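(* The tiling algebras are precisely the gentle algebras for which every cycle is oriented and relation-full. That is, a (basic, connected) algebra $\mathbf{k}Q/I$ is isomorphic to the tiling algebra $A_{\mathsf T}$ of some tiling $\mathsf T$ of a disc with at least two marked points on its boundary if and only if $\mathbf{k}Q/I$ is gentle and every cycle of $Q$ is oriented and relation-full.
   Context: $\mathbf{k}$ is an algebraically closed field; all quivers are finite, and all algebras are assumed connected (and nonzero). Paths are read from left to right. Tilings and tiling algebras. Let $\mathcal{P}$ be a disc with at least two marked points on the boundary. A tiling $\mathsf{T}$ of $\mathcal{P}$ is a collection of distinct, pairwise noncrossing interior diagonals (arcs joining two distinct marked points; a diagonal is determined by its endpoints, and an interior arc joining two neighbouring marked points is allowed); the regions they cut out are the tiles. The quiver $Q_{\mathsf T}$ has as vertices the interior diagonals of $\mathsf T$; two vertices are joined by an edge whenever the corresponding diagonals share a marked point and belong to the same tile; if $\alpha,\beta$ share the marked point $x$ and belong to the same tile, the edge is oriented $\alpha\to\beta$ if the rotation with minimal angle around $x$ sending $\alpha$ to $\beta$ is clockwise. The ideal $\mathsf{I}_{\mathsf T}$ is generated by the compositions of two successive arrows coming from the same tile. The tiling algebra is $A_{\mathsf T}=\mathbf{k}Q_{\mathsf T}/\mathsf{I}_{\mathsf T}$. Gentle algebras. An algebra is gentle if it is Morita equivalent to an algebra $\mathbf{k}Q/I$ such that: (1) each vertex of $Q$ is the starting point of at most two arrows and the endpoint of at most two arrows; (2) for each arrow $\alpha$ there is at most one arrow $\beta$ (with $\alpha\beta$ a path) such that $\alpha\beta\notin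 I$ and at most one arrow $\gamma$ such that $\gamma\alpha\notin I$; (3) for each arrow $\alpha$ there is at most one arrow $\delta$ such that $\alpha\delta\in I$ is a path and at most one arrow $\mu$ such that $\mu\alpha\in I$ is a path; (4) $I$ is generated by paths of length 2. It is assumed that quivers of gentle algebras have no loops or 2-cycles; algebras are considered up to Morita equivalence. A cycle of $Q$ is a cycle of the underlying graph without repeated vertices. An oriented cycle is relation-full if every pair of consecutive arrows in it is a zero relation in $I$. *)

(* Defs.v *)
From HB Require Import structures.
From mathcomp Require Import all_boot all_order all_algebra.
From mathcomp Require Import finmap.
From mathcomp Require Import boolp.
From mathcomp.multinomials Require Import monalg.

Set Implicit Arguments.
Unset Strict Implicit.
Unset Printing Implicit Defensive.

Import GRing.Theory.
Local Open Scope ring_scope.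
Local Open Scope quotient_scope.

(* MathComp's algType excludes the zero algebra, which occurs as a quotient
   and as the algebra of an empty tiling; a k-algebra is thus given by a ring
   with a morphism from k to its centre. *)
Record kalgebra (k : pzRingType) := KAlgebra {
  kalg_ring :> pzRingType;
  kalg_in : {rmorphism k -> kalg_ring};
  kalg_central : forall c x, kalg_in c * x = x * kalg_in c
}.
Arguments kalg_in {k} A : rename.

Record ideal (R : pzRingType) := Ideal {
  ideal_mem :> R -> Prop;
  ideal0 : ideal_mem 0;
  idealD : forall x y, ideal_mem x -> ideal_mem y -> ideal_mem (x + y);
  idealMl : forall a x, ideal_mem x -> ideal_mem (a * x);
  idealMr : forall a x, ideal_mem x -> ideal_mem (x * a)
}.

Section GeneratedIdeal.
Variables (R : pzRingType) (S : R -> Prop).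

Definition generated (x : R) : Prop :=
  forall J : ideal R, (forall y, S y -> J y) -> J x.

Fact generated0 : generated 0.
Proof. by move=> J _; apply: ideal0. Qed.

Fact generatedD x y : generated x -> generated y -> generated (x + y).
Proof. by move=> gx gy J sJ; apply: idealD; [apply: gx | apply: gy]. Qed.

Fact generatedMl a x : generated x -> generated (a * x).
Proof. by move=> gx J sJ; apply: idealMl; apply: gx. Qed.

Fact generatedMr a x : generated x -> generated (x * a).
Proof. by move=> gx J sJ; apply: idealMr; apply: gx. Qed.

Definition ideal_gen : ideal R :=
  Ideal generated0 generatedD generatedMl generatedMr.

End GeneratedIdeal.

Section QuotientRing.
Variables (A : pzRingType) (I : ideal A).

Lemma idealN x : I x -> I (- x).
Proof. by rewrite -mulN1r; apply: idealMl. Qed.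

Definition quot_eqv (x y : A) : bool := `[< I (x - y) >].

Fact quot_eqv_refl : reflexive quot_eqv.
Proof. by move=> x; apply/asboolP; rewrite subrr; apply: ideal0. Qed.

Fact quot_eqv_sym : symmetric quot_eqv.
Proof.
by move=> x y; apply/asboolP/asboolP => /idealN; rewrite opprB.
Qed.

Fact quot_eqv_trans : transitive quot_eqv.
Proof.
move=> y x z /asboolP xy /asboolP yz; apply/asboolP.
by rewrite -(subrKA y); apply: idealD.
Qed.

Canonical quot_equiv :=
  EquivRel quot_eqv quot_eqv_refl quot_eqv_sym quot_eqv_trans.

Definition quotring := {eq_quot quot_equiv}.
HB.instance Definition _ := Choice.on quotring.
HB.instance Definition _ := EqQuotient.on quotring.

Definition quot_pi (x : A) : quotring := \pi_quotring x.

Lemma quot_piP x y : quot_pi x = quot_pi y <-> I (x - y).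
Proof. by split=> [/eqmodP/asboolP //|Ixy]; apply/eqmodP/asboolP. Qed.

Lemma quot_repr x : I (repr (quot_pi x) - x).
Proof. by apply/quot_piP; rewrite /quot_pi reprK. Qed.

Lemma quot_ind (P : quotring -> Prop) : (forall x, P (quot_pi x)) -> forall u, P u.
Proof. by move=> Px u; rewrite -[u]reprK; apply: Px. Qed.

Definition quot_add (u v : quotring) := quot_pi (repr u + repr v).
Definition quot_opp (u : quotring) := quot_pi (- repr u).
Definition quot_mul (u v : quotring) := quot_pi (repr u * repr v).

Lemma quot_piD x y : quot_add (quot_pi x) (quot_pi y) = quot_pi (x + y).
Proof.
apply/quot_piP; rewrite opprD addrACA.
by apply: idealD; apply: quot_repr.
Qed.

Lemma quot_piN x : quot_opp (quot_pi x) = quot_pi (- x).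
Proof. by apply/quot_piP; rewrite -opprD; apply/idealN/quot_repr. Qed.

Lemma quot_piM x y : quot_mul (quot_pi x) (quot_pi y) = quot_pi (x * y).
Proof.
apply/quot_piP; rewrite -(subrKA (x * repr (quot_pi y))) -mulrBl -mulrBr.
by apply: idealD; [apply: idealMr | apply: idealMl]; apply: quot_repr.
Qed.

Let quotE := (quot_piD, quot_piN, quot_piM).

Fact quot_addA : associative quot_add.
Proof. by do 3![elim/quot_ind=> ?]; rewrite !quotE addrA. Qed.
Fact quot_addC : commutative quot_add.
Proof. by do 2![elim/quot_ind=> ?]; rewrite !quotE addrC. Qed.
Fact quot_add0 : left_id (quot_pi 0) quot_add.
Proof. by elim/quot_ind=> ?; rewrite !quotE add0r. Qed.
Fact quot_addN : left_inverse (quot_pi 0) quot_opp quot_add.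
Proof. by elim/quot_ind=> ?; rewrite !quotE addNr. Qed.

HB.instance Definition _ :=
  GRing.isZmodule.Build quotring quot_addA quot_addC quot_add0 quot_addN.

Fact quot_mulA : associative quot_mul.
Proof. by do 3![elim/quot_ind=> ?]; rewrite !quotE mulrA. Qed.
Fact quot_mul1 : left_id (quot_pi 1) quot_mul.
Proof. by elim/quot_ind=> ?; rewrite !quotE mul1r. Qed.
Fact quot_mulr1 : right_id (quot_pi 1) quot_mul.
Proof. by elim/quot_ind=> ?; rewrite !quotE mulr1. Qed.
Fact quot_mulDl : left_distributive quot_mul +%R.
Proof.
do 3![elim/quot_ind=> ?]; rewrite [_ + _ in LHS]quot_piD !quotE mulrDl.
by rewrite [RHS]quot_piD.
Qed.
Fact quot_mulDr : right_distributive quot_mul +%R.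
Proof.
do 3![elim/quot_ind=> ?]; rewrite [_ + _ in LHS]quot_piD !quotE mulrDr.
by rewrite [RHS]quot_piD.
Qed.

HB.instance Definition _ := GRing.Zmodule_isPzRing.Build quotring
  quot_mulA quot_mul1 quot_mulr1 quot_mulDl quot_mulDr.

Fact quot_pi_zmod_morphism : zmod_morphism quot_pi.
Proof.
move=> x y; rewrite -quot_piD -quot_piN.
by change (quot_pi x - quot_pi y = quot_pi x - quot_pi y).
Qed.
Fact quot_pi_monoid_morphism : monoid_morphism quot_pi.
Proof. by split=> // x y; rewrite -quot_piM. Qed.

HB.instance Definition _ :=
  GRing.isZmodMorphism.Build A quotring quot_pi quot_pi_zmod_morphism.
HB.instance Definition _ :=
  GRing.isMonoidMorphism.Build A quotring quot_pi quot_pi_monoid_morphism.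

End QuotientRing.

Section QuotientAlgebra.
Variables (k : pzRingType) (A : kalgebra k) (I : ideal A).

Definition quot_in : {rmorphism k -> quotring I} := @quot_pi A I \o kalg_in A.

Fact quot_in_central c u : quot_in c * u = u * quot_in c.
Proof.
elim/quot_ind: u => x; rewrite /quot_in /=.
by rewrite -!rmorphM kalg_central.
Qed.

Definition quotalg : kalgebra k := KAlgebra quot_in_central.

End QuotientAlgebra.

Definition alg_isomorphic (k : pzRingType) (A B : kalgebra k) : Prop :=
  exists f : {rmorphism A -> B},
    bijective f /\ forall c : k, f (kalg_in A c) = kalg_in B c.

Definition alg_connected (k : pzRingType) (A : kalgebra k) : Prop :=
  (1 : A) <> 0 /\
  forall e : A, e * e = e -> (forall x, e * x = x * e) -> e = 0 \/ e = 1.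

(* A k-linear functor between the categories of left modules. Morphisms are
   compared pointwise. *)
Record module_functor (k : pzRingType) (A B : kalgebra k) := ModuleFunctor {
  fun_obj :> lmodType A -> lmodType B;
  fun_hom : forall M N : lmodType A,
    {linear M -> N} -> {linear fun_obj M -> fun_obj N};
  fun_hom_id : forall (M : lmodType A) (f : {linear M -> M}),
    f =1 id -> fun_hom f =1 id;
  fun_hom_comp : forall (L M N : lmodType A) (f : {linear L -> M})
      (g : {linear M -> N}) (h : {linear L -> N}),
    h =1 g \o f -> fun_hom h =1 fun_hom g \o fun_hom f;
  fun_hom_linear : forall (M N : lmodType A) (c : k) (f g h : {linear M -> N}),
    (forall x, h x = kalg_in A c *: f x + g x) ->
    forall y, fun_hom h y = kalg_in B c *: fun_hom f y + fun_hom g y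
}.

Definition is_equivalence (k : pzRingType) (A B : kalgebra k)
    (F : module_functor A B) : Prop :=
  [/\ forall (M N : lmodType A) (f g : {linear M -> N}),
        fun_hom F f =1 fun_hom F g -> f =1 g,
      forall (M N : lmodType A) (g : {linear F M -> F N}),
        exists f : {linear M -> N}, fun_hom F f =1 g &
      forall N : lmodType B,
        exists (M : lmodType A) (g : {linear F M -> N}), bijective g].

Definition morita_equivalent (k : pzRingType) (A B : kalgebra k) : Prop :=
  exists F : module_functor A B, is_equivalence F.

Record quiver := Quiver {
  vert : finType;
  arr : finType;
  src : arr -> vert;
  tgt : arr -> vert
}.

Section Paths.
Variable Q : quiver.

Fixpoint walk (v : vert Q) (s : seq (arr Q)) : bool :=
  if s is a :: s' then (src a == v) && walk (tgt a) s' else true.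

(* A path is its starting vertex with its sequence of arrows, read from left
   to right. *)
Definition qpath := {p : vert Q * seq (arr Q) | walk p.1 p.2}.
HB.instance Definition _ := Choice.on qpath.
HB.instance Definition _ := SubChoice.on qpath.

Definition pstart (p : qpath) : vert Q := (val p).1.
Definition parrows (p : qpath) : seq (arr Q) := (val p).2.
Definition pend (p : qpath) : vert Q := last (pstart p) (map (@tgt Q) (parrows p)).
Definition plength (p : qpath) : nat := size (parrows p).

Definition trivial_path (v : vert Q) : qpath := exist _ (v, [::]) isT.

Fact walk_arrow (a : arr Q) : walk (src a) [:: a].
Proof. by rewrite /= eqxx. Qed.

Definition arrow_path (a : arr Q) : qpath := exist _ (src a, [:: a]) (walk_arrow a).

(* Meaningful only when pend p = pstart q. *)
Definition pcat (p q : qpath) : qpath :=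
  insubd p (pstart p, parrows p ++ parrows q).

Lemma walk_cat v s t :
  walk v (s ++ t) = walk v s && walk (last v (map (@tgt Q) s)) t.
Proof. by elim: s v => //= a s IHs v; rewrite IHs andbA. Qed.

Lemma val_pcat p q : pend p = pstart q ->
  val (pcat p q) = (pstart p, parrows p ++ parrows q).
Proof.
move=> pq; apply: insubdK; rewrite unfold_in /= walk_cat.
by rewrite -/(pend p) pq (valP p) (valP q).
Qed.

Lemma pstart_cat p q : pend p = pstart q -> pstart (pcat p q) = pstart p.
Proof. by move=> pq; rewrite /pstart val_pcat. Qed.

Lemma parrows_cat p q : pend p = pstart q ->
  parrows (pcat p q) = parrows p ++ parrows q.
Proof. by move=> pq; rewrite /parrows val_pcat. Qed.

Lemma pend_cat p q : pend p = pstart q -> pend (pcat p q) = pend q.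
Proof.
move=> pq; rewrite /pend pstart_cat // parrows_cat // map_cat last_cat.
by rewrite -/(pend p) pq.
Qed.

Lemma qpathP p q : pstart p = pstart q -> parrows p = parrows q -> p = q.
Proof.
move=> e1 e2; apply: val_inj.
by rewrite [val p]surjective_pairing [val q]surjective_pairing; congr pair.
Qed.

Lemma pcatA p q r : pend p = pstart q -> pend q = pstart r ->
  pcat p (pcat q r) = pcat (pcat p q) r.
Proof.
move=> pq qr; have pqr : pend p = pstart (pcat q r) by rewrite pstart_cat.
have pqr' : pend (pcat p q) = pstart r by rewrite pend_cat.
apply: qpathP; first by rewrite !pstart_cat.
by rewrite !parrows_cat // catA.
Qed.

Lemma pcat_trivl p : pcat (trivial_path (pstart p)) p = p.
Proof. by apply: qpathP; rewrite ?pstart_cat ?parrows_cat. Qed.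

Lemma pcat_trivr p : pcat p (trivial_path (pend p)) = p.
Proof. by apply: qpathP; rewrite ?pstart_cat ?parrows_cat ?cats0. Qed.

End Paths.

HB.lock Definition pathU (k : comNzRingType) (Q : quiver) (p : qpath Q) :
  {malg k[qpath Q]} := << 1 *g p >>.
Canonical pathU_unlockable := Unlockable pathU.unlock.
Arguments pathU k {Q} p.

Definition pprod (k : comNzRingType) (Q : quiver) (p q : qpath Q) :
    {malg k[qpath Q]} :=
  if pend p == pstart q then pathU k (pcat p q) else 0.
Arguments pprod {k Q} p q.

HB.lock Definition palg_mul (k : comNzRingType) (Q : quiver)
    (f g : {malg k[qpath Q]}) : {malg k[qpath Q]} :=
  \sum_(p <- msupp f) \sum_(q <- msupp g) (f@_p * g@_q) *: pprod p q.
Canonical palg_mul_unlockable := Unlockable palg_mul.unlock.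

Section PathAlgebra.
Variables (k : comNzRingType) (Q : quiver).

Definition palg := {malg k[qpath Q]}.
HB.instance Definition _ := GRing.Lmodule.on palg.

Implicit Types (p q r : qpath Q) (f g h : palg).
Local Notation pathU := (@pathU k Q).
Local Notation pprod := (@pprod k Q).
Local Notation palg_mul := (@palg_mul k Q).

Definition palg_one : palg := \sum_(v : vert Q) pathU (trivial_path v).

Lemma palg_mulw (d1 d2 : {fset qpath Q}) f g :
  (msupp f `<=` d1)%fset -> (msupp g `<=` d2)%fset ->
  palg_mul f g = \sum_(p <- d1) \sum_(q <- d2) (f@_p * g@_q) *: pprod p q.
Proof.
move=> le1 le2; rewrite unlock (big_fset_incl _ le1) /=.
  apply: eq_bigr => p _; apply: big_fset_incl => // q _ /mcoeff_outdom ->.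
  by rewrite mulr0 scale0r.
move=> p _ /mcoeff_outdom fp; rewrite big1 // => q _.
by rewrite fp mul0r scale0r.
Qed.

Lemma palg_mulDl : left_distributive palg_mul +%R.
Proof.
move=> f g h.
rewrite (palg_mulw (msuppD_le f g) (fsubset_refl _)).
rewrite (palg_mulw (fsubsetUl (msupp f) (msupp g)) (fsubset_refl (msupp h))).
rewrite (palg_mulw (fsubsetUr (msupp f) (msupp g)) (fsubset_refl (msupp h))).
rewrite -big_split /=; apply: eq_bigr => p _.
rewrite -big_split /=; apply: eq_bigr => q _.
by rewrite mcoeffD mulrDl scalerDl.
Qed.

Lemma palg_mulDr : right_distributive palg_mul +%R.
Proof.
move=> h f g.
rewrite (palg_mulw (fsubset_refl _) (msuppD_le f g)).
rewrite (palg_mulw (fsubset_refl (msupp h)) (fsubsetUl (msupp f) (msupp g))).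
rewrite (palg_mulw (fsubset_refl (msupp h)) (fsubsetUr (msupp f) (msupp g))).
rewrite -big_split /=; apply: eq_bigr => p _.
rewrite -big_split /=; apply: eq_bigr => q _.
by rewrite mcoeffD mulrDr scalerDl.
Qed.

Lemma palg_mulZl c f g : palg_mul (c *: f) g = c *: palg_mul f g.
Proof.
rewrite (palg_mulw (msuppZ_le c f) (fsubset_refl _)).
rewrite [in RHS](palg_mulw (fsubset_refl (msupp f)) (fsubset_refl (msupp g))) scaler_sumr.
apply: eq_bigr => p _; rewrite scaler_sumr; apply: eq_bigr => q _.
by rewrite mcoeffZ scalerA mulrA.
Qed.

Lemma palg_mulZr c f g : palg_mul f (c *: g) = c *: palg_mul f g.
Proof.
rewrite (palg_mulw (fsubset_refl _) (msuppZ_le c g)).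
rewrite [in RHS](palg_mulw (fsubset_refl (msupp f)) (fsubset_refl (msupp g))) scaler_sumr.
apply: eq_bigr => p _; rewrite scaler_sumr; apply: eq_bigr => q _.
by rewrite mcoeffZ scalerA mulrCA.
Qed.

Lemma palg_mul0l g : palg_mul 0 g = 0.
Proof. by have := palg_mulZl 0 0 g; rewrite !scale0r. Qed.

Lemma palg_mul0r f : palg_mul f 0 = 0.
Proof. by have := palg_mulZr 0 f 0; rewrite !scale0r. Qed.

Lemma palg_mul_suml (J : Type) (s : seq J) (F : J -> palg) g :
  palg_mul (\sum_(i <- s) F i) g = \sum_(i <- s) palg_mul (F i) g.
Proof.
exact: (big_morph (palg_mul^~ g) (fun x y => palg_mulDl x y g) (palg_mul0l g)).
Qed.

Lemma palg_mul_sumr (J : Type) (s : seq J) (F : J -> palg) f :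
  palg_mul f (\sum_(i <- s) F i) = \sum_(i <- s) palg_mul f (F i).
Proof. exact: (big_morph (palg_mul f) (palg_mulDr f) (palg_mul0r f)). Qed.

Lemma palg_mulUU p q : palg_mul (pathU p) (pathU q) = pprod p q.
Proof.
rewrite pathU.unlock (palg_mulw msuppU_le msuppU_le) !big_seq_fset1.
by rewrite !mcoeffUU mulr1 scale1r.
Qed.

Lemma palgE f : f = \sum_(p <- msupp f) f@_p *: pathU p.
Proof.
rewrite [LHS]monalgE; apply: eq_bigr => p _; apply/malgP => q.
by rewrite pathU.unlock [RHS]mcoeffZ [LHS]mcoeffU mcoeffU mulrnAr mulr1.
Qed.

Lemma palg_ind (P : palg -> Prop) : P 0 ->
  (forall f g, P f -> P g -> P (f + g)) ->
  (forall c f, P f -> P (c *: f)) ->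
  (forall p, P (pathU p)) -> forall f, P f.
Proof.
move=> P0 PD PZ PU f; rewrite [f]palgE.
by apply: (big_ind P) => // p _; apply: PZ.
Qed.

Lemma pprodE p q : pend p = pstart q -> pprod p q = pathU (pcat p q).
Proof. by move=> pq; rewrite /pprod pq eqxx. Qed.

Lemma pprod0 p q : pend p != pstart q -> pprod p q = 0.
Proof. by rewrite /pprod => /negPf ->. Qed.

Lemma pprodA p q r :
  palg_mul (pathU p) (pprod q r) = palg_mul (pprod p q) (pathU r).
Proof.
have [pq|pq] := eqVneq (pend p) (pstart q);
  have [qr|qr] := eqVneq (pend q) (pstart r).
- have pqr : pend p = pstart (pcat q r) by rewrite pstart_cat.
  have pqr' : pend (pcat p q) = pstart r by rewrite pend_cat.
  rewrite (pprodE pq) (pprodE qr) [LHS]palg_mulUU [RHS]palg_mulUU.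
  by rewrite (pprodE pqr) (pprodE pqr') (pcatA pq qr).
- have pqr : pend (pcat p q) != pstart r by rewrite pend_cat.
  rewrite (pprod0 qr) (pprodE pq) [LHS]palg_mul0r [RHS]palg_mulUU.
  by rewrite (pprod0 pqr).
- have pqr : pend p != pstart (pcat q r) by rewrite pstart_cat.
  rewrite (pprod0 pq) (pprodE qr) [LHS]palg_mulUU [RHS]palg_mul0l.
  by rewrite (pprod0 pqr).
- by rewrite (pprod0 pq) (pprod0 qr) [LHS]palg_mul0r [RHS]palg_mul0l.
Qed.

Fact palg_mulA : associative palg_mul.
Proof.
move=> f g h; elim/palg_ind: f => [|f1 f2 e1 e2|c f e|p].
- by rewrite !palg_mul0l.
- by rewrite !palg_mulDl e1 e2.
- rewrite [LHS]palg_mulZl [in RHS](palg_mulZl c f g).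
  by rewrite [RHS]palg_mulZl -e.
elim/palg_ind: g => [|f1 f2 e1 e2|c f e|q].
- by rewrite palg_mul0l palg_mul0r palg_mul0l.
- rewrite [in LHS](palg_mulDl f1 f2) [in RHS](palg_mulDr (pathU p) f1 f2).
  by rewrite [LHS]palg_mulDr [RHS]palg_mulDl -e1 -e2.
- rewrite (palg_mulZl c f h) [in RHS](palg_mulZr c (pathU p) f).
  by rewrite [RHS]palg_mulZl [LHS]palg_mulZr -e.
elim/palg_ind: h => [|f1 f2 e1 e2|c f e|r].
- by rewrite !palg_mul0r.
- rewrite [in LHS](palg_mulDr (pathU q) f1 f2) [LHS]palg_mulDr.
  by rewrite [RHS]palg_mulDr -e1 -e2.
- rewrite [in LHS](palg_mulZr c (pathU q) f) [LHS]palg_mulZr.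
  by rewrite [RHS]palg_mulZr -e.
by rewrite !palg_mulUU pprodA.
Qed.

Fact palg_mul1l : left_id palg_one palg_mul.
Proof.
elim/palg_ind=> [|f1 f2 e1 e2|c f e|p].
- by rewrite palg_mul0r.
- by rewrite palg_mulDr e1 e2.
- by rewrite palg_mulZr e.
rewrite palg_mul_suml (bigD1 (pstart p)) //= palg_mulUU pprodE // pcat_trivl.
by rewrite big1 ?addr0 // => v vp; rewrite palg_mulUU pprod0.
Qed.

Fact palg_mul1r : right_id palg_one palg_mul.
Proof.
elim/palg_ind=> [|f1 f2 e1 e2|c f e|p].
- by rewrite palg_mul0l.
- by rewrite palg_mulDl e1 e2.
- by rewrite palg_mulZl e.
rewrite palg_mul_sumr (bigD1 (pend p)) //= palg_mulUU pprodE // pcat_trivr.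
by rewrite big1 ?addr0 // => v vp; rewrite palg_mulUU pprod0 // eq_sym.
Qed.

HB.instance Definition _ := GRing.Zmodule_isPzRing.Build palg
  palg_mulA palg_mul1l palg_mul1r palg_mulDl palg_mulDr.

Definition palg_const (c : k) : palg := c *: palg_one.

Fact palg_const_zmod_morphism : zmod_morphism palg_const.
Proof. by move=> c d; rewrite /palg_const scalerBl. Qed.
Fact palg_const_monoid_morphism : monoid_morphism palg_const.
Proof.
split=> [|c d]; rewrite /palg_const ?scale1r //.
by rewrite [RHS]palg_mulZl palg_mul1l scalerA.
Qed.

HB.instance Definition _ :=
  GRing.isZmodMorphism.Build k palg palg_const palg_const_zmod_morphism.
HB.instance Definition _ :=
  GRing.isMonoidMorphism.Build k palg palg_const palg_const_monoid_morphism.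

Fact palg_const_central c f : palg_const c * f = f * palg_const c.
Proof.
rewrite [LHS]palg_mulZl [RHS]palg_mulZr; congr (c *: _).
by rewrite [LHS]palg_mul1l [RHS]palg_mul1r.
Qed.

Definition pathalg : kalgebra k := KAlgebra palg_const_central.

Definition arrU (a : arr Q) : pathalg := pathU (arrow_path a).

End PathAlgebra.

Section Gentle.
Variable k : comNzRingType.

(* R^N <= I <= R^2 for some N, where R is the ideal generated by the arrows;
   R^N is spanned by the paths of length at least N. *)
Definition admissible (Q : quiver) (I : ideal (pathalg k Q)) : Prop :=
  (forall x, I x -> forall p, p \in msupp x -> (2 <= plength p)%N) /\
  (exists N, forall p : qpath Q, (N <= plength p)%N -> I (pathU k p)).

Definition gentle_presentation (Q : quiver) (I : ideal (pathalg k Q)) : Prop :=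
  [/\ (forall a : arr Q, src a <> tgt a) /\
      (forall a b : arr Q, tgt a = src b -> tgt b <> src a),
      forall v : vert Q, (#|[set a : arr Q | src a == v]| <= 2)%N /\
                         (#|[set a : arr Q | tgt a == v]| <= 2)%N,
      forall a : arr Q,
        (forall b b', tgt a = src b -> tgt a = src b' ->
           ~ I (arrU k a * arrU k b) -> ~ I (arrU k a * arrU k b') -> b = b') /\
        (forall c c', tgt c = src a -> tgt c' = src a ->
           ~ I (arrU k c * arrU k a) -> ~ I (arrU k c' * arrU k a) -> c = c'),
      forall a : arr Q,
        (forall b b', tgt a = src b -> tgt a = src b' ->
           I (arrU k a * arrU k b) -> I (arrU k a * arrU k b') -> b = b') /\
        (forall c c', tgt c = src a -> tgt c' = src a ->
           I (arrU k c * arrU k a) -> I (arrU k c' * arrU k a) -> c = c') &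
      exists S : qpath Q -> Prop, (forall p, S p -> plength p = 2%N) /\
        forall x, I x <->
          ideal_gen (fun y : pathalg k Q => exists2 p, S p & y = pathU k p) x].

Definition gentle (A : kalgebra k) : Prop :=
  exists (Q : quiver) (I : ideal (pathalg k Q)),
    gentle_presentation I /\ morita_equivalent A (quotalg I).

Section Cycles.
Variable Q : quiver.

(* A step traverses an arrow forwards (true) or backwards (false). *)
Definition step := (arr Q * bool)%type.
Definition step_start (s : step) : vert Q := if s.2 then src s.1 else tgt s.1.
Definition step_end (s : step) : vert Q := if s.2 then tgt s.1 else src s.1.

(* A cycle of the underlying multigraph; distinctness of the arrows only
   excludes going back and forth along a single arrow. *)
Definition graph_cycle (c : seq step) : bool :=
  [&& c != [::], cycle (fun s t => step_end s == step_start t) c,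
      uniq (map step_start c) & uniq (map fst c)].

Definition oriented (c : seq step) : bool :=
  all (fun s => s.2) c || all (fun s => ~~ s.2) c.

(* As the vertices of a cycle are distinct, the consecutive pairs of arrows of
   an oriented cycle are its pairs (a, b) with tgt a = src b. *)
Definition relation_full (I : ideal (pathalg k Q)) (c : seq step) : Prop :=
  forall a b : arr Q, a \in map fst c -> b \in map fst c -> tgt a = src b ->
    I (arrU k a * arrU k b).

End Cycles.
End Gentle.

Section TilingQuiver.
Variable m : nat.

(* The marked points 0, ..., m - 1 are in clockwise order on the boundary; the
   boundary segment i goes from i to i + 1 modulo m. A diagonal is the pair of
   its endpoints in increasing order. *)
Notation diagonal := ('I_m * 'I_m)%type.

Definition crossing (d e : diagonal) : bool :=
  [|| (d.1 < e.1 < d.2)%N && (d.2 < e.2)%N | (e.1 < d.1 < e.2)%N && (e.2 < d.2)%N].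

Definition is_tiling (T : {set diagonal}) : Prop :=
  (forall d, d \in T -> (d.1 < d.2)%N) /\
  (forall d e, d \in T -> e \in T -> ~~ crossing d e).

Variable T : {set diagonal}.

Definition tdiag := {d : diagonal | d \in T}.
HB.instance Definition _ := Finite.on tdiag.

(* The two half-discs cut out by a diagonal, as sets of boundary segments. *)
Definition half_disc (d : tdiag) (b : bool) : {set 'I_m} :=
  let H := [set i : 'I_m | ((val d).1 <= i < (val d).2)%N] in
  if b then H else ~: H.

(* A region cut out by T is recorded by the half-disc containing it, for each
   diagonal of T. For noncrossing diagonals, a choice of half-discs arises from
   a region if and only if any two of them meet, and two half-discs of distinct
   noncrossing diagonals meet if and only if they share a boundary segment. *)
Definition tile (P : {ffun tdiag -> bool}) : bool :=
  [forall d, forall e, half_disc d (P d) :&: half_disc e (P e) != set0].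

(* The diagonal d is a side of the tile P when P has a neighbour across d. *)
Definition side (P : {ffun tdiag -> bool}) (d : tdiag) : bool :=
  tile [ffun e => if e == d then ~~ P e else P e].

Definition endpoint (d : tdiag) (x : 'I_m) : bool :=
  (x == (val d).1) || (x == (val d).2).

Definition other_end (d : tdiag) (x : 'I_m) : 'I_m :=
  if x == (val d).1 then (val d).2 else (val d).1.

(* Number of boundary segments from x clockwise to y. A diagonal at x turns
   clockwise around x as its other end y moves clockwise away from x. *)
Definition cw_dist (x y : 'I_m) : nat := ((y + (m - x)) %% m)%N.

Definition tarrow (d e : tdiag) : bool :=
  [exists P, [&& tile P, side P d & side P e]] &&
  [exists x, [&& endpoint d x, endpoint e x &
     (cw_dist x (other_end d x) < cw_dist x (other_end e x))%N]].

Definition tarr := {de : tdiag * tdiag | tarrow de.1 de.2}.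
HB.instance Definition _ := Finite.on tarr.

Definition tiling_quiver : quiver :=
  @Quiver tdiag tarr (fun a => (val a).1) (fun a => (val a).2).

Definition tiling_relation (a b : arr tiling_quiver) : Prop :=
  tgt a = src b /\
  exists P, [/\ tile P, side P (src a), side P (tgt a) & side P (tgt b)].

Definition tiling_ideal (k : comNzRingType) : ideal (pathalg k tiling_quiver) :=
  ideal_gen (fun x : pathalg k tiling_quiver =>
    exists a b, tiling_relation a b /\ x = arrU k a * arrU k b).

Definition tiling_algebra (k : comNzRingType) : kalgebra k :=
  quotalg (tiling_ideal k).

End TilingQuiver.

(* Main.v *)
From HB Require Import structures.
From mathcomp Require Import all_boot all_order all_algebra.
From mathcomp Require Import finmap boolp zify.
From mathcomp.multinomials Require Import monalg.
Require Import Defs.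

(** In a tiling the arcs at a marked point are linearly ordered clockwise. An
    arrow of the tiling quiver goes from an arc to its immediate successor at a
    common endpoint, its pivot, and the composition of two arrows is a relation
    exactly when their pivots differ. As an arc has two endpoints, the tiling
    algebra is gentle; as an arc separates the others, the arcs of a cycle are
    sides of one tile.

    Conversely, a gentle quiver with oriented relation-full cycles is realised by
    adding vertices one at a time to a connected set. A new vertex has one
    neighbour, and splitting a marked point makes room for its arc, or it closes
    an oriented cycle, and its arc closes up a chain of successive arcs into a
    tile.

    The presentation of a gentle algebra is only given up to Morita equivalence.
    An equivalence matches the indecomposable projectives, since the corners of
    a quadratic monomial algebra have only trivial idempotents; this gives an
    isomorphism matching the vertices. When there are no loops and cycles are
    relation-full, no other nonzero path is parallel to an arrow, so the
    isomorphism rescales the arrows and therefore preserves the relations. *)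

Set Implicit Arguments.
Unset Strict Implicit.
Unset Printing Implicit Defensive.

Import GRing.Theory.
Local Open Scope ring_scope.
Local Open Scope quotient_scope.

(** * Modules and equivalences *)

(** The cycle condition speaks of the given quiver, while gentleness provides another one, so the
    condition has to be carried along the isomorphism in both directions. The bridge is the
    filtration by path length: an arrow that is not a loop lies in a corner between distinct
    vertices, so its image has no trivial part, and an isomorphism matching the vertex idempotents
    preserves the filtration. The absence of loops is therefore settled before anything else is
    transferred. The two presentations also differ in strength: the given ideal is admissible, so
    its radical is nilpotent and an element of a corner with character 1 is invertible there,
    whereas a gentle presentation may have arbitrarily long nonzero paths, and only the vanishing of
    the intersection of the powers of its radical is available. When a tiling is built, the cycle
    condition excludes parallel arrows, so a relation on vertices encodes the quiver. Connectedness
    of the part already built restricts a new vertex: two incoming or two outgoing neighbours would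
    be joined by a path inside it and give a cycle that is not oriented. *)

Definition mklin (R : pzRingType) (M N : lmodType R) (f : M -> N)
    (fl : linear f) : {linear M -> N} :=
  HB.pack f (GRing.isLinear.Build R M N _ f fl).

Section Restriction.
Variables (A B : pzRingType) (g : {rmorphism B -> A}) (M : lmodType A).

(** The morphism is a phantom argument: the same additive group [M] carries a module structure for
    each [h], and the type records which one is meant. *)
Definition restr (h : {rmorphism B -> A}) : Type := M.
HB.instance Definition _ := GRing.Zmodule.on (restr g).

Definition restr_scale (b : B) (x : restr g) : restr g := g b *: (x : M).

Fact restr_scaleA b c x :
  restr_scale b (restr_scale c x) = restr_scale (b * c) x.
Proof. by rewrite /restr_scale scalerA rmorphM. Qed.
Fact restr_scale1 : left_id 1 restr_scale.
Proof. by move=> x; rewrite /restr_scale rmorph1 scale1r. Qed.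
Fact restr_scaleDr : right_distributive restr_scale +%R.
Proof. by move=> b x y; rewrite /restr_scale scalerDr. Qed.
Fact restr_scaleDl x : {morph restr_scale^~ x : b c / b + c}.
Proof. by move=> b c; rewrite /restr_scale rmorphD scalerDl. Qed.

HB.instance Definition _ := GRing.Zmodule_isLmodule.Build B (restr g)
  restr_scaleA restr_scale1 restr_scaleDr restr_scaleDl.

End Restriction.
Arguments restr {A B} M h.

Section QuotientModule.
Variables (R : pzRingType) (X Y : lmodType R) (f : {linear X -> Y}).

(** The cokernel of [f] serves to show that an equivalence preserves surjections. *)
Definition coker_eqv (x y : Y) : bool := `[< exists z, x - y = f z >].

Fact coker_eqv_refl : reflexive coker_eqv.
Proof. by move=> x; apply/asboolP; exists 0; rewrite subrr linear0. Qed.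
Fact coker_eqv_sym : symmetric coker_eqv.
Proof.
by move=> x y; apply/asboolP/asboolP => -[z e]; exists (- z);
  rewrite linearN -e opprB.
Qed.
Fact coker_eqv_trans : transitive coker_eqv.
Proof.
move=> y x z /asboolP[u eu] /asboolP[v ev]; apply/asboolP; exists (u + v).
by rewrite linearD -eu -ev subrKA.
Qed.

Canonical coker_equiv :=
  EquivRel coker_eqv coker_eqv_refl coker_eqv_sym coker_eqv_trans.

Definition coker := {eq_quot coker_equiv}.
HB.instance Definition _ := Choice.on coker.
HB.instance Definition _ := EqQuotient.on coker.

Definition coker_pi (x : Y) : coker := \pi_coker x.

Lemma coker_piP x y : coker_pi x = coker_pi y <-> exists z, x - y = f z.
Proof. by split=> [/eqmodP/asboolP //|e]; apply/eqmodP/asboolP. Qed.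

Lemma coker_repr x : exists z, repr (coker_pi x) - x = f z.
Proof. by apply/coker_piP; rewrite /coker_pi reprK. Qed.

Lemma coker_ind (P : coker -> Prop) :
  (forall x, P (coker_pi x)) -> forall u, P u.
Proof. by move=> Px u; rewrite -[u]reprK; apply: Px. Qed.

Definition coker_add (u v : coker) := coker_pi (repr u + repr v).
Definition coker_opp (u : coker) := coker_pi (- repr u).
Definition coker_scale (a : R) (u : coker) := coker_pi (a *: repr u).

Lemma coker_piD x y : coker_add (coker_pi x) (coker_pi y) = coker_pi (x + y).
Proof.
apply/coker_piP; have [u eu] := coker_repr x; have [v ev] := coker_repr y.
by exists (u + v); rewrite opprD addrACA eu ev linearD.
Qed.

Lemma coker_piN x : coker_opp (coker_pi x) = coker_pi (- x).
Proof.
apply/coker_piP; have [u eu] := coker_repr x.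
by exists (- u); rewrite -opprD eu linearN.
Qed.

Lemma coker_piZ a x : coker_scale a (coker_pi x) = coker_pi (a *: x).
Proof.
apply/coker_piP; have [u eu] := coker_repr x.
by exists (a *: u); rewrite -scalerBr eu linearZ.
Qed.

Let cokerE := (coker_piD, coker_piN, coker_piZ).

Fact coker_addA : associative coker_add.
Proof. by do 3![elim/coker_ind=> ?]; rewrite !cokerE addrA. Qed.
Fact coker_addC : commutative coker_add.
Proof. by do 2![elim/coker_ind=> ?]; rewrite !cokerE addrC. Qed.
Fact coker_add0 : left_id (coker_pi 0) coker_add.
Proof. by elim/coker_ind=> ?; rewrite !cokerE add0r. Qed.
Fact coker_addN : left_inverse (coker_pi 0) coker_opp coker_add.
Proof. by elim/coker_ind=> ?; rewrite !cokerE addNr. Qed.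

HB.instance Definition _ :=
  GRing.isZmodule.Build coker coker_addA coker_addC coker_add0 coker_addN.

Fact coker_scaleA a b u : coker_scale a (coker_scale b u) = coker_scale (a * b) u.
Proof. by elim/coker_ind: u => ?; rewrite !cokerE scalerA. Qed.
Fact coker_scale1 : left_id 1 coker_scale.
Proof. by elim/coker_ind=> ?; rewrite !cokerE scale1r. Qed.
Fact coker_scaleDr : right_distributive coker_scale +%R.
Proof.
move=> a; do 2![elim/coker_ind=> ?].
by rewrite [_ + _ in LHS]coker_piD !cokerE scalerDr [RHS]coker_piD.
Qed.
Fact coker_scaleDl u : {morph coker_scale^~ u : a b / a + b}.
Proof.
by elim/coker_ind: u => ? a b; rewrite !cokerE scalerDl [RHS]coker_piD.
Qed.

HB.instance Definition _ := GRing.Zmodule_isLmodule.Build R coker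
  coker_scaleA coker_scale1 coker_scaleDr coker_scaleDl.

Fact coker_pi_linear : linear coker_pi.
Proof. by move=> a x y; rewrite -coker_piD -coker_piZ. Qed.

HB.instance Definition _ :=
  GRing.isLinear.Build R Y coker _ coker_pi coker_pi_linear.

End QuotientModule.

Section CentralScaling.
Variables (k : pzRingType) (A : kalgebra k) (M N : lmodType A).

Fact kscale_linear c (f : {linear M -> N}) :
  linear (fun x => kalg_in A c *: f x).
Proof.
by move=> a x y; rewrite linearP scalerDr !scalerA kalg_central.
Qed.

Definition kscale c f : {linear M -> N} := mklin (kscale_linear c f).

Lemma kscaleE c f x : kscale c f x = kalg_in A c *: f x.
Proof. by []. Qed.

Lemma kscale0 f x : kscale 0 f x = 0.
Proof. by rewrite kscaleE rmorph0 scale0r. Qed.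

Fact orbit_linear (R : pzRingType) (X : lmodType R) (x : X) :
  linear (fun a : R^o => (a : R) *: x).
Proof. by move=> a b c; rewrite scalerDl scalerA. Qed.

End CentralScaling.

Definition orbit (R : pzRingType) (X : lmodType R) (x : X) : {linear R^o -> X} :=
  mklin (orbit_linear x).

Lemma orbitE (R : pzRingType) (X : lmodType R) (x : X) (a : R) :
  orbit x a = a *: x.
Proof. by []. Qed.

(* M is the A-module whose image under an equivalence is the free B-module of
   rank one, and theta b corresponds to the right multiplication by b. *)
Record progenerator (k : pzRingType) (A B : kalgebra k) := Progenerator {
  pg_mod : lmodType A;
  pg_end : B -> {linear pg_mod -> pg_mod};
  pg_end1 : forall x, pg_end 1 x = x;
  pg_endM : forall b c x, pg_end (b * c) x = pg_end c (pg_end b x);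
  pg_endD : forall b c x, pg_end (b + c) x = pg_end b x + pg_end c x;
  pg_endZ : forall c b x, pg_end (kalg_in B c * b) x = kalg_in A c *: pg_end b x;
  pg_end_inj : forall b c, pg_end b =1 pg_end c -> b = c;
  pg_end_surj : forall f : {linear pg_mod -> pg_mod}, exists b, pg_end b =1 f;
  pg_lift : forall (X Y : lmodType A) (g : {linear X -> Y})
      (h : {linear pg_mod -> Y}), (forall y, exists x, g x = y) ->
    exists l : {linear pg_mod -> X}, forall x, g (l x) = h x;
  pg_gen : forall (X : lmodType A) (x : X), x <> 0 ->
    exists (f : {linear pg_mod -> X}) (u : pg_mod), f u <> 0;
  pg_simple : forall chi : {rmorphism B -> k},
    (forall c, chi (kalg_in B c) = c) -> 1 <> 0 :> k ->
    exists (X : lmodType A) (t : {linear pg_mod -> X}),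
      [/\ exists u, t u <> 0,
          forall b u, t (pg_end b u) = kalg_in A (chi b) *: t u &
          forall h : {linear pg_mod -> X},
            exists c, forall u, h u = kalg_in A c *: t u]
}.

Section Equivalence.
Variables (k : comNzRingType) (A B : kalgebra k) (F : module_functor A B).
Hypothesis eqF : is_equivalence F.

Let Ffaithful := let: And3 h _ _ := eqF in h.
Let Ffull := let: And3 _ h _ := eqF in h.
Let Fess := let: And3 _ _ h := eqF in h.

(** Morphisms are compared pointwise, so invariance under pointwise equality has to be derived: it
    is the linearity axiom with coefficient 0. *)
Lemma fun_hom_ext (M N : lmodType A) (f g : {linear M -> N}) :
  f =1 g -> fun_hom F f =1 fun_hom F g.
Proof.
move=> fg y; rewrite (@fun_hom_linear _ _ _ F _ _ 0 f g f).
  by rewrite rmorph0 scale0r add0r.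
by move=> x; rewrite rmorph0 scale0r add0r.
Qed.

Lemma fun_homD (M N : lmodType A) (f g h : {linear M -> N}) :
  (forall x, h x = f x + g x) ->
  forall y, fun_hom F h y = fun_hom F f y + fun_hom F g y.
Proof.
move=> hfg y; rewrite (@fun_hom_linear _ _ _ F _ _ 1 f g h).
  by rewrite rmorph1 scale1r.
by move=> x; rewrite rmorph1 scale1r.
Qed.

Lemma fun_hom0 (M N : lmodType A) (f : {linear M -> N}) :
  (forall x, f x = 0) -> forall y, fun_hom F f y = 0.
Proof.
move=> f0 y; apply: (@addrI _ (fun_hom F f y)); rewrite addr0.
by rewrite -(@fun_homD _ _ f f f) // => x; rewrite f0 addr0.
Qed.

Lemma fun_homZ (M N : lmodType A) c (f h : {linear M -> N}) :
  (forall x, h x = kalg_in A c *: f x) ->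
  forall y, fun_hom F h y = kalg_in B c *: fun_hom F f y.
Proof.
move=> hf y; pose z := kscale 0 f.
have z0 x : z x = 0 by exact: kscale0.
rewrite (@fun_hom_linear _ _ _ F _ _ c f z h); first by rewrite (fun_hom0 z0) addr0.
by move=> x; rewrite z0 addr0.
Qed.

Lemma fun_homM (L M N : lmodType A) (f : {linear L -> M}) (g : {linear M -> N}) x :
  fun_hom F (g \o f) x = fun_hom F g (fun_hom F f x).
Proof. exact: (@fun_hom_comp _ _ _ F). Qed.

(** The projection onto the cokernel of [fun_hom F f] comes, by density and fullness, from some [h]
    on [Y]. By faithfulness [h] vanishes on the image of [f], which is all of [Y], so the projection
    is zero. *)
Lemma fun_hom_surj (X Y : lmodType A) (f : {linear X -> Y}) :
  (forall y, exists x, f x = y) -> forall y, exists x, fun_hom F f x = y.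
Proof.
move=> fs y; pose C : lmodType B := coker (fun_hom F f).
have [Z [g [g' gK g'K]]] := Fess C.
have pl : linear (fun y => g' (coker_pi (fun_hom F f) y)).
  by move=> a u v; apply: (can_inj gK); rewrite [RHS]linearP /= !g'K [LHS]linearP.
have [h hE] := Ffull (mklin pl).
have h0 u : h u = 0.
  have [v <-] := fs u; rewrite -(kscale0 (h \o f) v).
  apply: (@Ffaithful _ _ (h \o f)) => w; rewrite fun_homM hE.
  rewrite [RHS]fun_hom0; last exact: kscale0.
  apply: (can_inj gK); rewrite g'K linear0; apply/coker_piP.
  by exists w; rewrite subr0.
have : coker_pi (fun_hom F f) y = 0.
  by rewrite -[LHS]g'K -[g' _]hE fun_hom0 ?linear0.
by case/coker_piP=> x; rewrite subr0 => ->; exists x.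
Qed.

Section FreeImage.
Variables (M : lmodType A) (G : {linear F M -> B^o}) (g0 : F M).
Hypothesis Gg0 : G g0 = 1.
Hypothesis GK : forall y, (G y : B) *: g0 = y.

(** Evaluation at the generator [g0] identifies the homomorphisms from [M] to [X] with the elements
    of [F X]; identities between homomorphisms from [M] are checked through it. *)
Lemma free_hom (X : lmodType A) (x : F X) :
  exists f : {linear M -> X}, fun_hom F f g0 = x.
Proof.
have [f fE] := Ffull (orbit x \o G).
by exists f; rewrite fE /= Gg0 scale1r.
Qed.

Lemma free_hom_inj (X : lmodType A) (f g : {linear M -> X}) :
  fun_hom F f g0 = fun_hom F g g0 -> f =1 g.
Proof. by move=> e; apply: Ffaithful => y; rewrite -(GK y) !linearZZ /= e. Qed.

End FreeImage.

Lemma equivalence_progenerator : inhabited (progenerator A B).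
Proof.
have [M [G [G' GK G'K]]] := Fess B^o.
pose g0 := G' (1 : B).
have Gg0 : G g0 = 1 by rewrite G'K.
have Kg0 y : (G y : B) *: g0 = y.
  by apply: (can_inj GK); rewrite linearZZ /= Gg0 -[RHS]mulr1.
have ex (b : B) : {f : {linear M -> M} | fun_hom F f g0 = b *: g0}.
  by apply/cid/(free_hom Gg0).
pose th b := sval (ex b).
have thE b : fun_hom F (th b) g0 = b *: g0 by rewrite /th; case: (ex b).
have inj X := @free_hom_inj _ _ _ Kg0 X.
split; apply: (@Progenerator _ A B M th) => //.
- move=> x; apply: (inj _ (th 1) idfun).
  by rewrite thE scale1r (@fun_hom_id _ _ _ F).
- move=> b c x; apply: (inj _ (th (b * c)) (th c \o th b)).
  by rewrite fun_homM !thE linearZZ thE scalerA.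
- move=> b c x; apply: (inj _ (th (b + c)) (th b \+ th c)).
  by rewrite [RHS](@fun_homD _ _ (th b) (th c)) // !thE scalerDl.
- move=> c b x; apply: (inj _ (th (kalg_in B c * b)) (kscale c (th b))).
  by rewrite [RHS](@fun_homZ _ _ c (th b)) // !thE scalerA.
- move=> b c /fun_hom_ext/(_ g0); rewrite !thE => /(congr1 G).
  by rewrite !linearZZ /= Gg0 => e; rewrite -[b]mulr1 -[c]mulr1.
- by move=> f; exists (G (fun_hom F f g0)); apply: inj; rewrite thE Kg0.
- move=> X Y g h gs; have [x xE] := fun_hom_surj gs (fun_hom F h g0).
  have [l lE] := free_hom Gg0 x; exists l.
  by apply: (inj _ (g \o l) h); rewrite fun_homM lE.
(* If [F X] were zero, the identity and the zero map of [X] would have the same image under [F], and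
   [X] would be zero. *)
- move=> X x x0; have [[y y0]|all0] := pselect (exists y : F X, y <> 0).
    have [f fE] := free_hom Gg0 y; exists f.
    apply: contrapT => f0; apply: y0; rewrite -fE fun_hom0 // => u.
    by apply: contrapT => fu; apply: f0; exists u.
  pose o : {linear X -> X} := kscale 0 idfun.
  case: x0; rewrite -(kscale0 idfun x : o x = 0) -[LHS]/(idfun x).
  apply: (@Ffaithful _ _ idfun o) => y.
  rewrite [RHS]fun_hom0; last exact: kscale0.
  by apply: contrapT => e; apply: all0; exists (fun_hom F idfun y).
(* [X] corresponds to the one-dimensional [B]-module on which [B] acts through [chi]. *)
move=> chi chik nz; have [X [g [g' gK g'K]]] := Fess (restr k^o chi).
pose s := g' (1 : k); have gs : g s = (1 : k) by rewrite g'K.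
have sE y : kalg_in B (g y : k) *: s = y.
  apply: (can_inj gK); rewrite linearZZ gs.
  have e : chi (kalg_in B (g y : k)) * 1 = (g y : k) by rewrite chik mulr1.
  exact: e.
have [t tE] := free_hom Gg0 s; exists X, t; split.
- apply: contrapT => t0; apply: nz; rewrite -gs -tE fun_hom0 ?linear0 // => u.
  by apply: contrapT => tu; apply: t0; exists u.
- move=> b; apply: (inj _ (t \o th b) (kscale (chi b) t)).
  rewrite fun_homM thE [RHS](@fun_homZ _ _ (chi b) t) // linearZZ /= tE.
  apply: (can_inj gK); rewrite !linearZZ gs.
  have e : chi b * 1 = chi (kalg_in B (chi b)) * 1 by rewrite chik.
  exact: e.
- move=> h; exists (g (fun_hom F h g0)); apply: (inj _ h (kscale _ t)).
  by rewrite [RHS](@fun_homZ _ _ (g (fun_hom F h g0) : k) t) // tE sE.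
Qed.

End Equivalence.

(** * Quotients of path algebras *)

Section PathAlgebraTheory.
Variables (k : comNzRingType) (Q : quiver).
Implicit Types (p q r : qpath Q) (f g h : palg k Q) (D : qpath Q -> Prop).
Local Notation U := (pathU k).

Lemma palgZE c f : c *: f = kalg_in (pathalg k Q) c * f.
Proof. by rewrite [RHS]palg_mulZl [palg_mul _ _]palg_mul1l. Qed.

Lemma palgZl c f g : (c *: f) * g = c *: (f * g).
Proof. exact: palg_mulZl. Qed.

Lemma palgZr c f g : f * (c *: g) = c *: (f * g).
Proof. exact: palg_mulZr. Qed.

Lemma pathU_mul p q : (U p : palg k Q) * U q = pprod p q.
Proof. exact: palg_mulUU. Qed.

Lemma pathU_coef p q : (U p)@_q = (p == q)%:R.
Proof. by rewrite pathU.unlock mcoeffU. Qed.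

Definition supported D f := forall p, p \in msupp f -> D p.

Lemma supported0 D : supported D 0.
Proof. by move=> p; rewrite msupp0. Qed.

Lemma supportedD D f g : supported D f -> supported D g -> supported D (f + g).
Proof.
move=> sf sg p /(fsubsetP (msuppD_le f g)); rewrite in_fsetU => /orP[].
  exact: sf.
exact: sg.
Qed.

Lemma supportedZ D c f : supported D f -> supported D (c *: f).
Proof. by move=> sf p /(fsubsetP (msuppZ_le c f)); apply: sf. Qed.

Lemma supportedU D p : D p -> supported D (U p).
Proof.
move=> Dp q; rewrite pathU.unlock => /(fsubsetP msuppU_le).
by rewrite in_fset1 => /eqP->.
Qed.

Lemma supported_ind D (P : palg k Q -> Prop) : P 0 ->
  (forall f g, P f -> P g -> P (f + g)) ->
  (forall c f, P f -> P (c *: f)) ->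
  (forall p, D p -> P (U p)) -> forall f, supported D f -> P f.
Proof.
move=> P0 PD PZ PU f sf; rewrite [f]palgE big_seq_cond.
by apply: (big_ind P) => // p /andP[pf _]; apply: PZ; apply/PU/sf.
Qed.

Lemma supported_sub D1 D2 f : (forall p, D1 p -> D2 p) ->
  supported D1 f -> supported D2 f.
Proof. by move=> sD sf p /sf/sD. Qed.

Lemma supportedM D1 D2 D3 f g :
  (forall p q, D1 p -> D2 q -> pend p = pstart q -> D3 (pcat p q)) ->
  supported D1 f -> supported D2 g -> supported D3 (f * g).
Proof.
move=> D3P sf sg; elim/(@supported_ind D1): f / sf => [|f1 f2 s1 s2|c f s|p Dp].
- by rewrite mul0r; apply: supported0.
- by rewrite mulrDl; apply: supportedD.
- by rewrite palgZl; apply: supportedZ.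
elim/(@supported_ind D2): g / sg => [|f1 f2 s1 s2|c f s|q Dq].
- by rewrite mulr0; apply: supported0.
- by rewrite mulrDr; apply: supportedD.
- by rewrite palgZr; apply: supportedZ.
rewrite pathU_mul /pprod; case: eqP => [pq|_]; last exact: supported0.
by apply: supportedU; apply: D3P.
Qed.

Lemma plength_cat p q : pend p = pstart q ->
  plength (pcat p q) = (plength p + plength q)%N.
Proof. by move=> pq; rewrite /plength parrows_cat // size_cat. Qed.

Lemma trivial_pathP p : plength p = 0%N -> p = trivial_path (pstart p).
Proof. by move/size0nil=> e; apply: qpathP. Qed.

(** Path length is additive, so a trivial path factors only trivially; this makes the augmentation
    [aug] multiplicative. *)
Lemma pcat_eq_trivial p q v : pend p = pstart q ->
  (pcat p q == trivial_path v) = (p == trivial_path v) && (q == trivial_path v).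
Proof.
move=> pq; apply/eqP/andP => [e|[/eqP pv /eqP qv]]; last first.
  rewrite pv qv; exact: (pcat_trivl (trivial_path v)).
have /eqP := congr1 (@plength Q) e.
rewrite plength_cat // addn_eq0 => /andP[/eqP p0 /eqP q0].
have sp : pstart p = v by rewrite -(pstart_cat pq) e.
move: pq; rewrite (trivial_pathP p0) (trivial_pathP q0) sp => pq.
by split; apply/eqP/qpathP.
Qed.

Definition aug (v : vert Q) f : k := f@_(trivial_path v).

Fact aug_zmod v : zmod_morphism (aug v).
Proof. by move=> f g; rewrite /aug mcoeffB. Qed.

Lemma augZ v c f : aug v (c *: f) = c * aug v f.
Proof. by rewrite /aug mcoeffZ. Qed.

Lemma augU v p : aug v (U p) = (p == trivial_path v)%:R.
Proof. exact: pathU_coef. Qed.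

Fact aug_monoid v : monoid_morphism (aug v).
Proof.
split=> [|f g].
  rewrite /aug [1]/(palg_one k Q) raddf_sum (bigD1 v) //= pathU_coef eqxx.
  rewrite big1 ?addr0 // => w; rewrite pathU_coef -(inj_eq val_inj) xpair_eqE.
  by move/negPf->.
elim/palg_ind: f => [|f1 f2 e1 e2|c f e|p].
- by rewrite mul0r /aug mcoeff0 mul0r.
- by rewrite mulrDl /aug !mcoeffD -!/(aug v _) e1 e2 mulrDl.
- by rewrite palgZl [LHS]augZ (augZ v c f) e mulrA.
elim/palg_ind: g => [|f1 f2 e1 e2|c f e|q].
- by rewrite mulr0 /aug mcoeff0 mulr0.
- by rewrite mulrDr /aug !mcoeffD -!/(aug v _) e1 e2 mulrDr.
- by rewrite palgZr [LHS]augZ (augZ v c f) e mulrCA.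
rewrite pathU_mul /pprod; case: eqP => [pq|pq].
  by rewrite !augU pcat_eq_trivial // -natrM mulnb.
rewrite /aug mcoeff0 !pathU_coef -natrM mulnb; case: andP => //= -[/eqP pv /eqP qv].
by case: pq; rewrite pv qv.
Qed.

HB.instance Definition _ v :=
  GRing.isZmodMorphism.Build (palg k Q) k (aug v) (aug_zmod v).
HB.instance Definition _ v :=
  GRing.isMonoidMorphism.Build (palg k Q) k (aug v) (aug_monoid v).

End PathAlgebraTheory.

Section PathQuotient.
Variables (k : comNzRingType) (Q : quiver) (I : ideal (pathalg k Q)).
Implicit Types (p q r : qpath Q) (v w : vert Q).
Local Notation A := (quotalg I).

Definition qpi (f : palg k Q) : A := quot_pi I f.
Definition qp p : A := qpi (pathU k p).
Definition qe v : A := qp (trivial_path v).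
Definition qa a : A := qp (arrow_path a).
Local Notation kin := (kalg_in A).

Lemma qpiD f g : qpi (f + g) = qpi f + qpi g.
Proof. exact: (rmorphD (quot_pi I)). Qed.

Lemma qpiM f g : qpi (f * g) = qpi f * qpi g.
Proof. exact: (rmorphM (quot_pi I)). Qed.

Lemma qpi0 : qpi 0 = 0.
Proof. exact: (rmorph0 (quot_pi I)). Qed.

Lemma qpi1 : qpi 1 = 1.
Proof. exact: (rmorph1 (quot_pi I)). Qed.

Lemma qpiZ c f : qpi (c *: f) = kin c * qpi f.
Proof. by rewrite palgZE; exact: (rmorphM (quot_pi I)). Qed.

Lemma qpi_eq f g : qpi f = qpi g <-> I (f - g).
Proof. exact: quot_piP. Qed.

Lemma qpi_eq0 f : qpi f = 0 <-> I f.
Proof. by rewrite -qpi0 qpi_eq subr0. Qed.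

Lemma qpi_sum (J : Type) (s : seq J) (P : pred J) (F : J -> palg k Q) :
  qpi (\sum_(i <- s | P i) F i) = \sum_(i <- s | P i) qpi (F i).
Proof. exact: (rmorph_sum (quot_pi I)). Qed.

Lemma kinC c (x : A) : x * kin c = kin c * x.
Proof. by rewrite kalg_central. Qed.

Lemma kinCA c (x y : A) : x * (kin c * y) = kin c * (x * y).
Proof. by rewrite mulrA kinC mulrA. Qed.

Lemma qp_mul p q : qp p * qp q = if pend p == pstart q then qp (pcat p q) else 0.
Proof.
rewrite /qp -qpiM pathU_mul /pprod.
by case: eqP => // _; apply: qpi0.
Qed.

Lemma qe_idem v : qe v * qe v = qe v.
Proof. by rewrite /qe qp_mul eqxx -{1}[v]/(pstart (trivial_path v)) pcat_trivl. Qed.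

Lemma qe_mul v w : qe v * qe w = if v == w then qe v else 0.
Proof.
case: eqP => [->|vw]; first exact: qe_idem.
by rewrite /qe qp_mul -[pend _]/v -[pstart _]/w; case: eqP vw.
Qed.

Lemma qe_qp v p : qe v * qp p = if v == pstart p then qp p else 0.
Proof. by rewrite /qe qp_mul -[pend _]/v; case: eqP => [->|//]; rewrite pcat_trivl. Qed.

Lemma qp_qe v p : qp p * qe v = if pend p == v then qp p else 0.
Proof. by rewrite /qe qp_mul -[pstart _]/v; case: eqP => [<-|//]; rewrite pcat_trivr. Qed.

Lemma qe_sum1 : \sum_(v : vert Q) qe v = 1.
Proof. by rewrite -qpi_sum -qpi1. Qed.

(** The [n]-th power of the ideal generated by the arrows in the quotient. *)
Definition rad n (x : A) : Prop :=
  exists2 f, supported (fun p => n <= plength p)%N f & x = qpi f.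

Lemma rad_top x : rad 0 x.
Proof. by elim/quot_ind: x => f; exists f. Qed.

Lemma rad_qp n p : (n <= plength p)%N -> rad n (qp p).
Proof. by move=> np; exists (pathU k p) => //; apply: supportedU. Qed.

Lemma rad0 n : rad n 0.
Proof. by exists 0; rewrite ?qpi0 //; apply: supported0. Qed.

Lemma radD n x y : rad n x -> rad n y -> rad n (x + y).
Proof.
by move=> [f sf ->] [g sg ->]; exists (f + g); rewrite ?qpiD //; apply: supportedD.
Qed.

Lemma radZ n c x : rad n x -> rad n (kin c * x).
Proof.
by move=> [f sf ->]; exists (c *: f); rewrite ?qpiZ //; apply: supportedZ.
Qed.

Lemma radM n1 n2 x y : rad n1 x -> rad n2 y -> rad (n1 + n2) (x * y).
Proof.
move=> [f sf ->] [g sg ->]; exists (f * g); rewrite ?qpiM //.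
apply: supportedM sf sg => p q np nq pq.
by rewrite plength_cat // leq_add.
Qed.

Lemma rad_leq n1 n2 x : (n1 <= n2)%N -> rad n2 x -> rad n1 x.
Proof.
by move=> n12 [f sf ->]; exists f => //; apply: supported_sub sf => p; apply: leq_trans.
Qed.

Lemma rad_ind n (P : A -> Prop) : P 0 ->
  (forall x y, P x -> P y -> P (x + y)) ->
  (forall c x, P x -> P (kin c * x)) ->
  (forall p, (n <= plength p)%N -> P (qp p)) -> forall x, rad n x -> P x.
Proof.
move=> P0 PD PZ PU x [f sf ->].
elim/(@supported_ind k Q (fun p => n <= plength p)%N): f / sf => [|f g|c f|p].
- by rewrite qpi0.
- by rewrite qpiD; apply: PD.
- by rewrite qpiZ; apply: PZ.
exact: PU.
Qed.

Lemma corner_ind n v w (P : A -> Prop) : P 0 ->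
  (forall x y, P x -> P y -> P (x + y)) ->
  (forall c x, P x -> P (kin c * x)) ->
  (forall p, (n <= plength p)%N -> pstart p = v -> pend p = w -> P (qp p)) ->
  forall x, rad n x -> P (qe v * x * qe w).
Proof.
move=> P0 PD PZ PU; apply: rad_ind => [|x y Px Py|c x Px|p np].
- by rewrite mulr0 mul0r.
- by rewrite mulrDr mulrDl; apply: PD.
- by rewrite kinCA -mulrA; apply: PZ.
rewrite qe_qp; case: eqP => [vp|_]; last by rewrite mul0r.
by rewrite qp_qe; case: eqP => // pw; apply: PU.
Qed.

(* The coefficient of p in x; well defined for paths p of length at most 1 when
   every element of I is supported in length at least 2. *)
Definition coef p (x : A) : k := (repr (x : quotring I) : palg k Q)@_p.

Hypothesis smallI : forall x, I x -> forall p, p \in msupp x -> (2 <= plength p)%N.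

Lemma coefE p f : (plength p < 2)%N -> coef p (qpi f) = f@_p.
Proof.
move=> p2; have /smallI h := quot_repr I f.
apply/eqP; rewrite -subr_eq0 -mcoeffB; apply/eqP/mcoeff_outdom.
by apply/negP => /h; rewrite leqNgt p2.
Qed.

Lemma coefD p x y : (plength p < 2)%N -> coef p (x + y) = coef p x + coef p y.
Proof.
move=> p2; elim/quot_ind: x => f; elim/quot_ind: y => g.
by rewrite -[quot_pi I f]/(qpi f) -[quot_pi I g]/(qpi g) -qpiD !coefE // mcoeffD.
Qed.

Lemma coefZ p c x : (plength p < 2)%N -> coef p (kin c * x) = c * coef p x.
Proof.
move=> p2; elim/quot_ind: x => f.
by rewrite -[quot_pi I f]/(qpi f) -qpiZ !coefE // mcoeffZ.
Qed.

Lemma coef_qp p q : (plength p < 2)%N -> coef p (qp q) = (q == p)%:R.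
Proof. by move=> p2; rewrite coefE // pathU_coef. Qed.

Lemma coef_rad n p x : (plength p < n)%N -> (plength p < 2)%N ->
  rad n x -> coef p x = 0.
Proof.
move=> pn p2 [f sf ->]; rewrite coefE //; apply: mcoeff_outdom.
by apply/negP=> /sf; rewrite leqNgt pn.
Qed.

Lemma rad_coef n x : (n <= 2)%N ->
  (forall p, (plength p < n)%N -> coef p x = 0) -> rad n x.
Proof.
move=> n2 x0; exists (repr (x : quotring I)); last by rewrite /qpi /quot_pi reprK.
move=> p; rewrite leqNgt; apply: contraL => pn.
by rewrite -mcoeff_eq0; apply/eqP/x0.
Qed.

Fact coef_trivial_zmod v : zmod_morphism (coef (trivial_path v)).
Proof.
move=> x y; rewrite coefD //; congr (_ + _).
by rewrite -mulN1r -(rmorph1 kin) -rmorphN coefZ // mulN1r.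
Qed.

Fact coef_trivial_monoid v : monoid_morphism (coef (trivial_path v)).
Proof.
split=> [|x y]; first by rewrite -qpi1 coefE // -/(aug v 1) rmorph1.
elim/quot_ind: x => f; elim/quot_ind: y => g.
rewrite -[quot_pi I f]/(qpi f) -[quot_pi I g]/(qpi g) -qpiM !coefE //.
exact: (rmorphM (aug v)).
Qed.

(** The action on the simple module at [v]. The coefficient of a trivial path is well defined on the
    quotient because the ideal starts in length 2. *)
Definition chi v : {rmorphism A -> k} := HB.pack (coef (trivial_path v))
  (GRing.isZmodMorphism.Build A k _ (coef_trivial_zmod v))
  (GRing.isMonoidMorphism.Build A k _ (coef_trivial_monoid v)).

Lemma chiE v x : chi v x = coef (trivial_path v) x.
Proof. by []. Qed.

Lemma chi_kin v c : chi v (kin c) = c.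
Proof. by rewrite -[kin c]mulr1 chiE coefZ // -chiE rmorph1 mulr1. Qed.

Lemma chi_qe v w : chi v (qe w) = (v == w)%:R.
Proof.
by rewrite chiE coef_qp // -(inj_eq val_inj) xpair_eqE eqxx andbT eq_sym.
Qed.

Lemma rad1P x : rad 1 x <-> forall v, chi v x = 0.
Proof.
split=> [rx v|x0]; first by apply: coef_rad rx.
by apply: rad_coef => // -[[v [|a s]] ws] // _; rewrite -(x0 v) chiE; congr coef; apply: qpathP.
Qed.

Lemma rad1_corner v w x : v <> w -> rad 1 (qe v * x * qe w).
Proof.
move=> vw; apply/rad1P => u; rewrite !rmorphM !chi_qe.
case: eqP => [->|_]; last by rewrite mul0r mul0r.
by case: eqP => // _; rewrite mulr0.
Qed.

Lemma rad1_diag v x : rad 1 (qe v * (x - kin (chi v x)) * qe v).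
Proof.
apply/rad1P => u; rewrite !rmorphM !chi_qe.
case: eqP => [->|_]; last by rewrite mul0r mul0r.
by rewrite rmorphB chi_kin subrr mulr0 mul0r.
Qed.

End PathQuotient.

(** * Quadratic monomial ideals and the idempotents of their corners *)

Section QuadraticMonomial.
Variables (Q : quiver) (S : qpath Q -> Prop).
Hypothesis S2 : forall p, S p -> plength p = 2%N.
Implicit Types (p q r : qpath Q).

Definition has_sub p : Prop := exists p1 s p2,
  [/\ S s, pend p1 = pstart s, pend s = pstart p2 & p = pcat p1 (pcat s p2)].

Lemma has_sub_catl p q : pend p = pstart q -> has_sub q -> has_sub (pcat p q).
Proof.
move=> pq [p1 [s [p2 [Ss e1 e2 eq]]]]; exists (pcat p p1), s, p2.
have pp1 : pend p = pstart p1 by rewrite pq eq pstart_cat ?pstart_cat.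
by split; rewrite ?pend_cat // eq pcatA // pstart_cat.
Qed.

Lemma has_sub_catr p q : pend p = pstart q -> has_sub p -> has_sub (pcat p q).
Proof.
move=> pq [p1 [s [p2 [Ss e1 e2 ep]]]]; exists p1, s, (pcat p2 q).
have p2q : pend p2 = pstart q by rewrite -pq ep !pend_cat ?pstart_cat.
by split; rewrite ?pstart_cat // ep -!pcatA ?pend_cat ?pstart_cat.
Qed.

Lemma has_sub_length p : has_sub p -> (2 <= plength p)%N.
Proof.
move=> [p1 [s [p2 [Ss e1 e2 ->]]]].
by rewrite !plength_cat ?pstart_cat // (S2 Ss) addnCA leq_addr.
Qed.

Lemma has_sub_gen p : S p -> has_sub p.
Proof.
move=> Sp; exists (trivial_path (pstart p)), p, (trivial_path (pend p)).
by split=> //; rewrite pcat_trivr pcat_trivl.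
Qed.

Variable k : fieldType.

Fact mono_idealMl (a x : palg k Q) :
  supported has_sub x -> supported has_sub (a * x).
Proof.
apply: (@supportedM _ _ (fun=> True)) => // p q _ sq pq.
exact: has_sub_catl.
Qed.

Fact mono_idealMr (a x : palg k Q) :
  supported has_sub x -> supported has_sub (x * a).
Proof.
move=> sx; apply: (@supportedM _ _ has_sub (fun=> True)) sx _ => // p q sp _ pq.
exact: has_sub_catr.
Qed.

Definition mono_ideal : ideal (pathalg k Q) :=
  @Ideal (pathalg k Q) (supported has_sub) (@supported0 _ _ _)
    (@supportedD _ _ _) mono_idealMl mono_idealMr.

(** The paths with a subpath in [S] span a two-sided ideal, so membership is read off the
    support. *)
Lemma ideal_gen_mono (x : pathalg k Q) :
  ideal_gen (fun y : pathalg k Q => exists2 p, S p & y = pathU k p) x <->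
  supported has_sub x.
Proof.
split=> [gx|].
  apply: (gx mono_ideal) => y [p Sp ->].
  by apply: supportedU; apply: has_sub_gen.
move=> sx J SJ; elim/(@supported_ind k Q has_sub): x / sx => [|f g|c f|p].
- exact: ideal0.
- exact: idealD.
- by move=> Jf; rewrite palgZE; apply: idealMl.
move=> [p1 [s [p2 [Ss e1 e2 ->]]]].
have e1' : pend p1 = pstart (pcat s p2) by rewrite pstart_cat.
rewrite -(pprodE k e1') -pathU_mul; apply: (@idealMl (pathalg k Q)).
rewrite -(pprodE k e2) -pathU_mul; apply: (@idealMr (pathalg k Q)).
by apply: SJ; exists s.
Qed.

Variable I : ideal (pathalg k Q).
Hypothesis IS : forall x, I x <->
  ideal_gen (fun y : pathalg k Q => exists2 p, S p & y = pathU k p) x.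

Lemma quadI x : I x <-> supported has_sub x.
Proof. exact: iff_trans (IS x) (ideal_gen_mono x). Qed.

Lemma quad_small x : I x -> forall p, p \in msupp x -> (2 <= plength p)%N.
Proof. by move=> /quadI sx p /sx/has_sub_length. Qed.

Lemma quad_pathU p : I (pathU k p) <-> has_sub p.
Proof.
rewrite quadI; split=> [|sp]; last exact: supportedU.
by apply; rewrite -mcoeff_neq0 pathU_coef eqxx oner_neq0.
Qed.

(** Subtracting an element supported in length greater than that of [p] does not change the
    coefficient of [p], so [p] itself contains a generator. This separatedness replaces the
    nilpotency of the radical, which may fail here. *)
Lemma rad_inf0 (x : quotalg I) : (forall n, rad n x) -> x = 0.
Proof.
elim/quot_ind: x => f rf; apply/qpi_eq0/quadI => p pf.
have [g sg /qpi_eq/quadI sfg] := rf (plength p).+1.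
apply: sfg; rewrite -mcoeff_neq0 mcoeffB (mcoeff_outdom (_ : p \notin msupp g)).
  by rewrite subr0 mcoeff_neq0.
by apply/negP => /sg; rewrite ltnn.
Qed.

Lemma rad1_idem0 (x : quotalg I) : rad 1 x -> x * x = x -> x = 0.
Proof.
move=> rx xx; apply: rad_inf0; elim=> [|n IHn]; first exact: rad_top.
by rewrite -xx -add1n; apply: radM.
Qed.

(** The character at [v] is 0 or 1 on [x], so [x] or its complement in the corner is an idempotent
    of the radical and vanishes. *)
Lemma corner_idem v (x : quotalg I) :
  qe I v * x * qe I v = x -> x * x = x -> x = 0 \/ x = qe I v.
Proof.
move=> vx xx.
have chi0 w : v <> w -> chi quad_small w x = 0.
  move=> vw; rewrite -vx !rmorphM !(chi_qe quad_small).
  by case: eqP => [e|]; [case: vw | rewrite mulr0].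
have: (chi quad_small v x) * (chi quad_small v x - 1) = 0.
  by rewrite mulrBr -rmorphM xx mulr1 subrr.
move/eqP; rewrite mulf_eq0 subr_eq0 => /orP[] /eqP cx; [left|right].
  apply: rad1_idem0 => //; apply/(rad1P quad_small) => w.
  by have [<-|/eqP/chi0] := eqVneq v w.
have vv : qe I v * qe I v = qe I v by exact: qe_idem.
apply/esym/eqP; rewrite -subr_eq0; apply/eqP/rad1_idem0.
  apply/(rad1P quad_small) => w; rewrite rmorphB (chi_qe quad_small) eq_sym.
  by case: eqP => [<-|/chi0 ->]; rewrite ?cx subrr.
have vx1 : qe I v * x = x by rewrite -vx !mulrA vv.
have xv1 : x * qe I v = x by rewrite -vx -!mulrA vv.
by rewrite mulrBr !mulrBl vv vx1 xv1 xx subrr subr0.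
Qed.

End QuadraticMonomial.

(** * Morita equivalence and isomorphism *)

Lemma inj_surj_bij (S T : Type) (f : S -> T) :
  injective f -> (forall y, exists x, f x = y) -> bijective f.
Proof.
move=> fi fs; pose g y := sval (cid (fs y)).
have gK y : f (g y) = y by rewrite /g; case: cid.
by exists g => // x; apply: fi; rewrite gK.
Qed.

Section BasicMorita.
Variables (k : fieldType) (Q1 Q2 : quiver).
Variables (I1 : ideal (pathalg k Q1)) (I2 : ideal (pathalg k Q2)).
Hypothesis adm1 : admissible I1.
Variable S : qpath Q2 -> Prop.
Hypothesis S2 : forall p, S p -> plength p = 2%N.
Hypothesis I2S : forall x, I2 x <->
  ideal_gen (fun y : pathalg k Q2 => exists2 p, S p & y = pathU k p) x.
Local Notation A := (quotalg I1).
Local Notation B := (quotalg I2).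
Variable pg : progenerator A B.
Let M := pg_mod pg.
Let theta := pg_end pg.
Let small1 := adm1.1.
Let small2 := quad_small S2 I2S.

(** [c] differs from the identity of the corner by an element of the radical, which is nilpotent by
    admissibility; the geometric series gives the inverse. *)
Lemma corner_unit i (c : A) : c = qe I1 i * c * qe I1 i -> chi small1 i c = 1 ->
  exists2 c', c * c' = qe I1 i & c' = c' * qe I1 i.
Proof.
move=> ce c1; have [N radN] := adm1.2.
have rN x : rad N x -> x = 0 :> A.
  elim/rad_ind: x / => // [x y -> ->|d x ->|p /radN Ip]; rewrite ?addr0 ?mulr0 //.
  exact/qpi_eq0.
pose n := qe I1 i - c.
have rn : rad 1 n.
  apply/(rad1P small1) => v; rewrite /n ce rmorphB !rmorphM !chi_qe.
  by case: eqP => [->|_]; rewrite ?c1 ?mulr1 ?mul0r subrr.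
have rnt t : rad t (n ^+ t).
  by elim: t => [|t IHt]; [exact: rad_top | rewrite exprS -add1n; apply: radM].
exists ((\sum_(t < N) n ^+ t) * qe I1 i); last by rewrite -mulrA qe_idem.
have cn : c = - (qe I1 i * (n - 1)).
  rewrite -mulrN opprB mulrBr mulr1 mulrBr qe_idem opprB addrC subrK.
  by rewrite {2}ce !mulrA qe_idem.
rewrite {1}cn mulNr -mulrA [(n - 1) * _]mulrA -subrX1 (rN _ (rnt N)).
by rewrite sub0r mulN1r mulrN opprK qe_idem.
Qed.

Lemma end0 x : theta 0 x = 0.
Proof.
apply: (@addrI _ (theta 0 x)).
by rewrite /theta -pg_endD !addr0.
Qed.

Lemma end_sum (J : Type) (s : seq J) (F : J -> B) x :
  theta (\sum_(i <- s) F i) x = \sum_(i <- s) theta (F i) x.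
Proof.
apply: (big_morph (theta^~ x)) => [b c|]; last exact: end0.
exact: pg_endD.
Qed.

Lemma sum_qe_end x : \sum_j theta (qe I2 j) x = x.
Proof. by rewrite -end_sum qe_sum1 /theta pg_end1. Qed.

(** The maps [u] and [w] identify the projective [A e_i] with the summand of [M] cut out by [e_j].
    They are defined on all of [A] and [M], with the idempotents in the equations, which avoids
    forming submodules. *)
Definition matched (i : vert Q1) (j : vert Q2) : Prop :=
  exists (u : {linear A^o -> M}) (w : {linear M -> A^o}),
    [/\ forall a : A, w (u a) = a * qe I1 i,
        forall x, u (w x) = theta (qe I2 j) x,
        forall a : A, theta (qe I2 j) (u a) = u a /\ u a = u (a * qe I1 i) &
        forall x, w (theta (qe I2 j) x) = w x /\ w x = (w x : A) * qe I1 i].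

(** The projective cover argument: [f] on the summand of [j] lifts along the projection [p] of [A]
    onto the simple module at [i]. The value [c] of the lift at a suitable [m] is a unit of the
    corner at [i], and correcting the lift by the inverse of [c] splits the map [u] that sends 1 to
    [m]. *)
Lemma matched_simple i j (f : {linear M -> restr k^o (chi small1 i)}) x :
  f (theta (qe I2 j) x) <> 0 -> matched i j.
Proof.
move=> fx; pose Si := restr k^o (chi small1 i).
have SiE (a : A) (c : Si) : a *: c = chi small1 i a * c :> k by [].
pose p : {linear A^o -> Si} := orbit ((1 : k) : Si).
have pE (a : A) : p a = chi small1 i a by rewrite /p orbitE [LHS]mulr1.
have ps y : exists a, p a = y.
  by exists (kalg_in A (y : k)); rewrite pE chi_kin.
have [l lE] := @pg_lift _ _ _ pg _ _ p (f \o theta (qe I2 j)) ps.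
have th2 y : theta (qe I2 j) (theta (qe I2 j) y) = theta (qe I2 j) y.
  by rewrite /theta -pg_endM qe_idem.
have w0l : linear (fun y => (l (theta (qe I2 j) y) : A) * qe I1 i : A^o).
  by move=> a y z; rewrite !linearP [RHS]/= mulrDl -mulrA.
pose w0 := mklin w0l.
have w0E y : w0 y = (l (theta (qe I2 j) y) : A) * qe I1 i by [].
have pw0 y : chi small1 i (w0 y) = f (theta (qe I2 j) y).
  by rewrite w0E rmorphM chi_qe eqxx mulr1 -pE lE [LHS]/= th2.
pose d : k := f (theta (qe I2 j) x); have d0 : d != 0 by apply/eqP.
(* The factor [d^-1] normalises [m] so that [f m = 1]; then the character of [c] at [i] is 1. *)
pose m := theta (qe I2 j) (qe I1 i *: (kalg_in A d^-1 *: x)).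
have fm : f m = 1 :> k.
  by rewrite /m !linearZZ !SiE chi_qe eqxx mul1r chi_kin mulVf.
have im : qe I1 i *: m = m by rewrite /m -linearZZ scalerA qe_idem.
have jm : theta (qe I2 j) m = m by rewrite /m th2.
pose c : A := w0 m.
have ci : qe I1 i * c = c by rewrite /c -{2}im linearZZ.
have ic : c * qe I1 i = c by rewrite /c w0E -mulrA qe_idem.
have [||c' cc' c'i] := @corner_unit i c; rewrite ?ci ?ic //.
  by rewrite /c pw0 jm.
have wl : linear (fun y => (w0 y : A) * c' : A^o).
  move=> a y z; rewrite linearP [LHS]mulrDl; congr (_ + _).
  exact: esym (mulrA _ _ _).
pose u := orbit m; pose w := mklin wl.
have wE y : w y = (w0 y : A) * c' by [].
have wi y : w y = (w y : A) * qe I1 i by rewrite wE -mulrA -c'i.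
have wj y : w (theta (qe I2 j) y) = w y by rewrite !wE !w0E th2.
have wu (a : A) : w (u a) = a * qe I1 i.
  by rewrite wE orbitE linearZZ -[a *: w0 m]/(a * c) -mulrA cc'.
have uj (a : A) : theta (qe I2 j) (u a) = u a by rewrite orbitE linearZZ jm.
have ui (a : A) : u a = u (a * qe I1 i) by rewrite !orbitE -scalerA im.
exists u, w; split=> // y.
(* The idempotent endomorphism [u \o w] is given by an idempotent [b] of the corner at [j]. It fixes
   [m], so [b] is nonzero, and this corner has only trivial idempotents. *)
have [b bE] := @pg_end_surj _ _ _ pg (u \o w).
have bE' z : theta b z = u (w z) by exact: bE.
suff -> : qe I2 j = b by rewrite bE'.
have bj : qe I2 j * b * qe I2 j = b.
  apply: (@pg_end_inj _ _ _ pg) => z.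
  by rewrite !pg_endM -!/(theta _ _) !bE' uj wj.
have bb : b * b = b.
  apply: (@pg_end_inj _ _ _ pg) => z.
  by rewrite !pg_endM -!/(theta _ _) !bE' wu -wi.
case: (corner_idem S2 I2S bj bb) => // b0.
have := bE' m; rewrite b0 end0.
have <- : u 1 = m by rewrite orbitE scale1r.
rewrite wu -ui => u0; move: fm; have <- : u 1 = m by rewrite orbitE scale1r.
by rewrite -u0 linear0 => /eqP; rewrite eq_sym oner_eq0.
Qed.

Lemma matched_exists i : exists j, matched i j.
Proof.
pose Si := restr k^o (chi small1 i).
have [|f [x fx]] := @pg_gen _ _ _ pg Si ((1 : k) : Si).
  by move/eqP; rewrite [_ == _](oner_eq0 k).
have [j fj] : exists j, f (theta (qe I2 j) x) <> 0.
  apply: contrapT => h; apply: fx; rewrite -(sum_qe_end x) linear_sum big1 // => j _.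
  by apply: contrapT => fj; apply: h; exists j.
by exists j; apply: matched_simple fj.
Qed.

(** [d] and [d'] represent mutually inverse maps between [A e_i] and [A e_i']. Their product is
    [e_i], but [d] ends in [e_i'], which the character at [i] kills when the vertices differ. *)
Lemma matched_inj i i' j : matched i j -> matched i' j -> i = i'.
Proof.
move=> [u [w [wu uw uP wP]]] [u' [w' [wu' uw' uP' wP']]].
pose d : A := w' (u 1); pose d' : A := w (u' 1).
have dd : d * d' = qe I1 i.
  have <- : w (u' d) = d * d'.
    by rewrite -[d in LHS]mulr1 -[d * 1]/(d *: (1 : A^o)) !linearZZ.
  by rewrite /d uw' (uP 1).1 wu mul1r.
apply/eqP; move/(congr1 (chi small1 i)): dd.
rewrite /d (wP' _).2 !rmorphM !chi_qe eqxx.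
by case: eqP => // _ /eqP; rewrite mulr0 mul0r eq_sym oner_eq0.
Qed.

(** [X] corresponds to the simple module at [j]. A match of [i] with [j'] turns a nonzero element of
    [e_i X] into a map from [M] to [X]; every such map is a multiple of [t], which kills the
    summands of all vertices but [j]. *)
Lemma matched_surj j : exists i, forall j', matched i j' -> j' = j.
Proof.
have [|X [t [[x tx] tb th]]] := @pg_simple _ _ _ pg (chi small2 j) (@chi_kin _ _ _ small2 j).
  by move/eqP; rewrite oner_eq0.
have [i ix] : exists i, qe I1 i *: t x <> 0.
  apply: contrapT => h; apply: tx.
  rewrite -[t x]scale1r -(qe_sum1 I1) scaler_suml big1 // => i _.
  by apply: contrapT => ti; apply: h; exists i.
exists i => j' [u [w [wu uw uP wP]]].
have [c cE] := th (orbit (qe I1 i *: t x) \o w).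
have cE' y : (w y : A) *: (qe I1 i *: t x) = kalg_in A c *: t y by exact: cE.
have := cE' (theta (qe I2 j') (u 1)).
rewrite (wP _).1 wu mul1r scalerA qe_idem /theta tb chi_qe.
by case: eqP => // _; rewrite rmorph0 scale0r scaler0.
Qed.

(** The matches add up to an isomorphism [U] from the regular module to [M]. It transports the
    endomorphism given by [b] to the right multiplication of [A] by [Psi b], and right
    multiplications compose in the order that makes [Psi] multiplicative. *)
Theorem basic_morita : exists (kappa : vert Q1 -> vert Q2) (Psi : {rmorphism B -> A}),
  [/\ bijective kappa, bijective Psi,
      forall c, Psi (kalg_in B c) = kalg_in A c &
      forall i, Psi (qe I2 (kappa i)) = qe I1 i].
Proof.
pose kappa i := sval (cid (matched_exists i)).
have kP i : matched i (kappa i) by rewrite /kappa; case: cid.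
have kinj : injective kappa by move=> i i' e; apply: matched_inj (kP i) _; rewrite e.
have kbij : bijective kappa.
  by apply: inj_surj_bij => // j; have [i ij] := matched_surj j; exists i; apply: ij.
have [u uP] := boolp.choice kP; have [w wP] := boolp.choice uP.
have Ul : linear (fun a : A^o => \sum_i u i a).
  move=> a x y; rewrite scaler_sumr -big_split; apply: eq_bigr => i _.
  exact: linearP.
have Wl : linear (fun x : M => \sum_i w i x).
  move=> a x y; rewrite scaler_sumr -big_split; apply: eq_bigr => i _.
  exact: linearP.
pose U := mklin Ul; pose W := mklin Wl.
have UE (a : A) : U a = \sum_i u i a by [].
have WE x : W x = \sum_i w i x by [].
have UW x : U (W x) = x.
  rewrite UE WE -[RHS]sum_qe_end (reindex kappa) /=; last exact: onW_bij.
  apply: eq_bigr => i _; have [_ <- uPi _] := wP i.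
  rewrite linear_sum (bigD1 i) //= big1 ?addr0 // => l li.
  have [_ _ _ /(_ x)[_ ->]] := wP l.
  by rewrite (uPi _).2 -mulrA qe_mul (negPf li) mulr0 linear0.
have wU i (a : A) : w i (U a) = a * qe I1 i.
  rewrite UE; have [<- _ _ wPi] := wP i.
  rewrite linear_sum (bigD1 i) //= big1 ?addr0 // => l li.
  have [_ _ /(_ a)[<- _] _] := wP l.
  rewrite -(wPi _).1 /theta -pg_endM qe_mul (inj_eq kinj) (negPf li).
  by rewrite -/(theta _ _) end0 linear0.
have WU (a : A) : W (U a) = a.
  rewrite WE -[RHS]mulr1 -(qe_sum1 I1) mulr_sumr.
  by apply: eq_bigr => i _; rewrite wU.
pose Psi b : A := W (theta b (U 1)).
have UPsi b : U (Psi b) = theta b (U 1) by rewrite UW.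
have Uscale (a : A) : U a = a *: U 1.
  by rewrite -linearZZ; congr (U _); rewrite -[LHS]mulr1.
have PsiM b c : Psi (b * c) = Psi b * Psi c.
  rewrite /Psi {1}/theta pg_endM -!/(theta _ _) -UPsi Uscale !linearZZ.
  by have -> (a : A^o) : a *: W (U 1) = a by rewrite WU; exact: mulr1.
have PsiZ c b : Psi (kalg_in B c * b) = kalg_in A c * Psi b.
  by rewrite /Psi /theta pg_endZ linearZZ.
have Psi1 : Psi 1 = 1 by rewrite /Psi /theta pg_end1 WU.
have PsiB : zmod_morphism Psi.
  have PsiD b c : Psi (b + c) = Psi b + Psi c.
    by rewrite /Psi /theta pg_endD; apply: (linearD W).
  by move=> b c; rewrite -[in RHS](subrK c b) [in RHS]PsiD addrK.
pose Psi' : {rmorphism B -> A} := HB.pack Psi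
  (GRing.isZmodMorphism.Build B A Psi PsiB)
  (GRing.isMonoidMorphism.Build B A Psi (conj Psi1 PsiM)).
exists kappa, Psi'; split=> //.
- apply: inj_surj_bij => [b c e|a].
    apply: (@pg_end_inj _ _ _ pg) => x; rewrite -(UW x) Uscale.
    by rewrite !linearZZ -!/(theta _ _) -!UPsi [Psi b]e.
  have fl : linear (fun x => U ((W x : A) * a)).
    by move=> c x y; rewrite linearP [_ *: _]/(_ * _) mulrDl -mulrA linearP.
  have [b bE] := @pg_end_surj _ _ _ pg (mklin fl); exists b.
  have e : theta b (U 1) = U ((W (U 1) : A) * a) by exact: bE.
  by have := congr1 W e; rewrite WU [W (U 1)]WU mul1r.
- by move=> c; rewrite -[kalg_in B c]mulr1 [LHS]PsiZ Psi1 mulr1.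
move=> i; rewrite -[RHS]WU.
suff e : theta (qe I2 (kappa i)) (U 1) = U (qe I1 i) by exact: (congr1 W e).
have [_ <- _ _] := wP i; rewrite wU mul1r UE (bigD1 i) //= big1 ?addr0 // => l li.
by have [_ _ /(_ (qe I1 i))[_ ->] _] := wP l; rewrite qe_mul eq_sym (negPf li) linear0.
Qed.

End BasicMorita.

(** * Isomorphic algebras are Morita equivalent *)

Section Isomorphisms.
Variable k : pzRingType.
Implicit Types A B C : kalgebra k.

Lemma alg_iso_sym A B : alg_isomorphic A B -> alg_isomorphic B A.
Proof.
move=> [f [[g fK gK] fk]].
have gB : zmod_morphism g.
  by move=> x y; apply: (can_inj fK); rewrite rmorphB !gK.
have gM : monoid_morphism g.
  by split=> [|x y]; apply: (can_inj fK); rewrite ?rmorph1 ?rmorphM !gK.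
pose g' : {rmorphism B -> A} := HB.pack g
  (GRing.isZmodMorphism.Build B A g gB) (GRing.isMonoidMorphism.Build B A g gM).
exists g'; split; first by exists f.
by move=> c; apply: (can_inj fK); rewrite [LHS]gK fk.
Qed.

Lemma alg_iso_trans A B C :
  alg_isomorphic A B -> alg_isomorphic B C -> alg_isomorphic A C.
Proof.
move=> [f [fb fk]] [g [gb gk]]; exists (g \o f); split; first exact: bij_comp.
by move=> c; rewrite /= fk gk.
Qed.

Section RestrictionFunctor.
Variables (A B : kalgebra k) (g : {rmorphism B -> A}).
Hypothesis gk : forall c, g (kalg_in B c) = kalg_in A c.

Fact restr_hom_linear (M N : lmodType A) (f : {linear M -> N}) :
  linear (f : restr M g -> restr N g).
Proof. by move=> b x y; apply: linearP. Qed.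

Definition restr_hom (M N : lmodType A) (f : {linear M -> N}) :
  {linear restr M g -> restr N g} := mklin (restr_hom_linear f).

Fact restr_hom_klinear (M N : lmodType A) c (f h l : {linear M -> N}) :
  (forall x, l x = kalg_in A c *: f x + h x) ->
  forall y, restr_hom l y = kalg_in B c *: restr_hom f y + restr_hom h y.
Proof.
move=> lE y; transitivity (g (kalg_in B c) *: f y + h y) => //.
by rewrite gk -lE.
Qed.

Definition restr_functor : module_functor A B :=
  @ModuleFunctor _ A B (fun M => restr M g) restr_hom
    (fun M f fid => fid) (fun L M N f h l e => e) restr_hom_klinear.

End RestrictionFunctor.

(** The equivalence is restriction of scalars along the inverse isomorphism; restricting back
    recovers a module on the same underlying group. *)
Lemma alg_iso_morita A B : alg_isomorphic A B -> morita_equivalent A B.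
Proof.
move=> /alg_iso_sym[g [[f gK fK] gk]]; exists (restr_functor gk); split.
- by [].
- move=> M N h; have hl : linear (h : M -> N).
    move=> a x y; rewrite -[a]fK.
    have e := linearPZ h (f a) (x : restr M g) (y : restr M g).
    exact: e.
  by exists (mklin hl).
move=> N.
have fB : zmod_morphism f.
  by move=> x y; apply: (can_inj gK); rewrite rmorphB !fK.
have fM : monoid_morphism f.
  by split=> [|x y]; apply: (can_inj gK); rewrite ?rmorph1 ?rmorphM !fK.
pose f' : {rmorphism A -> B} := HB.pack f
  (GRing.isZmodMorphism.Build A B f fB) (GRing.isMonoidMorphism.Build A B f fM).
exists (restr N f').
have il : linear (id : restr (restr N f') g -> N).
  move=> b x y.
  have e : f (g b) *: (x : N) + (y : N) = b *: (x : N) + (y : N) by rewrite gK.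
  exact: e.
by exists (mklin il); exists id.
Qed.

End Isomorphisms.

(** * Arcs of a polygon *)

Section Arcs.

(* The points x, y, z are met in this order clockwise; for arcs at x with other
   ends y and z this means that the second one follows the first clockwise. *)
Definition cyc (x y z : nat) : bool :=
  [|| (x < y < z)%N, (y < z < x)%N | (z < x < y)%N].

Definition inc (d : nat * nat) (x : nat) : bool := (x == d.1) || (x == d.2).
Definition oth (d : nat * nat) (x : nat) : nat := if x == d.1 then d.2 else d.1.
Definition cross (d e : nat * nat) : bool :=
  (d.1 < e.1 < d.2)%N && (d.2 < e.2)%N || (e.1 < d.1 < e.2)%N && (e.2 < d.2)%N.

Lemma othP d x : inc d x -> d.1 <> d.2 ->
  [/\ inc d (oth d x), oth d x <> x & oth d (oth d x) = x].
Proof.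
rewrite /inc /oth => /orP[] /eqP-> de; first by rewrite !eqxx orbT; case: eqP => [/esym|].
have -> : (d.2 == d.1) = false by apply/eqP => /esym.
by rewrite !eqxx.
Qed.

Lemma inc_cases d x y : inc d x -> inc d y -> y = x \/ y = oth d x.
Proof.
by rewrite /inc /oth; do 2!case/orP=> /eqP->; rewrite ?eqxx; auto; case: eqP; auto.
Qed.

Lemma arc_eq (d e : nat * nat) x : (d.1 < d.2)%N -> (e.1 < e.2)%N ->
  inc d x -> inc e x -> oth d x = oth e x -> d = e.
Proof.
case: d e => [a b] [c d]; rewrite /inc /oth /= => ab cd xd xe o.
suff [-> ->] : a = c /\ b = d by [].
move: xd xe o; case: (x =P a); case: (x =P c) => /=; try lia.
Qed.

Lemma cyc_irr x y : cyc x y y = false. Proof. rewrite /cyc; lia. Qed.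
Lemma cyc_total x y z : y <> x -> z <> x -> y <> z -> cyc x y z \/ cyc x z y.
Proof. by move=> yx zx yz; apply/orP; rewrite /cyc; lia. Qed.
Lemma cyc_trans x y z t : cyc x y z -> cyc x z t -> cyc x y t.
Proof. by rewrite /cyc; lia. Qed.
Lemma cyc_mid x y z t : cyc x y z -> cyc x z t -> cyc y z t.
Proof. by rewrite /cyc; lia. Qed.
Lemma cyc_neq x y z : cyc x y z -> [/\ x <> y, y <> z & x <> z].
Proof. by rewrite /cyc => h; split; lia. Qed.
Lemma cyc_asym x y z : cyc x y z -> cyc x z y = false.
Proof. by rewrite /cyc; lia. Qed.
Lemma cyc_rot x y z : cyc x y z = cyc y z x.
Proof. by rewrite /cyc; lia. Qed.

(** The clockwise distance from [x] to [y] among [m] points. It turns the cyclic comparison at [x]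
    into one of numbers, so that a nearest arc on either side can be chosen by minimising or
    maximising. *)
Definition rk m x y := if (x < y)%N then (y - x)%N else (y + m - x)%N.

Lemma cyc_rk m x y z : (x < m)%N -> (y < m)%N -> (z < m)%N -> y <> x -> z <> x ->
  cyc x y z = (rk m x y < rk m x z)%N.
Proof. by rewrite /rk => *; case: (ltnP x y); case: (ltnP x z); rewrite /cyc; lia. Qed.

Lemma cross_sym d e : cross d e = cross e d.
Proof. by rewrite /cross orbC. Qed.

End Arcs.

Section Realisation.
Variable V : finType.
Implicit Types (S : {set V}) (f : V -> nat * nat) (u v w t : V).

Definition before f x u v : bool := cyc x (oth (f u) x) (oth (f v) x).

Definition nxt f S x u v : Prop :=
  [/\ inc (f u) x, inc (f v) x, before f x u v &
      forall w, w \in S -> inc (f w) x -> before f x u w -> before f x w v -> False].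

Record arcs S m f : Prop := Arcs {
  arc_lt : forall u, u \in S -> ((f u).1 < (f u).2)%N;
  arc_m : forall u, u \in S -> ((f u).2 < m)%N;
  arc_nc : forall u v, u \in S -> v \in S -> ~~ cross (f u) (f v);
  arc_inj : {in S &, injective f}
}.

Section ArcsTheory.
Variables (S : {set V}) (m : nat) (f : V -> nat * nat).
Hypothesis Sf : arcs S m f.

Lemma arc_neq u : u \in S -> (f u).1 <> (f u).2.
Proof. by move=> /(arc_lt Sf) + e; rewrite e ltnn. Qed.

Lemma inc_lt_m u x : u \in S -> inc (f u) x -> (x < m)%N.
Proof. by move=> uS /orP[] /eqP->; have := arc_lt Sf uS; have := arc_m Sf uS; lia. Qed.

Lemma oth_lt_m u x : u \in S -> inc (f u) x -> (oth (f u) x < m)%N.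
Proof. by move=> uS ux; apply: (inc_lt_m uS); have [] := othP ux (arc_neq uS). Qed.

Lemma before_rk u v x : u \in S -> v \in S -> inc (f u) x -> inc (f v) x ->
  before f x u v = (rk m x (oth (f u) x) < rk m x (oth (f v) x))%N.
Proof.
move=> uS vS ux vx; have [_ ? _] := othP ux (arc_neq uS); have [_ ? _] := othP vx (arc_neq vS).
by apply: cyc_rk => //; [apply: (inc_lt_m uS) | apply: oth_lt_m | apply: oth_lt_m].
Qed.

Lemma before_total u v x : u \in S -> v \in S -> inc (f u) x -> inc (f v) x ->
  u <> v -> before f x u v \/ before f x v u.
Proof.
move=> uS vS ux vx uv; have [_ ? _] := othP ux (arc_neq uS); have [_ ? _] := othP vx (arc_neq vS).
apply: cyc_total => // e; apply: uv; apply: (arc_inj Sf) => //.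
by apply: arc_eq ux vx e; apply: (arc_lt Sf).
Qed.

Lemma succ_exists u v x : u \in S -> v \in S -> inc (f u) x -> inc (f v) x ->
  before f x u v -> exists2 w, w \in S & nxt f S x u w.
Proof.
move=> uS vS ux vx uv.
pose P w := [&& w \in S, inc (f w) x & before f x u w].
have Pv : P v by apply/and3P.
case: (arg_minnP (fun w => rk m x (oth (f w) x)) Pv) => w /and3P[wS wx uw] minw.
exists w => //; split=> // t tS tx ut; rewrite before_rk // ltnNge.
by rewrite minw // /P tS tx.
Qed.

Lemma pred_exists u v x : u \in S -> v \in S -> inc (f u) x -> inc (f v) x ->
  before f x u v -> exists2 w, w \in S & nxt f S x w v.
Proof.
move=> uS vS ux vx uv.
pose P w := [&& w \in S, inc (f w) x & before f x w v].
have Pu : P u by apply/and3P.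
case: (arg_maxnP (fun w => rk m x (oth (f w) x)) Pu) => w /and3P[wS wx wv] maxw.
exists w => //; split=> // t tS tx + tv; rewrite before_rk // ltnNge.
by apply/negP/negPn; apply: maxw; rewrite /P tS tx.
Qed.

(** Otherwise the two arcs would share both ends, and neither would precede the other. *)
Lemma nxt_pivot u v x y : nxt f S x u v -> nxt f S y u v -> x = y.
Proof.
move=> [ux vx uv _] [uy vy _ _].
have [//|e] := inc_cases ux uy; have [//|e'] := inc_cases vx vy.
by move: uv; rewrite /before -e -e' cyc_irr.
Qed.

Lemma nxt_succ_uniq u v w x : u \in S -> v \in S -> w \in S ->
  nxt f S x u v -> nxt f S x u w -> v = w.
Proof.
move=> uS vS wS [ux vx uv nv] [_ wx uw nw]; apply: contrapT => vw.
by have [h|h] := before_total vS wS vx wx vw; [apply: nw h | apply: nv h].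
Qed.

Lemma nxt_pred_uniq u v w x : u \in S -> v \in S -> w \in S ->
  nxt f S x v u -> nxt f S x w u -> v = w.
Proof.
move=> uS vS wS [vx ux vu nv] [wx _ wu nw]; apply: contrapT => vw.
by have [h|h] := before_total vS wS vx wx vw; [apply: nv h wu | apply: nw h vu].
Qed.

Lemma nxt_neq u v x : nxt f S x u v -> u <> v.
Proof. by move=> [_ _ + _] e; rewrite e /before cyc_irr. Qed.

End ArcsTheory.
End Realisation.

(** * Realisations of gentle relations by arcs, and their reflections *)

Section GentleRelation.
Variable V : finType.
Implicit Types (E : rel V) (R : V -> V -> V -> bool) (S : {set V}).
Implicit Types (f : V -> nat * nat) (u v w t : V).

(* E u v says that there is an arrow from u to v, and R u v w that the
   composition of the arrows from u to v and from v to w is a relation. *)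
Record gentle_rel E R : Prop := GentleRel {
  gr_irr : forall u, ~~ E u u;
  gr_2cycle : forall u v, E u v -> ~~ E v u;
  gr_out : forall u a b c, E u a -> E u b -> E u c -> [\/ a = b, a = c | b = c];
  gr_in : forall u a b c, E a u -> E b u -> E c u -> [\/ a = b, a = c | b = c];
  gr_post : forall u v w w', E u v -> E v w -> E v w' -> R u v w = R u v w' -> w = w';
  gr_pre : forall u u' v w, E u v -> E u' v -> E v w -> R u v w = R u' v w -> u = u'
}.

(** Successors are taken among the arcs of [S] only. Adding an arc can therefore break up a pair of
    successive arcs, and each growth step has to rule this out. *)
Definition realises E R S m f : Prop :=
  [/\ arcs S m f,
      forall u v, u \in S -> v \in S -> E u v <-> exists x, nxt f S x u v &
      forall u v w x y, u \in S -> v \in S -> w \in S ->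
        nxt f S x u v -> nxt f S y v w -> R u v w = (x != y)].

Definition rev_rel E : rel V := fun u v => E v u.
Definition rev_tri R : V -> V -> V -> bool := fun u v w => R w v u.

Lemma gentle_rel_rev E R : gentle_rel E R -> gentle_rel (rev_rel E) (rev_tri R).
Proof.
case=> irr c2 o i po pr; split; rewrite /rev_rel /rev_tri => //.
- by move=> u v /c2.
- by move=> u v w w' vu wv w'v; apply: pr.
- by move=> u u' v w vu vu' wv; apply: po.
Qed.

Section Mirror.
Variable m : nat.

Definition mirror (x : nat) : nat := (m.-1 - x)%N.
Definition mirror_arc (d : nat * nat) : nat * nat := (mirror d.2, mirror d.1).

Lemma inc_mirror d x : (d.1 < m)%N -> (d.2 < m)%N -> (x < m)%N ->
  inc (mirror_arc d) (mirror x) = inc d x.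
Proof.
case: d => a b /= am bm xm; rewrite /inc /mirror /=.
have e c : (c < m)%N -> (m.-1 - x == m.-1 - c)%N = (x == c) by lia.
by rewrite !e // orbC.
Qed.

Lemma oth_mirror d x : (d.1 < d.2)%N -> (d.2 < m)%N -> inc d x ->
  oth (mirror_arc d) (mirror x) = mirror (oth d x).
Proof.
case: d => a b; rewrite /inc /oth /mirror /= => ab bm.
case/orP => /eqP->; rewrite eqxx /mirror; first by rewrite (_ : (_ == _) = false) //; lia.
by rewrite (_ : (b == a) = false) //; lia.
Qed.

Lemma cyc_mirror x y z : (x < m)%N -> (y < m)%N -> (z < m)%N ->
  cyc (mirror x) (mirror y) (mirror z) = cyc x z y.
Proof.
rewrite /cyc /mirror => xm ym zm.
have e a b : (a < m)%N -> (b < m)%N -> (m.-1 - a < m.-1 - b)%N = (b < a)%N by lia.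
by rewrite !e //; lia.
Qed.

Lemma nxt_mirror S f x u v : arcs S m f -> u \in S -> v \in S ->
  nxt f S x u v -> nxt (mirror_arc \o f) S (mirror x) v u.
Proof.
move=> Sf uS vS [ux vx uv nuv].
have b w w' : w \in S -> w' \in S -> inc (f w) x -> inc (f w') x ->
    before (mirror_arc \o f) (mirror x) w w' = before f x w' w.
  move=> wS w'S wx w'x; rewrite /before /=.
  have := (arc_lt Sf wS, arc_m Sf wS, arc_lt Sf w'S, arc_m Sf w'S).
  have := (inc_lt_m Sf wS wx, oth_lt_m Sf wS wx, oth_lt_m Sf w'S w'x).
  by move=> [[? ?] ?] [[[? ?] ?] ?]; rewrite !oth_mirror ?cyc_mirror.
have xm := inc_lt_m Sf uS ux.
have i w : w \in S -> inc (mirror_arc (f w)) (mirror x) = inc (f w) x.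
  by move=> wS; apply: inc_mirror => //; have := arc_lt Sf wS; have := arc_m Sf wS; lia.
split; rewrite /= ?i ?b // => w wS; rewrite i // => wx.
by rewrite !b // => wv uw; apply: (nuv w).
Qed.

Lemma arcs_mirror S f : arcs S m f -> arcs S m (mirror_arc \o f).
Proof.
move=> Sf; split=> [u uS|u uS|u v uS vS|u v uS vS].
- by have := arc_lt Sf uS; have := arc_m Sf uS; rewrite /= /mirror; lia.
- by have := arc_lt Sf uS; have := arc_m Sf uS; rewrite /= /mirror; lia.
- have := arc_nc Sf uS vS; rewrite /cross /= /mirror.
  have := arc_lt Sf uS; have := arc_m Sf uS.
  by have := arc_lt Sf vS; have := arc_m Sf vS; lia.
move=> [e1 e2]; apply: (arc_inj Sf) => //; rewrite [f u]surjective_pairing [f v]surjective_pairing.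
have := arc_lt Sf uS; have := arc_m Sf uS.
have := arc_lt Sf vS; have := arc_m Sf vS; move: e1 e2; rewrite /mirror.
by move=> *; congr pair; lia.
Qed.

Lemma mirrorKf S f : arcs S m f ->
  {in S, mirror_arc \o (mirror_arc \o f) =1 f}.
Proof.
move=> Sf u uS; have := arc_lt Sf uS; have := arc_m Sf uS.
by rewrite /= /mirror_arc /mirror; case: (f u) => a b /= *; congr pair; lia.
Qed.

Lemma eq_nxt S f f' x u v : {in S, f =1 f'} -> u \in S -> v \in S ->
  nxt f S x u v -> nxt f' S x u v.
Proof.
move=> ff' uS vS [ux vx uv nuv]; split; rewrite /before -?ff' // => w wS.
by rewrite -ff' //; apply: nuv.
Qed.

Lemma nxt_mirrorK S f x u v : arcs S m f -> u \in S -> v \in S ->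
  nxt (mirror_arc \o f) S x u v -> nxt f S (mirror x) v u.
Proof.
move=> Sf uS vS nuv; apply: (eq_nxt (mirrorKf Sf)) => //.
by apply: nxt_mirror => //; apply: arcs_mirror.
Qed.

(** A reflection of the disc reverses all rotations, hence all arrows. It reduces the attachment of
    a leaf by an arrow out of it to that by an arrow into it. *)
Lemma realises_rev E R S f : realises E R S m f ->
  realises (rev_rel E) (rev_tri R) S m (mirror_arc \o f).
Proof.
move=> [Sf fE fR]; split=> [|u v uS vS|u v w x y uS vS wS uv vw].
- exact: arcs_mirror.
- rewrite /rev_rel fE //; split=> -[x xP]; exists (mirror x).
    exact: nxt_mirror.
  exact: nxt_mirrorK.
have uv' := nxt_mirrorK Sf uS vS uv; have vw' := nxt_mirrorK Sf vS wS vw.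
rewrite /rev_tri (fR _ _ _ _ _ wS vS uS vw' uv').
have Sf' := arcs_mirror Sf.
have [ux _ _ _] := uv; have [vy _ _ _] := vw.
by have := inc_lt_m Sf' uS ux; have := inc_lt_m Sf' vS vy; rewrite /mirror; lia.
Qed.

End Mirror.

Lemma eq_realises E E' R R' S m f f' : E =2 E' -> (forall u v w, R u v w = R' u v w) ->
  {in S, f =1 f'} -> realises E R S m f -> realises E' R' S m f'.
Proof.
move=> EE RR ff' [Sf fE fR].
have f'f : {in S, f' =1 f} by move=> u uS; rewrite ff'.
split=> [|u v uS vS|u v w x y uS vS wS uv vw].
- split=> [u uS|u uS|u v uS vS|u v uS vS]; rewrite -?ff' //.
  + exact: (arc_lt Sf).
  + exact: (arc_m Sf).
  + exact: (arc_nc Sf).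
  exact: (arc_inj Sf).
- rewrite -EE fE //; split=> -[x xP]; exists x; [apply: eq_nxt xP | apply: eq_nxt xP] => //.
by rewrite -RR; apply: fR; [exact: uS|exact: vS| exact: wS|apply: eq_nxt uv|apply: eq_nxt vw].
Qed.

End GentleRelation.

(** * Growing a tiling *)

Section LeafStep.

(** [bump h] shifts the marked points from [h] on by one, which frees the number [h] for a new
    point. *)
Definition bump_arc h (d : nat * nat) : nat * nat := (bump h d.1, bump h d.2).

Lemma inc_bump h d y : inc (bump_arc h d) (bump h y) = inc d y.
Proof. by rewrite /inc /= !(inj_eq (can_inj (bumpK h))). Qed.

Lemma inc_bumpP h d y : inc (bump_arc h d) y -> exists2 z, y = bump h z & inc d z.
Proof.
by case/orP => /eqP ->; [exists d.1 | exists d.2]; rewrite // /inc eqxx ?orbT.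
Qed.

Lemma oth_bump h d y : oth (bump_arc h d) (bump h y) = bump h (oth d y).
Proof. by rewrite /oth /= (inj_eq (can_inj (bumpK h))); case: eqP. Qed.

Lemma ltn_bump h x y : (bump h x < bump h y)%N = (x < y)%N.
Proof. by rewrite /bump; case: (leqP h x); case: (leqP h y) => /=; lia. Qed.

Lemma cyc_bump h x y z : cyc (bump h x) (bump h y) (bump h z) = cyc x y z.
Proof. by rewrite /cyc !ltn_bump. Qed.

Variable V : finType.
Implicit Types (E : rel V) (R : V -> V -> V -> bool) (S : {set V}).
Implicit Types (f : V -> nat * nat) (u v w t : V).

(** Gentleness decides at which end of [u] the arrow to [v] turns. If [u] already has an arrow out,
    the new one takes the other end: after a given arrow, one of the two compositions is a relation
    and the other is not. If it has none, an arrow into [u] decides, and failing that either end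
    will do. *)
Lemma leaf_pivot E R S m f u v : gentle_rel E R -> realises E R S m f ->
  u \in S -> v \notin S -> E u v ->
  exists x, [/\ inc (f u) x, forall t, t \in S -> ~ nxt f S x u t &
    forall t y, t \in S -> nxt f S y t u -> R t u v = (y != x)].
Proof.
move=> gr [Sf fE fR] uS vS Euv.
have vP w : w \in S -> w <> v by move=> wS e; rewrite -e wS in vS.
have nE t t' x : t \in S -> t' \in S -> nxt f S x t t' -> E t t'.
  by move=> tS t'S h; apply/(fE t t'); rewrite //; exists x.
pose x1 := (f u).1; pose x2 := (f u).2.
have x12 : x1 <> x2 by have := arc_lt Sf uS; rewrite /x1 /x2; lia.
have i1 : inc (f u) x1 by rewrite /inc eqxx.
have i2 : inc (f u) x2 by rewrite /inc eqxx orbT.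
(* any out-arrow of u other than u -> v fixes the pivot of u -> v *)
have out x x' w : inc (f u) x -> inc (f u) x' -> x <> x' -> w \in S -> nxt f S x u w ->
    exists y, [/\ inc (f u) y, forall t, t \in S -> ~ nxt f S y u t &
      forall t z, t \in S -> nxt f S z t u -> R t u v = (z != y)].
  move=> ix ix' xx' wS xw; exists x'; split=> // [t tS x't|t z tS zt].
    have [e|e|e] := gr_out gr (nE _ _ _ uS wS xw) (nE _ _ _ uS tS x't) Euv.
    - by rewrite e in xw; apply: xx'; exact: nxt_pivot xw x't.
    - exact: vP wS e.
    exact: vP tS e.
  have [_ iz _ _] := zt; have Etu := nE _ _ _ tS uS zt.
  have Rw := fR _ _ _ _ _ tS uS wS zt xw.
  have zz : (z == x) (+) (z == x').
    have o := inc_cases ix ix'; have [/esym //|o'] := o; have [e|e] := inc_cases ix iz.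
      by rewrite e eqxx; case: eqP xx'.
    by rewrite e -o' eqxx; case: eqP => // e'; case: xx'.
  have nR : R t u v <> R t u w.
    by move=> e; apply: (vP w wS); apply: (gr_post gr Etu (nE _ _ _ uS wS xw) Euv).
  move: nR; rewrite Rw; move: zz; case: (z == x); case: (z == x') => //= _; case: (R t u v) => //.
have [[w wS xw]|n1] := pselect (exists2 w, w \in S & nxt f S x1 u w).
  exact: (out x1 x2 w).
have [[w wS xw]|n2] := pselect (exists2 w, w \in S & nxt f S x2 u w).
  by apply: (out x2 x1 w) => //; apply/nesym.
have n12 y : inc (f u) y -> forall t, t \in S -> ~ nxt f S y u t.
  move=> /orP[] /eqP-> t tS yt; [case: n1|case: n2]; by exists t.
have zz z : inc (f u) z -> (z == x1) (+) (z == x2).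
  case/orP => /eqP->; rewrite eqxx; case: eqP => //; last by move/esym.
have inP t z t' z' : t \in S -> t' \in S -> nxt f S z t u -> nxt f S z' t' u ->
    R t u v = R t' u v -> z = z'.
  move=> tS t'S zt zt' e; have ett := gr_pre gr (nE _ _ _ tS uS zt) (nE _ _ _ t'S uS zt') Euv e.
  by rewrite -ett in zt'; apply: nxt_pivot zt zt'.
have [[[t z] /= [tS zt]]|n] := pselect (exists tz : V * nat, tz.1 \in S /\ nxt f S tz.2 tz.1 u).
  have [_ iz _ _] := zt.
  pose z' := if z == x1 then x2 else x1.
  have iz' : inc (f u) z' by rewrite /z'; case: eqP.
  have zz' : z' <> z.
    by have := zz _ iz; rewrite /z'; case: eqP => [-> _ /esym //|]; case: eqP => // ->.
  (* The pivot must change exactly when the composition with the arrow from [t] is a relation. *)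
  exists (if R t u v then z' else z); split.
  - by case: ifP.
  - by apply: n12; case: ifP.
  move=> s y sS ys; have [_ iy _ _] := ys; have h := inP _ _ _ _ tS sS zt ys.
  have oy : y = z \/ y = z'.
    have [->|->] := inc_cases iz iy; first by left.
    by have [|->] := inc_cases iz iz'; [move/zz' | right].
  case: oy => e; rewrite {}e in ys h *.
    rewrite (nxt_pred_uniq Sf uS sS tS ys zt).
    by case: (R t u v); rewrite ?eqxx //; apply/esym/eqP/nesym.
  have : R t u v <> R s u v by move/h => e; apply: zz'; rewrite -e.
  by case: (R t u v); case: (R s u v) => //= _; rewrite ?eqxx //; apply/esym/eqP.
exists x1; split=> // [|t y tS yt]; first exact: n12.
by case: n; exists (t, y).
Qed.

(** The pivot [x] is split into a new point [x] and the old one, now [x.+1], and [v] becomes the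
    short arc joining them. Seen from [x.+1] the point [x] is the last one clockwise, so [v] follows
    [u], which was the last arc there; no other arc ends at [x]. *)
Lemma leaf_out E R S m f u v : gentle_rel E R -> realises E R S m f ->
  u \in S -> v \notin S -> E u v -> (forall t, t \in S -> E t v -> t = u) ->
  (forall t, t \in S -> ~~ E v t) ->
  exists m' f', realises E R (v |: S) m' f'.
Proof.
move=> gr real uS vS Euv inv outv.
have [x [ux lastu Rx]] := leaf_pivot gr real uS vS Euv.
have [Sf fE fR] := real.
pose f' t := if t == v then (x, x.+1) else bump_arc x (f t).
have f'v : f' v = (x, x.+1) by rewrite /f' eqxx.
have f'S t : t \in S -> f' t = bump_arc x (f t).
  by rewrite /f'; case: eqP vS => // -> /negPf->.
have xbump : x.+1 = bump x x by rewrite /bump leqnn.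
have incx t : t \in S -> inc (f' t) x = false.
  move=> tS; rewrite f'S //; apply/negP => /inc_bumpP[z e _].
  by have := neq_bump x z; rewrite -e eqxx.
have incx1 t : t \in S -> inc (f' t) x.+1 = inc (f t) x.
  by move=> tS; rewrite f'S // xbump inc_bump.
have vt y t : t \in S -> inc (f' v) y -> inc (f' t) y -> y = x.+1.
  by move=> tS; rewrite f'v => /orP[] /eqP-> //=; rewrite incx.
have othv : oth (f' v) x.+1 = x by rewrite f'v /oth /=; case: eqP => //; lia.
have vlast t : before f' x.+1 v t = false.
  by rewrite /before othv /cyc; lia.
have tv t : t \in S -> inc (f t) x -> before f' x.+1 t v.
  move=> tS tx; rewrite /before othv f'S // xbump oth_bump.
  have [|_ nx _] := othP tx; first by have := arc_lt Sf tS; lia.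
  by rewrite /cyc /bump leqnn; case: leqP; lia.
have beforeS t t' y : t \in S -> t' \in S -> before f' (bump x y) t t' = before f y t t'.
  by move=> tS t'S; rewrite /before !f'S // !oth_bump cyc_bump.
have nxtS t t' y : t \in S -> t' \in S -> nxt f S y t t' -> nxt f' (v |: S) (bump x y) t t'.
  move=> tS t'S [ty t'y tt' ntt']; split; rewrite ?f'S ?inc_bump ?beforeS //.
  move=> w; rewrite in_setU1 => /orP[/eqP->|wS].
    by move=> vy _; rewrite (vt _ t tS vy) ?vlast // f'S ?inc_bump.
  by rewrite f'S // inc_bump !beforeS //; apply: ntt'.
have nxtI t t' z : t \in S -> t' \in S -> nxt f' (v |: S) z t t' ->
    exists2 y, z = bump x y & nxt f S y t t'.
  move=> tS t'S; rewrite /nxt f'S // => -[/inc_bumpP[y ->{z} ty]].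
  rewrite f'S // inc_bump beforeS // => t'y tt' ntt'; exists y => //; split=> // w wS wy.
  rewrite -!beforeS //; apply: ntt'; first by rewrite in_setU1 wS orbT.
  by rewrite f'S // inc_bump.
have nxtuv : nxt f' (v |: S) x.+1 u v.
  split; [by rewrite incx1 | by rewrite f'v /inc eqxx orbT | exact: tv |].
  move=> w; rewrite in_setU1 => /orP[/eqP-> _ _|wS]; first by rewrite vlast.
  rewrite incx1 // xbump beforeS // => wx uw _.
  have [t tS ut] := succ_exists Sf uS wS ux wx uw.
  exact: lastu tS ut.
have nxtv t z : t \in S -> nxt f' (v |: S) z t v -> t = u /\ z = x.+1.
  move=> tS tzv; have [tz vz _ ntv] := tzv; have e := vt _ _ tS vz tz.
  rewrite {}e in tz vz ntv *; split=> //.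
  apply: contrapT => tu; rewrite incx1 // in tz.
  case: (before_total Sf tS uS tz ux tu) => [h|h].
    apply: (ntv u); rewrite ?in_setU1 ?uS ?orbT ?incx1 ?tv //.
    by rewrite xbump beforeS.
  have [w wS uw] := succ_exists Sf uS tS ux tz h.
  exact: lastu wS uw.
have nvt t z : t \in v |: S -> ~ nxt f' (v |: S) z v t.
  rewrite in_setU1 => /orP[/eqP->|tS] [vz tz + _].
    by rewrite /before cyc_irr.
  by rewrite (vt _ _ tS vz tz) vlast.
exists m.+1, f'; split.
- split=> [t|t|t t'|t t'].
  + rewrite in_setU1 => /orP[/eqP->|tS]; first by rewrite f'v /=.
    by rewrite f'S //= ltn_bump; apply: (arc_lt Sf).
  + have xm := inc_lt_m Sf uS ux.
    rewrite in_setU1 => /orP[/eqP->|tS]; first by rewrite f'v /=.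
    by have := arc_m Sf tS; rewrite f'S //= /bump; case: leqP => /=; lia.
  + have vc w : w \in S -> ~~ cross (f' v) (f' w).
      by move=> _; rewrite f'v /cross /=; lia.
    rewrite !in_setU1 => /orP[/eqP->|tS] /orP[/eqP->|t'S].
    * by rewrite /cross ltnn.
    * exact: vc.
    * by rewrite cross_sym; apply: vc.
    by rewrite !f'S // /cross /= !ltn_bump; apply: (arc_nc Sf).
  have vi w : w \in S -> f' v <> f' w.
    by move=> wS e; have := incx _ wS; rewrite -e f'v /inc eqxx.
  rewrite !in_setU1 => /orP[/eqP->|tS] /orP[/eqP->|t'S] //.
  + by move/vi => /(_ t'S).
  + by move/esym/vi => /(_ tS).
  rewrite !f'S // => -[/(can_inj (bumpK x)) e1 /(can_inj (bumpK x)) e2].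
  apply: (arc_inj Sf) => //.
  by rewrite [f t]surjective_pairing [f t']surjective_pairing e1 e2.
- move=> t t'; rewrite !in_setU1 => /orP[/eqP->|tS] /orP[/eqP->|t'S].
  + rewrite (negPf (gr_irr gr v)); split=> // -[z].
    by move=> /nvt; rewrite setU11 => /(_ isT).
  + rewrite (negPf (outv _ t'S)); split=> // -[z].
    by move=> /nvt; rewrite in_setU1 t'S orbT => /(_ isT).
  + split=> [/(inv _ tS) ->|[z /(nxtv _ _ tS)[-> _]] //]; by exists x.+1.
  split=> [/(fE t t' tS t'S)[y yP]|[z /(nxtI _ _ _ tS t'S)[y _ yP]]].
    by exists (bump x y); apply: nxtS.
  by apply/fE => //; exists y.
move=> a b c y z aS' bS' cS' ab bc.
move: aS' (bS') (cS'); rewrite !in_setU1.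
case/orP=> [/eqP e|aS]; first by rewrite e in ab; case: (nvt b y bS' ab).
case/orP=> [/eqP e|bS]; first by rewrite e in bc; case: (nvt c z cS' bc).
have [y0 ey ab0] := nxtI _ _ _ aS bS ab.
case/orP=> [/eqP e|cS].
  rewrite {}e in bc *; have [eb ez] := nxtv _ _ bS bc; rewrite eb in ab0 *.
  by rewrite ey ez xbump (inj_eq (can_inj (bumpK x))); apply: Rx.
have [z0 ez bc0] := nxtI _ _ _ bS cS bc.
by rewrite ey ez (inj_eq (can_inj (bumpK x))); apply: fR ab0 bc0.
Qed.

Lemma leaf_in E R S m f u v : gentle_rel E R -> realises E R S m f ->
  u \in S -> v \notin S -> E v u -> (forall t, t \in S -> E v t -> t = u) ->
  (forall t, t \in S -> ~~ E t v) ->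
  exists m' f', realises E R (v |: S) m' f'.
Proof.
move=> /gentle_rel_rev gr /realises_rev real uS vS Evu outv inv.
have [m' [f' /realises_rev real']] := leaf_out gr real uS vS Evu outv inv.
exists m', (mirror_arc m' \o f').
by apply: eq_realises real'.
Qed.

End LeafStep.

(** * Closing a chain of successive arcs by a chord *)

Section ClosingStep.

Definition chord (x y : nat) : nat * nat := (minn x y, maxn x y).

(** Crossing in cyclic form, independent of where the numbering of the marked points starts. *)
Definition separates (x y : nat) (d : nat * nat) : bool :=
  cyc x d.1 y && cyc y d.2 x || cyc x d.2 y && cyc y d.1 x.

Lemma cross_chord x y d : (d.1 < d.2)%N -> cross (chord x y) d = separates x y d.
Proof.
case: d => a b /=; rewrite /cross /separates /chord /cyc /= => ab.
by case: (leqP x y) => xy; apply/idP/idP; lia.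
Qed.

Lemma chordE d : (d.1 < d.2)%N -> chord d.1 d.2 = d.
Proof. by case: d => a b /= ab; rewrite /chord; congr pair; lia. Qed.

Lemma chordC x y : chord x y = chord y x.
Proof. by rewrite /chord minnC maxnC. Qed.

Lemma chord_inc d x : inc d x -> (d.1 < d.2)%N -> chord x (oth d x) = d.
Proof.
move=> dx dlt; rewrite -[RHS](chordE dlt); move: dx; rewrite /inc /oth.
case/orP => /eqP->; rewrite ?eqxx // chordC.
by have -> : (d.2 == d.1) = false by lia.
Qed.

Lemma chord_lt x y : x <> y -> ((chord x y).1 < (chord x y).2)%N.
Proof. by rewrite /chord /=; lia. Qed.

Lemma chord_ltm x y m : (x < m)%N -> (y < m)%N -> ((chord x y).2 < m)%N.
Proof. by rewrite /chord /=; lia. Qed.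

Lemma crossxx d : cross d d = false.
Proof. by rewrite /cross ltnn. Qed.

Lemma inc_chord x y z : inc (chord x y) z = (z == x) || (z == y).
Proof. by rewrite /inc /chord /=; lia. Qed.

Lemma oth_chord x y : oth (chord x y) x = y.
Proof. by rewrite /oth /chord /=; case: eqP; lia. Qed.

Lemma separatesP x y d : (d.1 < d.2)%N ->
  reflect (exists p, [/\ inc d p, cyc x p y & cyc y (oth d p) x]) (separates x y d).
Proof.
move=> dlt; have o1 : oth d d.1 = d.2 by rewrite /oth eqxx.
have o2 : oth d d.2 = d.1 by rewrite /oth; case: eqP => //; lia.
apply: (iffP orP) => [[]/andP[h1 h2]|[p [/orP[] /eqP-> h1 h2]]].
- by exists d.1; rewrite /inc eqxx o1.
- by exists d.2; rewrite /inc eqxx orbT o2.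
- by left; rewrite h1 -o1.
by right; rewrite h1 -o2.
Qed.

(** An arc crossing the side [x0 z] of the triangle on [x0], [y], [z] crosses another side or ends
    at [y]. The last hypothesis excludes the second case: it leaves no arc at [y] in the angle from
    [o] to [z], which contains that of the triangle. *)
Lemma separates_step x0 y o z d :
  o = x0 \/ cyc y o x0 -> cyc y x0 z -> (d.1 < d.2)%N ->
  ~~ separates x0 y d -> ~~ separates y z d ->
  (inc d y -> ~~ (cyc y o (oth d y) && cyc y (oth d y) z)) -> ~~ separates x0 z d.
Proof.
move=> ho hz dlt /(separatesP _ _ dlt) n1 /(separatesP _ _ dlt) n2 hy.
apply/(separatesP _ _ dlt) => -[p [dp x0pz zqx0]].
have [dq _ oq] := othP dp (ltac:(lia) : d.1 <> d.2).
set q := oth d p in dq oq zqx0.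
have x0py : cyc x0 p y.
  by apply: cyc_trans x0pz _; rewrite -cyc_rot.
have ypz : cyc y p z by rewrite 2!cyc_rot; apply: (@cyc_trans _ _ x0); rewrite cyc_rot.
have [qy|nqy] := eqVneq q y.
  have := hy; rewrite -qy oq dq => /(_ isT)/negP; apply.
  rewrite qy ypz andbT; have yx0p : cyc y x0 p by rewrite cyc_rot.
  by case: ho => [->|/cyc_trans]; last exact.
have [yqx0|zqy] : cyc y q x0 \/ cyc z q y.
  by apply/orP; move: nqy zqx0 hz; rewrite /cyc; lia.
  by apply: n1; exists p.
by apply: n2; exists p.
Qed.

Variable V : finType.
Implicit Types (E : rel V) (R : V -> V -> V -> bool) (S : {set V}).
Implicit Types (f : V -> nat * nat) (u v w t : V).

Section Chain.
Variables (S : {set V}) (m : nat) (f : V -> nat * nat) (w : V) (x0 : nat).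
Hypothesis Sf : arcs S m f.
Hypotheses (wS : w \in S) (wx0 : inc (f w) x0).
Hypothesis first_w : forall t, t \in S -> inc (f t) x0 -> ~ before f x0 t w.

(* A chain of arcs starting with w at x0, each one the successor of the previous
   one at their common end, has reached the end y of the arc u. *)
Definition reached u y : Prop :=
  [/\ u \in S /\ inc (f u) y,
      u = w /\ y = oth (f w) x0 \/ cyc y (oth (f u) y) x0 /\ cyc x0 y (oth (f w) x0),
      forall t, t \in S -> ~~ separates x0 y (f t) &
      forall t, t \in S -> inc (f t) y ->
        ~~ (cyc y (oth (f u) y) (oth (f t) y) && cyc y (oth (f t) y) x0)].

Lemma reached0 : reached w (oth (f w) x0).
Proof.
have [wy wx _] := othP wx0 (arc_neq Sf wS); have [_ _ o] := othP wx0 (arc_neq Sf wS).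
split=> [//||t tS|t tS ty]; first by left.
  rewrite -cross_chord ?(arc_lt Sf) // chord_inc ?(arc_lt Sf) //.
  exact: (arc_nc Sf).
by rewrite o; apply/negP => /andP[/cyc_asym ->].
Qed.

(** The ends run counterclockwise from the far end of [w] towards [x0]. The new end cannot pass
    [x0], because of the angle kept empty at [y], nor equal it, because [w] is the first arc at
    [x0]. *)
Lemma reachedS u t y : reached u y -> t \in S -> t <> w -> nxt f S y u t ->
  reached t (oth (f t) y).
Proof.
move=> [[uS uy] pos nsep between] tS tw [_ ty yut nut].
have [tz zy oz] := othP ty (arc_neq Sf tS); set z := oth (f t) y in tz zy oz *.
have yoz : cyc y (oth (f u) y) z by exact: yut.
have [[_ wy ow] [x0y ou]] : [/\ inc (f w) (oth (f w) x0), oth (f w) x0 <> x0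
    & oth (f w) (oth (f w) x0) = x0] /\ (x0 <> y /\
    (oth (f u) y = x0 \/ cyc y (oth (f u) y) x0)).
  have h := othP wx0 (arc_neq Sf wS); split=> //; have [_ ? o] := h.
  case: pos => [[-> ->]|[h1 h2]]; first by split; [apply/nesym | left; rewrite o].
  by split; [have [] := cyc_neq h2 | right].
have zx0 : z <> x0.
  move=> e; rewrite e in tz oz; case: pos => [[uw yw]|[_ x0yw]].
    apply: tw; apply: (arc_inj Sf) => //.
    by apply: (arc_eq (arc_lt Sf tS) (arc_lt Sf wS) tz wx0); rewrite oz yw.
  by apply: (first_w tS tz); rewrite /before oz.
have yx0z : cyc y x0 z.
  case: (cyc_total x0y zy (nesym zx0)) => // yzx0.
  case: ou => [e|_]; first by move: yoz; rewrite e (cyc_asym yzx0).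
  by have := between _ tS ty; rewrite -/z yoz yzx0.
have x0zy : cyc x0 z y by rewrite -cyc_rot.
split=> //.
- right; rewrite oz; split; first by rewrite cyc_rot.
  by case: pos => [[_ <-] //|[_]]; apply: cyc_trans.
- move=> t' t'S; have t'lt := arc_lt Sf t'S.
  apply: (@separates_step _ y (oth (f u) y)) => //; first exact: nsep.
    rewrite -cross_chord // chord_inc ?(arc_lt Sf) //; exact: (arc_nc Sf).
  move=> t'y; apply/negP => /andP[h1 h2]; exact: (nut t').
move=> t' t'S t'z; rewrite oz; apply/negP => /andP[h1 h2].
move/negP: (nsep _ t'S); apply; apply/separatesP; first exact: (arc_lt Sf).
by exists z; split=> //; apply: cyc_mid h1 h2.
Qed.

(** The pivot moves to the far end of each arc in turn, so the arcs form a polygonal line. *)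
Fixpoint links u y (s : seq V) : Prop :=
  if s is t :: s' then
    [/\ t \in S, t <> w, nxt f S y u t & links t (oth (f t) y) s']
  else True.

Fixpoint links_end y (s : seq V) : nat :=
  if s is t :: s' then links_end (oth (f t) y) s' else y.

Lemma reached_links u y s : reached u y -> links u y s ->
  reached (last u s) (links_end y s).
Proof.
elim: s u y => //= t s IHs u y ruy [tS tw ut ts].
by apply: IHs => //; apply: reachedS ut.
Qed.

End Chain.

(** Relations along the path force the pivot to change at every arrow, which makes the arcs a chain.
    The last arrow and its pivot are returned because the closing chord ends at the far end of the
    last arc. *)
Lemma links_path E R S m f w a u y s : realises E R S m f ->
  a \in S -> u \in S -> {subset s <= S} -> w \notin s ->
  nxt f S y a u -> path E u s ->
  (forall l1 b c d l2, [:: a, u & s] = l1 ++ [:: b, c, d & l2] -> R b c d) ->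
  links S f w u (oth (f u) y) s /\
  exists b z, [/\ b = last a (belast u s), b \in S, nxt f S z b (last u s) &
    links_end f (oth (f u) y) s = oth (f (last u s)) z].
Proof.
move=> [Sf fE fR]; elim: s a u y => [|t s IHs] a u y aS uS sS ws au /=.
  by move=> _ _; split=> //; exists a, y.
case/andP => Eut Ets RR.
have tS : t \in S by apply: sS; rewrite mem_head.
have [z ut] : exists z, nxt f S z u t by apply/fE.
have /eqP yz : y != z by rewrite -(fR _ _ _ _ _ aS uS tS au ut); apply: (RR [::]).
have zE : z = oth (f u) y.
  have [_ uy _ _] := au; have [uz _ _ _] := ut.
  by have [e|//] := inc_cases uy uz; case: yz.
have sS' : {subset s <= S} by move=> x xs; apply: sS; rewrite in_cons xs orbT.
have ws' : w \notin s by move: ws; rewrite in_cons negb_or => /andP[].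
have RR' l1 b c d l2 : [:: u, t & s] = l1 ++ [:: b, c, d & l2] -> R b c d.
  by move=> e; apply: (RR (a :: l1) _ _ _ l2); rewrite e.
have [l [b [x [be bS bl le]]]] := IHs u t z uS tS sS' ws' ut Ets RR'.
split; last by exists b, x; rewrite -zE.
split; rewrite -?zE //.
by move=> tw; move: ws; rewrite tw mem_head.
Qed.

End ClosingStep.

(** * Induction over connected sets of vertices *)

Section Growth.
Variable V : finType.
Implicit Types (S : {set V}) (f : V -> nat * nat) (u v w t : V).
Variables (E : rel V) (R : V -> V -> V -> bool).
Hypothesis gr : gentle_rel E R.

(** The chord is placed after [u], the last arc at [xj], and before [w], the first arc at [x0]. So
    [v] becomes the last arc at [xj] and the first at [x0], and it breaks up no pair of successive
    arcs. *)
Lemma realises_chord S m f u v w x0 xj : realises E R S m f ->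
  u \in S -> w \in S -> v \notin S -> u <> w ->
  inc (f w) x0 -> inc (f u) xj -> (forall t, t \in S -> ~~ separates x0 xj (f t)) ->
  cyc xj (oth (f u) xj) x0 -> cyc x0 xj (oth (f w) x0) ->
  (forall t, t \in S -> ~ nxt f S xj u t) -> (forall t, t \in S -> ~ nxt f S x0 t w) ->
  (forall t, t \in S -> E t v <-> t = u) -> (forall t, t \in S -> E v t <-> t = w) ->
  (forall t y, t \in S -> nxt f S y t u -> R t u v = (y != xj)) ->
  (forall t y, t \in S -> nxt f S y w t -> R v w t = (x0 != y)) -> R u v w ->
  realises E R (v |: S) m (fun t => if t == v then chord x0 xj else f t).
Proof.
move=> [Sf fE fR] uS wS vS uw wx0 uxj nsep cu cw lastu firstw inv outv Ru Rw Ruvw.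
set f' := fun t : V => _.
have [x0j _ _] := cyc_neq cw.
have f'v : f' v = chord x0 xj by rewrite /f' eqxx.
have f'S t : t \in S -> f' t = f t by rewrite /f'; case: eqP vS => // -> /negPf->.
have ncu t : t \in S -> inc (f t) xj -> ~ before f xj u t.
  move=> tS tx ut; have [s sS us] := succ_exists Sf uS tS uxj tx ut.
  exact: lastu sS us.
have ncw t : t \in S -> inc (f t) x0 -> ~ before f x0 t w.
  move=> tS tx tw; have [s sS sw] := pred_exists Sf tS wS tx wx0 tw.
  exact: firstw sS sw.
have incv y : inc (f' v) y -> y = x0 \/ y = xj.
  by rewrite f'v inc_chord => /orP[] /eqP; [left|right].
have ov0 : oth (f' v) x0 = xj by rewrite f'v oth_chord.
have ovj : oth (f' v) xj = x0 by rewrite f'v chordC oth_chord.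
have iv0 : inc (f' v) x0 by rewrite f'v inc_chord eqxx.
have ivj : inc (f' v) xj by rewrite f'v inc_chord eqxx orbT.
have lastv t : t \in S -> inc (f t) xj -> before f' xj t v.
  move=> tS tx; rewrite /before ovj f'S //.
  have [->//|/eqP tu] := eqVneq t u.
  case: (before_total Sf tS uS tx uxj tu) => [h|/(ncu _ tS tx)] //.
  exact: cyc_trans h cu.
have firstv t : t \in S -> inc (f t) x0 -> before f' x0 v t.
  move=> tS tx; rewrite /before ov0 f'S //.
  have [->//|/eqP tw] := eqVneq t w.
  case: (before_total Sf tS wS tx wx0 tw) => [/(ncw _ tS tx)|h] //.
  exact: cyc_trans cw h.
have beforeS t t' y : t \in S -> t' \in S -> before f' y t t' = before f y t t'.
  by move=> tS t'S; rewrite /before !f'S.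
have nxtS t t' y : t \in S -> t' \in S -> nxt f S y t t' -> nxt f' (v |: S) y t t'.
  move=> tS t'S [ty t'y tt' ntt']; split; rewrite ?f'S ?beforeS //.
  move=> s; rewrite in_setU1 => /orP[/eqP->{s}|sS].
    case/incv => e; rewrite {}e in ty t'y *.
      by move=> tv; have := firstv _ tS ty; rewrite /before (cyc_asym tv).
    by move=> _ vt; have := lastv _ t'S t'y; rewrite /before (cyc_asym vt).
  by rewrite f'S // !beforeS //; apply: ntt'.
have nxtI t t' y : t \in S -> t' \in S -> nxt f' (v |: S) y t t' -> nxt f S y t t'.
  move=> tS t'S []; rewrite !f'S // beforeS // => ty t'y tt' ntt'; split=> // s sS sy.
  rewrite -!beforeS //; apply: ntt'; first by rewrite in_setU1 sS orbT.
  by rewrite f'S.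
have nxtuv : nxt f' (v |: S) xj u v.
  split=> //; [by rewrite f'S | exact: lastv |].
  move=> s; rewrite in_setU1 => /orP[/eqP-> _ _|sS]; first by rewrite /before cyc_irr.
  by rewrite f'S // beforeS // => sx us; case: (ncu _ sS sx us).
have nxtvw : nxt f' (v |: S) x0 v w.
  split=> //; [by rewrite f'S | exact: firstv |].
  move=> s; rewrite in_setU1 => /orP[/eqP->|sS]; first by rewrite /before cyc_irr.
  by rewrite f'S // (beforeS s w) // => sx _ sw; case: (ncw _ sS sx sw).
have Sf' : arcs (v |: S) m f'.
  have um := inc_lt_m Sf uS uxj; have wm := inc_lt_m Sf wS wx0.
  split=> [t|t|t t'|t t'].
  - rewrite in_setU1 => /orP[/eqP->|tS]; last by rewrite f'S ?(arc_lt Sf).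
    by rewrite f'v chord_lt.
  - rewrite in_setU1 => /orP[/eqP->|tS]; last by rewrite f'S ?(arc_m Sf).
    by rewrite f'v chord_ltm.
  - have vc s : s \in S -> ~~ cross (f' v) (f' s).
      by move=> sS; rewrite f'v f'S // cross_chord ?(arc_lt Sf) // nsep.
    rewrite !in_setU1 => /orP[/eqP->|tS] /orP[/eqP->|t'S].
    + by rewrite crossxx.
    + exact: vc.
    + by rewrite cross_sym; apply: vc.
    by rewrite !f'S // (arc_nc Sf).
  have vi s : s \in S -> f' v <> f' s.
    move=> sS e; have sx : inc (f s) xj by rewrite -f'S // -e.
    by have := lastv _ sS sx; rewrite /before -e cyc_irr.
  rewrite !in_setU1 => /orP[/eqP->|tS] /orP[/eqP->|t'S] //.
  - by move/vi => /(_ t'S).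
  - by move/esym/vi => /(_ tS).
  by rewrite !f'S //; apply: (arc_inj Sf).
have SvS t : t \in S -> t \in v |: S by rewrite in_setU1 orbC => ->.
have vvS : v \in v |: S by rewrite setU11.
have nxtv t z : t \in S -> nxt f' (v |: S) z t v -> t = u /\ z = xj.
  move=> tS tv; have [tz /incv[e|e] h _] := tv; rewrite e in tv tz h.
    by rewrite f'S // in tz; have := firstv _ tS tz; rewrite /before (cyc_asym h).
  split; [exact: (nxt_pred_uniq Sf' vvS (SvS _ tS) (SvS _ uS) tv nxtuv) | exact: e].
have nvxt t z : t \in S -> nxt f' (v |: S) z v t -> t = w /\ z = x0.
  move=> tS vt; have [/incv[e|e] tz h _] := vt; rewrite e in vt tz h.
    split; [exact: (nxt_succ_uniq Sf' vvS (SvS _ tS) (SvS _ wS) vt nxtvw) | exact: e].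
  by rewrite f'S // in tz; have := lastv _ tS tz; rewrite /before (cyc_asym h).
split=> //.
- move=> t t'; rewrite !in_setU1 => /orP[/eqP->|tS] /orP[/eqP->|t'S].
  + by rewrite (negPf (gr_irr gr v)); split=> // -[z /nxt_neq].
  + by rewrite outv //; split=> [->|[z /(nvxt _ _ t'S)[]] //]; exists x0.
  + by rewrite inv //; split=> [->|[z /(nxtv _ _ tS)[]] //]; exists xj.
  by rewrite fE //; split=> -[y yP]; exists y; [apply: nxtS | apply: nxtI].
move=> a b c y z; rewrite !in_setU1.
case/orP=> [/eqP->|aS] /orP[/eqP->|bS] /orP[/eqP->|cS].
- by move/nxt_neq.
- by move/nxt_neq.
- by move=> /(nvxt _ _ bS)[-> _] /(nxtv _ _ wS)[e]; case: uw.
- by move=> /(nvxt _ _ bS)[-> ->] /(nxtI _ _ _ wS cS); apply: Rw.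
- by move=> _ /nxt_neq.
- move=> /(nxtv _ _ aS)[-> ->] /(nvxt _ _ cS)[-> ->].
  by rewrite Ruvw; apply/esym/eqP/nesym.
- move=> ab /(nxtv _ _ bS)[e ->]; rewrite e in ab *.
  by apply: Ru => //; apply: nxtI ab.
by move=> ab bc; apply: fR => //; apply: nxtI.
Qed.

Hypothesis relR : forall a b d r,
  uniq [:: a, b, d & r] -> cycle E [:: a, b, d & r] -> R a b d.

(** The arcs of the cycle other than [v] form a chain from [w] to [u], and the chord for [v] joins
    the two ends left over. It crosses nothing by [reached_links]; the relations around the cycle,
    with gentleness, keep other arcs from following [u] or preceding [w] there. *)
Lemma close_step S m f v w s : realises E R S m f ->
  v \notin S -> s != [::] -> {subset w :: s <= S} -> uniq (v :: w :: s) ->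
  cycle E (v :: w :: s) ->
  (forall t, t \in S -> E t v -> t = last w s) -> (forall t, t \in S -> E v t -> t = w) ->
  exists f', realises E R (v |: S) m f'.
Proof.
move=> real vS; case: s => // b s _ sS uniqc cycc inv outv.
have [Sf fE fR] := real.
have relc n c d e l : rot n [:: v, w, b & s] = [:: c, d, e & l] -> R c d e.
  move=> h; apply: (relR (r := l)); rewrite -h ?rot_uniq //.
  by rewrite rot_cycle.
have vP t : t \in S -> t <> v by move=> tS e; rewrite -e tS in vS.
have nE t t' x : t \in S -> t' \in S -> nxt f S x t t' -> E t t'.
  by move=> tS t'S h; apply/fE => //; exists x.
set u := last w (b :: s) in inv.
have rot l1 a c d l2 : [:: v, w, b & s] = l1 ++ [:: a, c, d & l2] -> R a c d.
  by move=> e; apply: (relc (size l1) _ _ _ (l2 ++ l1)); rewrite e rot_size_cat.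
have wS : w \in S by apply: sS; rewrite mem_head.
have bS : b \in S by apply: sS; rewrite !in_cons eqxx orbT.
have uS : u \in S by apply: sS; rewrite /u mem_last.
have wbs : w \notin b :: s by move: uniqc => /= /and3P[].
have uw : u <> w by move=> e; rewrite -e /u /= mem_last in wbs.
move: cycc; rewrite /cycle rcons_cons /= rcons_path => /and4P[Evw Ewb Ebs].
rewrite -/(last w (b :: s)) -/u => Euv.
have [x1 wb] : exists x, nxt f S x w b by apply/fE.
have [wx1 _ _ _] := wb; have := othP wx1 (arc_neq Sf wS).
set x0 := oth (f w) x1 => -[wx0 x01 ox0].
have Ebw : E w b by apply: nE wb.
(* The composition from [t] through [w] to [b] would change the pivot and be a relation, just like
   the one from [v], so [t] would be [v]. *)
have firstw t : t \in S -> ~ nxt f S x0 t w.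
  move=> tS tw; apply: (vP t tS); apply: (gr_pre gr (nE _ _ _ tS wS tw) Evw Ewb).
  rewrite (fR _ _ _ _ _ tS wS bS tw wb) (rot [::] v w b s) //.
  exact/eqP.
have firstw' t : t \in S -> inc (f t) x0 -> ~ before f x0 t w.
  move=> tS tx tw; have [c cS] := pred_exists Sf tS wS tx wx0 tw.
  exact: firstw.
have ss : {subset s <= S} by move=> t ts; apply: sS; rewrite !in_cons ts !orbT.
have ws : w \notin s by move: wbs; rewrite in_cons negb_or => /andP[].
have rot' l1 c d e l2 : [:: w, b & s] = l1 ++ [:: c, d, e & l2] -> R c d e.
  by move=> h; apply: (rot (v :: l1) _ _ _ l2); rewrite h.
have [lk [a [y [ea aS au endE]]]] := links_path real wS bS ss ws wb Ebs rot'.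
have r0 := reached0 Sf wS wx0; rewrite ox0 in r0.
have lk' : links S f w w x1 (b :: s) by split=> //; move=> e; rewrite e mem_head in wbs.
have := reached_links Sf wS wx0 firstw' r0 lk'.
rewrite -/u /= endE -/(last w (b :: s)) -/u in au * .
have [_ uy _ _] := au; have := othP uy (arc_neq Sf uS).
set xj := oth (f u) y => -[uxj xjy oxj].
move=> [_ pos nsep _].
have [cu cw] : cyc xj (oth (f u) xj) x0 /\ cyc x0 xj (oth (f w) x0).
  by case: pos => [[e]|].
have sE : b :: s = rcons (belast b s) u by rewrite /u /= -lastI.
have Ruvw : R u v w.
  apply: (relc (size [:: v, w & belast b s]) _ _ _ (belast b s)).
  by rewrite sE -!rcons_cons -cats1 rot_size_cat.
have Rau : R a u v.
  have e : [:: v, w, b & s] = (v :: belast w (belast b s)) ++ [:: a; u].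
    by rewrite sE /= -cat_rcons ea -lastI cats1.
    apply: (relc (size (v :: belast w (belast b s))) _ _ _ (belast w (belast b s))).
  by rewrite e rot_size_cat.
have Eau := nE _ _ _ aS uS au.
have /eqP yxj := nesym xjy.
eexists; apply: (realises_chord real uS wS vS uw wx0 uxj nsep cu cw) => //.
- move=> t tS ut; apply: (vP t tS); apply/esym.
  apply: (gr_post gr Eau Euv (nE _ _ _ uS tS ut)).
  by rewrite Rau (fR _ _ _ _ _ aS uS tS au ut).
- by move=> t tS; split=> [|->//]; apply: inv.
- by move=> t tS; split=> [|->//]; apply: outv.
- move=> t z tS tu; have [_ uz _ _] := tu.
  have [e|e] := inc_cases uy uz; rewrite {}e in tu *.
    by rewrite yxj (nxt_pred_uniq Sf uS tS aS tu au).
  rewrite -/xj eqxx; apply/negP => Rt.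
  have ta : t = a by apply: (gr_pre gr (nE _ _ _ tS uS tu) Eau Euv); rewrite Rau.
  by rewrite ta in tu; case: xjy; apply: nxt_pivot tu au.
move=> t z tS wt; have [wz _ _ _] := wt.
have [e|e] := inc_cases wx1 wz; rewrite {}e in wt *.
  rewrite (nxt_succ_uniq Sf wS tS bS wt wb) (rot [::] v w b s) //.
  by apply/esym/eqP.
rewrite -/x0 eqxx; apply/negP => Rt.
have tb : t = b.
  by apply: (gr_post gr Evw (nE _ _ _ wS tS wt) Ewb); rewrite Rt (rot [::] v w b s).
by rewrite tb in wt; case: x01; apply: nxt_pivot wt wb.
Qed.

Let U : rel V := fun u v => E u v || E v u.
Hypothesis cycE : forall c, uniq c -> (2 < size c)%N -> cycle U c ->
  cycle E c \/ cycle (rev_rel E) c.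

Definition within S : rel V := fun u v => [&& u \in S, v \in S & U u v].
Definition connected_in S : Prop :=
  forall u v, u \in S -> v \in S -> connect (within S) u v.

Let Usym u v : U u v = U v u.
Proof. by rewrite /U orbC. Qed.

Lemma connected_add S u v : connected_in S -> u \in S -> U u v -> connected_in (v |: S).
Proof.
move=> conS uS Uuv.
have sub a b : connect (within S) a b -> connect (within (v |: S)) a b.
  apply: connect_sub => x y /and3P[xS yS xy]; apply: connect1.
  by rewrite /within !in_setU1 xS yS !orbT.
have uv : connect (within (v |: S)) u v.
  by apply: connect1; rewrite /within !in_setU1 uS eqxx orbT.
have vu : connect (within (v |: S)) v u.
  by apply: connect1; rewrite /within !in_setU1 uS eqxx orbT Usym.
move=> a b; rewrite !in_setU1 => /orP[/eqP->|aS] /orP[/eqP->|bS].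
- exact: connect0.
- by apply: connect_trans vu (sub _ _ (conS _ _ uS bS)).
- by apply: connect_trans (sub _ _ (conS _ _ aS uS)) uv.
exact: sub (conS _ _ aS bS).
Qed.

(** A simple path within [S] from [t] to [t'] closes up through [v]; as [t] and [t'] differ, the
    cycle has at least three vertices. *)
Lemma cycle_through S v t t' : connected_in S -> v \notin S -> t \in S -> t' \in S ->
  t <> t' -> U v t -> U t' v -> exists s,
  [/\ s != [::], {subset t :: s <= S}, uniq (v :: t :: s), last t s = t' &
      cycle E (v :: t :: s) \/ cycle (rev_rel E) (v :: t :: s)].
Proof.
move=> conS vS tS t'S tt' Uvt Ut'v.
have /connectP[p pp lp] := conS _ _ tS t'S.
case/shortenP: pp lp => s ps us _ ls.
have sS : {subset t :: s <= S}.
  move: ps tS {ls us}; elim: (s) (t) => [|b r IHr] a /=.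
    by move=> _ aS x; rewrite inE => /eqP->.
  case/andP => /and3P[_ bS _] pr aS x; rewrite in_cons => /orP[/eqP->//|].
  exact: (IHr b).
have s0 : s != [::] by apply/eqP => e; apply: tt'; rewrite ls e.
have uvs : uniq (v :: t :: s) by rewrite cons_uniq us andbT; apply/negP => /sS; apply/negP.
exists s; split=> //; apply: cycE => //; first by case: (s) s0.
rewrite /= rcons_path Uvt -ls Ut'v andbT /=.
by apply: sub_path ps => x y /and3P[].
Qed.

(** Two neighbours of [v] in [S] lie with [v] on an oriented cycle, so one of them precedes [v] and
    the other follows it. Hence [v] has a single neighbour and is a leaf, or it has one of each kind
    and closes a cycle. *)
Lemma realises_grow S m f u v : connected_in S -> realises E R S m f ->
  u \in S -> v \notin S -> U u v -> exists m' f', realises E R (v |: S) m' f'.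
Proof.
move=> conS real uS vS Uuv.
have inv t t' : t \in S -> t' \in S -> E t v -> E t' v -> t = t'.
  move=> tS t'S Etv Et'v; apply: contrapT => tt'.
  have [||s [_ _ _ ls]] := cycle_through conS vS tS t'S tt'.
  - by rewrite /U Etv orbT.
  - by rewrite /U Et'v.
  case=> /=; rewrite rcons_path ls => /and3P[]; rewrite /rev_rel.
    by move/(gr_2cycle gr); rewrite Etv.
  by move=> _ _ /(gr_2cycle gr); rewrite Et'v.
have outv t t' : t \in S -> t' \in S -> E v t -> E v t' -> t = t'.
  move=> tS t'S Evt Evt'; apply: contrapT => tt'.
  have [||s [_ _ _ ls]] := cycle_through conS vS tS t'S tt'.
  - by rewrite /U Evt.
  - by rewrite /U Evt' orbT.
  case=> /=; rewrite rcons_path ls => /and3P[]; rewrite /rev_rel.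
    by move=> _ _ /(gr_2cycle gr); rewrite Evt'.
  by move/(gr_2cycle gr); rewrite Evt.
have [[a aS Eav]|na] := pselect (exists2 a, a \in S & E a v); last first.
  have na' t : t \in S -> ~~ E t v by move=> tS; apply/negP => tv; apply: na; exists t.
  have Evu : E v u by case/orP: Uuv => // Euv; have := na' _ uS; rewrite Euv.
  by apply: (leaf_in gr real uS vS Evu) => // t tS vt; apply: outv vt Evu.
have [[b bS Evb]|nb] := pselect (exists2 b, b \in S & E v b); last first.
  have nb' t : t \in S -> ~~ E v t by move=> tS; apply/negP => tv; apply: nb; exists t.
  by apply: (leaf_out gr real aS vS Eav) => // t tS tv; apply: inv tv Eav.
have ba : b <> a by move=> e; have := gr_2cycle gr Eav; rewrite -e Evb.
have [||s [s0 sS us ls]] := cycle_through conS vS bS aS ba.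
- by rewrite /U Evb.
- by rewrite /U Eav.
case=> [cE|/= /andP[]]; last by rewrite /rev_rel => /(gr_2cycle gr); rewrite Evb.
have [|| f' real'] := close_step real vS s0 sS us cE.
- by move=> t tS tv; rewrite ls; apply: inv tv Eav.
- by move=> t tS vt; apply: outv vt Evb.
by exists m, f'.
Qed.

(** The starting point is a disc with two marked points and the arc joining them. *)
Lemma realises1 v : realises E R [set v] 2 (fun=> (0, 1)%N).
Proof.
split=> [|u w /set1P-> /set1P->|u w t x y /set1P-> /set1P-> _].
- by split=> // u w /set1P-> /set1P->.
- by rewrite (negPf (gr_irr gr v)); split=> // -[x /nxt_neq].
by move/nxt_neq.
Qed.

Hypothesis conU : forall u v, connect U u v.

Theorem realisation_exists (v0 : V) : exists m f, realises E R [set: V] m f.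
Proof.
suff grow n : (n < #|V|)%N -> exists S : {set V}, [/\ #|S| = n.+1, connected_in S &
    exists m f, realises E R S m f].
  have V0 : (0 < #|V|)%N by apply/card_gt0P; exists v0.
  have [|S [cS _]] := grow #|V|.-1; first by rewrite prednK.
  suff -> : S = [set: V] by [].
  by apply/eqP; rewrite eqEcard subsetT cS cardsT leqSpred.
elim: n => [_|n IHn nV].
  exists [set v0]; rewrite cards1; split=> //; last first.
    by exists 2%N, (fun=> (0, 1)%N); apply: realises1.
  by move=> u w /set1P-> /set1P->; apply: connect0.
have [|S [cS conS [m [f real]]]] := IHn; first exact: ltnW.
have [u [v [uS vS Uuv]]] : exists u v, [/\ u \in S, v \notin S & U u v].
  apply: contrapT => none.
  (* Without an edge leaving it, [S] would be a union of components, hence everything. *)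
  have clS : closed U (mem S).
    have cl u v : U u v -> u \in S -> v \in S.
      by move=> Uuv uS; apply: contrapT => /negP vS; apply: none; exists u, v.
    by move=> u v Uuv; apply/idP/idP; apply: cl; rewrite // Usym.
  have [s sS] : exists s, s \in S by apply/card_gt0P; rewrite cS.
  have := nV; rewrite ltnNge => /negP; apply; rewrite -cS -cardsT subset_leq_card //.
  by apply/subsetP => x _; rewrite -(closed_connect clS (conU s x)).
have [m' [f' real']] := realises_grow conS real uS vS Uuv.
exists (v |: S); split; first by rewrite cardsU1 vS cS.
  exact: connected_add conS uS Uuv.
by exists m', f'.
Qed.

End Growth.

(** * Tilings give gentle algebras *)

Section Nesting.
Implicit Types d e g : nat * nat.

(** For distinct noncrossing arcs this tells on which side of [e] the arc [d] lies, with the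
    convention of [half_disc]: true for the segments from [e.1] to [e.2]. *)
Definition nested d e : bool := (e.1 <= d.1)%N && (d.2 <= e.2)%N.

Lemma arc_of_inc d x : (d.1 < d.2)%N -> inc d x ->
  d = (x, oth d x) /\ (x < oth d x)%N \/ d = (oth d x, x) /\ (oth d x < x)%N.
Proof.
case: d => a b /= ab; rewrite /inc /oth /=; case: (x =P a) => [->|_] /=; first by left.
by move/eqP->; right.
Qed.

Lemma lt_neq d : (d.1 < d.2)%N -> d.1 <> d.2.
Proof. by move=> + e; rewrite e ltnn. Qed.

Lemma nested_between d e g x : (d.1 < d.2)%N -> (e.1 < e.2)%N -> (g.1 < g.2)%N ->
  inc d x -> inc e x -> inc g x ->
  cyc x (oth d x) (oth g x) -> cyc x (oth g x) (oth e x) ->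
  nested d g = ~~ nested e g.
Proof.
move=> dlt elt glt /(arc_of_inc dlt) hd /(arc_of_inc elt) he /(arc_of_inc glt) hg.
move: (oth d x) (oth e x) (oth g x) hd he hg => y z t hd he hg.
by case: hd he hg => [] [-> ?] [] [-> ?] [] [-> ?]; rewrite /cyc /nested /=; lia.
Qed.

(** To have [d] and [e] on different sides, [g] would have to cross one of them or leave [x] in the
    angle between them. *)
Lemma nested_agree d e g x : (d.1 < d.2)%N -> (e.1 < e.2)%N -> (g.1 < g.2)%N ->
  inc d x -> inc e x -> cyc x (oth d x) (oth e x) -> d <> g -> e <> g ->
  ~~ cross d g -> ~~ cross e g ->
  (inc g x -> ~ (cyc x (oth d x) (oth g x) /\ cyc x (oth g x) (oth e x))) ->
  nested d g = nested e g.
Proof.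
move=> dlt elt glt dx ex yz dg eg cd ce ng.
have [gx|ngx] := boolP (inc g x).
  have gn : cyc x (oth g x) (oth d x) \/ cyc x (oth e x) (oth g x).
    have [_ dn _] := othP dx (lt_neq dlt).
    have [_ en _] := othP ex (lt_neq elt).
    have [_ gn _] := othP gx (lt_neq glt).
    have [|h|] := cyc_total dn gn; [|right|by left].
      by move=> /(arc_eq dlt glt dx gx).
    have [|h'|//] := cyc_total gn en; first by move=> /esym/(arc_eq elt glt ex gx).
    by case: (ng gx).
  move: (arc_of_inc dlt dx) (arc_of_inc elt ex) (arc_of_inc glt gx) yz gn.
  move: (oth d x) (oth e x) (oth g x) => y z t hd he hg yz gn.
  clear -hd he hg yz gn.
  by case: hd he hg => [] [-> ?] [] [-> ?] [] [-> ?]; move: yz gn; rewrite /cyc /nested /=; lia.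
move: (arc_of_inc dlt dx) (arc_of_inc elt ex) yz.
move: (oth d x) (oth e x) => y z hd he yz.
move: cd ce ngx; rewrite /inc /cross /nested.
clear -hd he glt; case: g glt => a b /= ab.
by case: hd he => [] [-> ?] [] [-> ?] /=; lia.
Qed.

(** Clockwise rotations about the two ends of an arc lead to opposite sides of it. So an arc before
    [e] at one end and an arc after [e] at the other lie on the same side, and in [nested_fork],
    where both come before or both after, on opposite sides. *)
Lemma nested_turn d e g x y : (d.1 < d.2)%N -> (e.1 < e.2)%N -> (g.1 < g.2)%N ->
  inc d x -> inc e x -> inc e y -> inc g y -> x <> y ->
  cyc x (oth d x) (oth e x) -> cyc y (oth e y) (oth g y) ->
  nested d e = nested g e.
Proof.
move=> dlt elt glt dx ex ey gy xy.
have [/esym //|yo] := inc_cases ex ey.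
have [_ _ oo] := othP ex (lt_neq elt).
have oy : oth e y = x by rewrite yo.
rewrite oy -yo.
have := arc_of_inc elt ex; rewrite -yo.
move: (arc_of_inc dlt dx) (arc_of_inc glt gy).
move: (oth d x) (oth g y) => p q hd hg he.
clear -hd hg he.
by case: hd he hg => [] [-> ?] [] [-> ?] [] [-> ?]; rewrite /cyc /nested /=; lia.
Qed.

Lemma nested_fork d e g x y : (d.1 < d.2)%N -> (e.1 < e.2)%N -> (g.1 < g.2)%N ->
  inc d x -> inc e x -> inc e y -> inc g y -> x <> y ->
  cyc x (oth d x) (oth e x) && cyc y (oth g y) (oth e y) ||
  cyc x (oth e x) (oth d x) && cyc y (oth e y) (oth g y) ->
  nested d e = ~~ nested g e.
Proof.
move=> dlt elt glt dx ex ey gy xy.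
have [/esym //|yo] := inc_cases ex ey.
have [_ _ oo] := othP ex (lt_neq elt).
have oy : oth e y = x by rewrite yo.
rewrite oy -yo.
have := arc_of_inc elt ex; rewrite -yo.
move: (arc_of_inc dlt dx) (arc_of_inc glt gy).
move: (oth d x) (oth g y) => p q hd hg he.
clear -hd hg he.
by case: hd he hg => [] [-> ?] [] [-> ?] [] [-> ?]; rewrite /cyc /nested /=; lia.
Qed.

(** The doubled conclusion fits [half_meet] for twice the same half-disc. The segment [m.-1] lies
    outside every arc. *)
Lemma half_point d m b : (d.1 < d.2)%N -> (d.2 < m)%N ->
  exists2 i, (i < m)%N & (d.1 <= i < d.2)%N == b /\ (d.1 <= i < d.2)%N == b.
Proof. by move=> dl dm; case: b; [exists d.1 | exists m.-1]; lia. Qed.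

(** [d] lies on one side of [e], and as the arcs differ, each half-disc of [d] contains a boundary
    segment on that side. *)
Lemma half_halves d e m c : (d.1 < d.2)%N -> (d.2 < m)%N -> (e.1 < e.2)%N -> (e.2 < m)%N ->
  ~~ cross d e -> d <> e -> exists2 i, (i < m)%N &
    (d.1 <= i < d.2)%N == c /\ (e.1 <= i < e.2)%N == nested d e.
Proof.
case: d e => [p q] [a b]; rewrite /cross /nested /= => pq qm ab bm nc ne.
have {ne} ne : p != a \/ q != b.
  by apply/orP; rewrite -negb_and -xpair_eqE; apply/eqP.
case: c.
  by exists (if (p == a) && (b < q)%N then b else p); case: ifP; lia.
exists (if (a <= p)%N && (q <= b)%N then (if (a < p)%N then a else q) else m.-1).
  by do !case: ifP; lia.
by do !case: ifP; lia.
Qed.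

(** A half-disc of [e] that did not contain [d] would be contained in one of the half-discs of [d],
    and could not meet both. *)
Lemma halves_nested d e i j b : (d.1 < d.2)%N -> (e.1 < e.2)%N -> ~~ cross d e ->
  (d.1 <= i < d.2)%N == true -> (e.1 <= i < e.2)%N == b ->
  (d.1 <= j < d.2)%N == false -> (e.1 <= j < e.2)%N == b -> d <> e ->
  b = nested d e.
Proof.
case: d e => [p q] [a c]; rewrite /cross /nested /= => pq ac nc h1 h2 h3 h4 ne.
have {ne} ne : p != a \/ q != c.
  by apply/orP; rewrite -negb_and -xpair_eqE; apply/eqP.
by move: h2 h4; case: b; lia.
Qed.

End Nesting.

(** * Tiles and arrows of a tiling *)

Section TilingStructure.
Variables (m : nat) (T : {set 'I_m * 'I_m}).
Hypothesis Ttil : is_tiling T.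
Local Notation D := (tdiag T).
Implicit Types d e f g : D.

Definition arc d : nat * nat := (nat_of_ord (val d).1, nat_of_ord (val d).2).
Local Notation inn d e := (nested (arc d) (arc e)).

Lemma arc_inj_tdiag : injective arc.
Proof.
move=> d e [e1 e2]; apply: val_inj.
rewrite [val d]surjective_pairing [val e]surjective_pairing.
by congr pair; apply: val_inj.
Qed.

Lemma arcs_tiling : arcs [set: D] m arc.
Proof.
split=> [d _|d _|d e _ _|d e _ _]; first exact: (Ttil.1 _ (valP d)).
- exact: ltn_ord.
- exact: (Ttil.2 _ _ (valP d) (valP e)).
exact: arc_inj_tdiag.
Qed.

Let arclt d : ((arc d).1 < (arc d).2)%N := arc_lt arcs_tiling (in_setT d).
Let arcnc d e : ~~ cross (arc d) (arc e) := arc_nc arcs_tiling (in_setT d) (in_setT e).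

Lemma mem_half d b (i : 'I_m) :
  (i \in half_disc d b) = (((arc d).1 <= i < (arc d).2)%N == b).
Proof. by rewrite /half_disc; case: b; rewrite !inE ?eqb_id ?eqbF_neg. Qed.

(** The tile beside [d] on its side [b]: relative to any other diagonal, it lies where [d] lies. *)
Definition tile_at d b : {ffun D -> bool} :=
  [ffun f => if f == d then b else inn d f].

Lemma tile_at_flip d b :
  [ffun e => if e == d then ~~ tile_at d b e else tile_at d b e] = tile_at d (~~ b).
Proof. by apply/ffunP => f; rewrite !ffunE; case: eqP. Qed.

Lemma half_meet d b e c :
  reflect (exists2 i, i < m & ((arc d).1 <= i < (arc d).2) == b /\
                              (((arc e).1 <= i < (arc e).2) == c))%N
    (half_disc d b :&: half_disc e c != set0).
Proof.
apply: (iffP (set0Pn _)) => [[i]|[i im [h1 h2]]].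
  by rewrite inE !mem_half => /andP[h1 h2]; exists i.
by exists (Ordinal im); rewrite inE !mem_half h1 h2.
Qed.

Lemma tile_atP d b : tile (tile_at d b).
Proof.
suff w e f : half_disc e (tile_at d b e) :&: half_disc f (tile_at d b f) != set0.
  by apply/forallP => e; apply/forallP => f; apply: w.
have dm := arc_m arcs_tiling (in_setT d); have dl := arclt d.
have em := arc_m arcs_tiling (in_setT e); have fm := arc_m arcs_tiling (in_setT f).
have dhalf g c : g <> d -> exists2 i, (i < m)%N &
    ((arc d).1 <= i < (arc d).2)%N == c /\ ((arc g).1 <= i < (arc g).2)%N == inn d g.
  move=> gd; have gm := arc_m arcs_tiling (in_setT g).
  apply: (half_halves c dl dm (arclt g) gm (arcnc d g)).
  by move/arc_inj_tdiag/esym.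
apply/half_meet; rewrite !ffunE; case: eqP => [->|ed]; case: eqP => [->|fd].
- by have [i im] := half_point b dl dm; exists i.
- exact: dhalf.
- by have [i im [h1 h2]] := dhalf e b ed; exists i.
(* The half-discs of [e] and [f] both contain [d]. A common segment is found inside [d] if [d] is
   nested in one of the two arcs, and is [m.-1] otherwise. *)
case ne: (inn d e); case nf: (inn d f).
- exists (arc d).1; first exact: ltn_trans dm.
  by move: ne nf; clear -dl; rewrite /nested; lia.
- have [i im [h1 h2]] := dhalf f true fd; exists i => //; move: h1 h2 ne; rewrite nf.
  by clear; rewrite /nested; lia.
- have [i im [h1 h2]] := dhalf e true ed; exists i => //; move: h1 h2 nf; rewrite ne.
  by clear; rewrite /nested; lia.
by exists m.-1; move: em fm; clear; lia.
Qed.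

Lemma side_tile_at d b : side (tile_at d b) d.
Proof. by rewrite /side tile_at_flip tile_atP. Qed.

(** As [P] and its flip across [d] are both tiles, the half-disc chosen for [f] meets both
    half-discs of [d], and so contains [d]. *)
Lemma side_tileE P d : tile P -> side P d -> P = tile_at d (P d).
Proof.
move=> tP sP; apply/ffunP => f; rewrite ffunE; case: eqP => [->//|fd].
have meet c : half_disc d c :&: half_disc f (P f) != set0.
  have := forallP (forallP tP d) f; have := forallP (forallP sP d) f.
  rewrite !ffunE eqxx; case: (f =P d) => // _; case: (P d) c => [] [] //.
have /half_meet[i im [h1 h2]] := meet true.
have /half_meet[j jm [h3 h4]] := meet false.
have nc := arcnc d f.
by apply: (halves_nested (arclt d) (arclt f) nc h1 h2 h3 h4) => /arc_inj_tdiag/esym.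
Qed.

Lemma side_nested P d f : tile P -> side P d -> f <> d -> P f = inn d f.
Proof. by move=> tP sd /eqP/negPf fd; rewrite (side_tileE tP sd) ffunE fd. Qed.

(** The common tile is the one beside [d] on the side of [e]; agreement on all other diagonals
    identifies it with the one beside [e] on the side of [d]. *)
Lemma common_tileP d e : d <> e ->
  (exists P, [/\ tile P, side P d & side P e]) <->
  forall f, f <> d -> f <> e -> inn d f = inn e f.
Proof.
move=> de; split=> [[P [tP sd se]] f fd fe|agree].
  by rewrite -(side_nested tP sd) // (side_nested tP se).
have ee : tile_at d (inn e d) = tile_at e (inn d e).
  apply/ffunP => f; rewrite !ffunE; case: eqP => [->|fd]; case: eqP => [e1|fe] //.
  - by rewrite e1.
  exact: agree.
exists (tile_at d (inn e d)); split; first exact: tile_atP.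
  exact: side_tile_at.
by rewrite ee; apply: side_tile_at.
Qed.

Lemma cw_dist_rk (x y : 'I_m) : x != y -> cw_dist x y = rk m x y.
Proof.
rewrite -(inj_eq val_inj) /cw_dist /rk /= => xy; have := ltn_ord x; have := ltn_ord y.
case: (ltnP x y) => [lt|le] *.
  have -> : (y + (m - x) = m + (y - x))%N by lia.
  by rewrite modnDl modn_small; lia.
by rewrite modn_small; lia.
Qed.

Lemma endpointE d (x : 'I_m) : endpoint d x = inc (arc d) x.
Proof. by []. Qed.

Lemma other_endE d (x : 'I_m) : nat_of_ord (other_end d x) = oth (arc d) x.
Proof. by rewrite /other_end /oth /= -val_eqE; case: eqP. Qed.

(** An arc strictly between [d] and [e] at their common endpoint would separate them and deny them a
    common tile; conversely, nothing separates successive arcs. *)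
Lemma tarrowP d e : tarrow d e <-> exists x, nxt arc [set: D] x d e.
Proof.
have nd d' x : inc (arc d') x -> oth (arc d') x <> x.
  by move=> dx; have [] := othP dx (lt_neq (arclt d')).
have cw (x : 'I_m) : endpoint d x -> endpoint e x ->
    (cw_dist x (other_end d x) < cw_dist x (other_end e x))%N = before arc x d e.
  rewrite !endpointE => dx ex; rewrite (before_rk arcs_tiling) ?in_setT //.
  by rewrite !cw_dist_rk ?other_endE // -val_eqE /= other_endE eq_sym; apply/eqP/nd.
split=> [/andP[/existsP[P /and3P[tP sd se]] /existsP[x /and3P[dx ex]]]|[x xde]].
  rewrite cw // => de; exists (nat_of_ord x); split; rewrite -?endpointE //.
  move=> f _ fx df fe.
  have dne : d <> e by move=> h; rewrite h /before cyc_irr in de.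
  have fd : f <> d by move=> h; rewrite h /before cyc_irr in df.
  have fne : f <> e by move=> h; rewrite h /before cyc_irr in fe.
  have [/(_ (ex_intro _ P (And3 tP sd se)) f fd fne) + _] := common_tileP dne.
  rewrite (nested_between (arclt d) (arclt e) (arclt f) dx ex fx df fe).
  by case: (inn e f).
have [dx ex de nde] := xde; have dne : d <> e by exact: nxt_neq xde.
apply/andP; split.
  apply/existsP; have [_ [|P [tP sd se]]] := common_tileP dne; last by exists P; apply/and3P.
  move=> f fd fe; apply: (nested_agree (arclt d) (arclt e) (arclt f) dx ex de) => //.
  - by move/arc_inj_tdiag/esym.
  - by move/arc_inj_tdiag/esym.
  by move=> fx [df fe']; apply: (nde f).
have xm : (x < m)%N by exact: (inc_lt_m arcs_tiling (in_setT d) dx).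
apply/existsP; exists (Ordinal xm).
by rewrite !endpointE dx ex cw.
Qed.

(** With a single pivot the middle arc [e] separates [d] from [f]. With two pivots both lie on the
    same side of [e], and the tile beside [e] there has all three as sides. *)
Lemma tarrow_nxt d e f x y : nxt arc [set: D] x d e -> nxt arc [set: D] y e f ->
  (exists P, [/\ tile P, side P d, side P e & side P f]) <-> x <> y.
Proof.
move=> xde yef; have [dx ex de _] := xde; have [ey fy ef _] := yef.
have dne := nxt_neq xde; have enf := nxt_neq yef.
have : tarrow d e by apply/tarrowP; exists x.
case/andP => /existsP[P /and3P[tP sd se]] _.
have : tarrow e f by apply/tarrowP; exists y.
case/andP => /existsP[P' /and3P[tP' se' sf]] _.
split=> [[P0 [tP0 sd0 se0 sf0]] xy|xy].
  have h := nested_between (arclt d) (arclt f) (arclt e) dx.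
  move: yef ey fy ef; rewrite -xy => yef _ fx ef.
  have := h fx ex de ef.
  rewrite -(side_nested tP0 sd0) ?(side_nested tP0 sf0) //; last exact/nesym.
  by case: (inn f e).
exists P; split=> //; suff -> : P = P' by [].
rewrite (side_tileE tP se) (side_tileE tP' se'); congr tile_at.
rewrite (side_nested tP sd) ?(side_nested tP' sf) //; last exact/nesym.
exact: (nested_turn (arclt d) (arclt e) (arclt f) dx ex ey fy xy de ef).
Qed.

End TilingStructure.

Section QuadraticArrows.
Variables (Q : quiver).

Definition path2 (a b : arr Q) : qpath Q := pcat (arrow_path a) (arrow_path b).

Lemma parrows_path2 a b : tgt a = src b -> parrows (path2 a b) = [:: a; b].
Proof. by move=> ab; rewrite parrows_cat. Qed.

Lemma path2_inj a b a' b' : tgt a = src b -> tgt a' = src b' ->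
  path2 a b = path2 a' b' -> a = a' /\ b = b'.
Proof.
by move=> ab ab' /(congr1 (@parrows Q)); rewrite !parrows_path2 // => -[].
Qed.

Lemma path2P (p : qpath Q) : plength p = 2%N -> exists a b, tgt a = src b /\ p = path2 a b.
Proof.
case: p => [[v [|a [|b [|? ?]]]] wp] //= _; exists a, b.
have /and3P[/eqP av /eqP ab _] : [&& src a == v, src b == tgt a & true] by exact: wp.
split=> //.
by apply: qpathP; rewrite ?parrows_path2 // pstart_cat.
Qed.

Lemma path_cons (p : qpath Q) a s : parrows p = a :: s -> exists q,
  [/\ pstart q = tgt a, parrows q = s, pstart p = src a & p = pcat (arrow_path a) q].
Proof.
case: p => [[v [|b t]] wp] // [eb et]; rewrite {}eb {}et {b t} in wp *.
have /andP[/eqP av ws] : (src a == v) && walk (tgt a) s by [].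
exists (exist _ (tgt a, s) ws); split=> //.
by apply: qpathP; rewrite ?pstart_cat ?parrows_cat.
Qed.

Variable k : fieldType.

Lemma arrU_mul a b : tgt a = src b -> arrU k a * arrU k b = pathU k (path2 a b).
Proof. by move=> ab; rewrite /arrU [LHS]pathU_mul pprodE. Qed.

Variable S : qpath Q -> Prop.
Hypothesis S2 : forall p, S p -> plength p = 2%N.
Variable I : ideal (pathalg k Q).
Hypothesis IS : forall x, I x <->
  ideal_gen (fun y : pathalg k Q => exists2 p, S p & y = pathU k p) x.

Lemma quad_arrows a b : tgt a = src b -> I (arrU k a * arrU k b) <-> S (path2 a b).
Proof.
move=> ab; rewrite arrU_mul // (quad_pathU IS); split=> [|Sab]; last exact: has_sub_gen.
move=> [p1 [s [p2 [Ss e1 e2 e]]]].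
have := congr1 (@plength Q) e.
have ep : pend p1 = pstart (pcat s p2) by rewrite pstart_cat.
rewrite !plength_cat // (S2 Ss) => /eqP.
rewrite addnCA -[X in X == _]addn0 eqn_add2l eq_sym addn_eq0 => /andP[/eqP p10 /eqP p20].
move: e; rewrite (trivial_pathP p10) (trivial_pathP p20).
have -> : pstart p1 = pstart s by rewrite -e1 (trivial_pathP p10).
by rewrite -e2 pcat_trivr pcat_trivl => ->.
Qed.

End QuadraticArrows.

Section PathSplit.
Variables (k : fieldType) (Q : quiver) (I : ideal (pathalg k Q)).

Lemma path_rel_in p a b s : parrows p = [:: a, b & s] ->
  I (arrU k a * arrU k b) -> I (pathU k p).
Proof.
move=> /path_cons[q [qa qs pa ->]] Iab; have [r [rb rs qb eq]] := path_cons qs.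
have ab : tgt a = src b by rewrite -qa qb.
have ar : pend (arrow_path a) = pstart (arrow_path b) by [].
rewrite eq pcatA // -(pprodE k); last by rewrite pend_cat.
rewrite -pathU_mul -(pprodE k) // -pathU_mul.
exact: (@idealMr (pathalg k Q)).
Qed.

Lemma path_tail_in p q a : p = pcat (arrow_path a) q -> pstart q = tgt a ->
  I (pathU k q) -> I (pathU k p).
Proof.
move=> -> qa Iq; rewrite -(pprodE k) // -pathU_mul.
exact: (@idealMl (pathalg k Q)).
Qed.

End PathSplit.

(** * The tiling algebra is gentle *)

Section TilingAlgebraGentle.
Variables (k : fieldType) (m : nat) (T : {set 'I_m * 'I_m}).
Hypothesis Ttil : is_tiling T.
Local Notation Q := (tiling_quiver T).
Local Notation D := (tdiag T).
Local Notation I := (tiling_ideal T k).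
Local Notation nx := (nxt (@arc m T) [set: D]).
Implicit Types a b : arr Q.

Let AT := arcs_tiling Ttil.
Let inT (d : D) : d \in [set: D] := in_setT d.

Lemma arr_eq a b : src a = src b -> tgt a = tgt b -> a = b.
Proof.
move=> e1 e2; apply: val_inj; rewrite [val a]surjective_pairing [val b]surjective_pairing.
by congr pair.
Qed.

Lemma arr_nxt a : exists x, nx x (src a) (tgt a).
Proof. exact/(tarrowP Ttil)/(valP a). Qed.

Lemma tiling_relationP a b x y : tgt a = src b -> nx x (src a) (tgt a) ->
  nx y (src b) (tgt b) -> tiling_relation a b <-> x <> y.
Proof.
move=> ab xa yb; rewrite -ab in yb.
split=> [[_ h]|/(tarrow_nxt Ttil xa yb)]; first by apply/(tarrow_nxt Ttil xa yb).
by split.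
Qed.

Definition tiling_rel_path (p : qpath Q) : Prop :=
  exists a b, tiling_relation a b /\ p = path2 a b.

Lemma tiling_rel_length p : tiling_rel_path p -> plength p = 2%N.
Proof. by move=> [a [b [[ab _] ->]]]; rewrite /plength parrows_path2. Qed.

Lemma tiling_idealE x : I x <->
  ideal_gen (fun y : pathalg k Q => exists2 p, tiling_rel_path p & y = pathU k p) x.
Proof.
split=> Ix J SJ; apply: Ix => y.
  move=> [a [b [ab ->]]]; apply: SJ; exists (path2 a b); first by exists a, b.
  by rewrite arrU_mul //; case: ab.
move=> [p [a [b [ab ->]]] ->]; apply: SJ; exists a, b; split=> //.
by rewrite arrU_mul //; case: ab.
Qed.

Lemma tiling_arrows a b : tgt a = src b ->
  I (arrU k a * arrU k b) <-> tiling_relation a b.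
Proof.
move=> ab; rewrite (quad_arrows tiling_rel_length tiling_idealE ab).
split=> [[a' [b' [r e]]]|r]; last by exists a, b.
by have [ab' _] := r; have [-> ->] := path2_inj ab ab' e.
Qed.

Lemma other_pivot (d : D) x y z : inc (arc d) x -> inc (arc d) y -> inc (arc d) z ->
  x <> y -> x <> z -> y = z.
Proof.
move=> dx dy dz; have [->//|->] := inc_cases dx dy.
by have [->//|->] := inc_cases dx dz.
Qed.

Lemma card_le2 (U : finType) (A : {set U}) (f : U -> bool) :
  {in A &, injective f} -> (#|A| <= 2)%N.
Proof. by move=> fi; rewrite -(card_in_imset fi) -card_bool max_card. Qed.

(** Among the arrows leaving a given arc, or entering it, each is determined by its pivot. A nonzero
    composition with [a] keeps the pivot of [a] and a zero one takes the other endpoint, so each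
    condition leaves one candidate. *)
Lemma tiling_gentle : gentle_presentation I.
Proof.
have out_eq a b b' y y' : tgt a = src b -> tgt a = src b' -> nx y (src b) (tgt b) ->
    nx y' (src b') (tgt b') -> y = y' -> b = b'.
  move=> ab ab' yb yb' e; rewrite -e -ab' in yb'; rewrite -ab in yb.
  by apply: arr_eq; [rewrite -ab | apply: (nxt_succ_uniq AT) yb yb'].
have in_eq a c c' y y' : tgt c = src a -> tgt c' = src a -> nx y (src c) (tgt c) ->
    nx y' (src c') (tgt c') -> y = y' -> c = c'.
  move=> ca ca' yc yc' e; rewrite -e ca' in yc'; rewrite ca in yc.
  by apply: arr_eq; [apply: (nxt_pred_uniq AT) yc yc' | rewrite ca].
have nloop a : src a <> tgt a by have [x xa] := arr_nxt a; apply: nxt_neq xa.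
split.
- split=> // a b ab ba; have [x xa] := arr_nxt a; have [y yb] := arr_nxt b.
  rewrite -ab ba in yb; have [ax bx h _] := xa; have [bY ay h' _] := yb.
  have [xy|xy] := eqVneq x y.
    by move: h'; rewrite -xy /before (cyc_asym h).
  have ey : y = oth (arc (src a)) x by case: (inc_cases ax ay) xy => // ->; rewrite eqxx.
  have ey' : y = oth (arc (tgt a)) x by case: (inc_cases bx bY) xy => // ->; rewrite eqxx.
  by move: h; rewrite /before -ey -ey' cyc_irr.
- move=> v; split.
    (* The arrows at [v] are told apart by whether their pivot is the first endpoint of [v]. *)
    apply: (@card_le2 _ _ (fun a => `[< nx (arc v).1 (src a) (tgt a) >])) => a b.
    rewrite !inE => /eqP av /eqP bv.
    have [x xa] := arr_nxt a; have [y yb] := arr_nxt b.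
    move=> e; apply: arr_eq; first by rewrite av.
    rewrite av in xa e; rewrite bv in yb e.
    suff xy : x = y by rewrite xy in xa; apply: (nxt_succ_uniq AT (inT v)) xa yb.
    have [vx _ _ _] := xa; have [vy _ _ _] := yb.
    have iv1 : inc (arc v) (arc v).1 by rewrite /inc eqxx.
    have [e1|e1] := eqVneq (arc v).1 x.
      rewrite -e1; move: e; rewrite -e1 in xa; rewrite (asboolT xa) => /esym/asboolP h.
      exact: nxt_pivot h yb.
    have [e2|e2] := eqVneq (arc v).1 y.
      rewrite -e2; move: e; rewrite -e2 in yb; rewrite (asboolT yb) => /asboolP h.
      by apply/esym; apply: nxt_pivot h xa.
    exact: other_pivot iv1 vx vy (elimN eqP e1) (elimN eqP e2).
  apply: (@card_le2 _ _ (fun a => `[< nx (arc v).1 (src a) (tgt a) >])) => a b.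
  rewrite !inE => /eqP av /eqP bv.
  have [x xa] := arr_nxt a; have [y yb] := arr_nxt b.
  move=> e; apply: arr_eq; last by rewrite av.
  rewrite av in xa e; rewrite bv in yb e.
  suff xy : x = y by rewrite xy in xa; apply: (nxt_pred_uniq AT (inT v)) xa yb.
  have [_ vx _ _] := xa; have [_ vy _ _] := yb.
  have iv1 : inc (arc v) (arc v).1 by rewrite /inc eqxx.
  have [e1|e1] := eqVneq (arc v).1 x.
    rewrite -e1; move: e; rewrite -e1 in xa; rewrite (asboolT xa) => /esym/asboolP h.
    exact: nxt_pivot h yb.
  have [e2|e2] := eqVneq (arc v).1 y.
    rewrite -e2; move: e; rewrite -e2 in yb; rewrite (asboolT yb) => /asboolP h.
    by apply/esym; apply: nxt_pivot h xa.
  exact: other_pivot iv1 vx vy (elimN eqP e1) (elimN eqP e2).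
- move=> a; have [x xa] := arr_nxt a; split.
    move=> b b' ab ab'; have [y yb] := arr_nxt b; have [y' yb'] := arr_nxt b'.
    move=> nI nI'; apply: (out_eq a b b' y y') => //.
    have /contrapT <- : ~ x <> y.
      by move/(tiling_relationP ab xa yb)/(tiling_arrows ab).
    have /contrapT <- // : ~ x <> y'.
    by move/(tiling_relationP ab' xa yb')/(tiling_arrows ab').
  move=> c c' ca ca'; have [y yc] := arr_nxt c; have [y' yc'] := arr_nxt c'.
  move=> nI nI'; apply: (in_eq a c c' y y') => //.
  have /contrapT -> : ~ y <> x.
    by move/(tiling_relationP ca yc xa)/(tiling_arrows ca).
  have /contrapT -> // : ~ y' <> x.
  by move/(tiling_relationP ca' yc' xa)/(tiling_arrows ca').
- move=> a; have [x xa] := arr_nxt a; have [ax tx _ _] := xa; split.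
    move=> b b' ab ab'; have [y yb] := arr_nxt b; have [y' yb'] := arr_nxt b'.
    move=> /(tiling_arrows ab)/(tiling_relationP ab xa yb) xy.
    move=> /(tiling_arrows ab')/(tiling_relationP ab' xa yb') xy'.
    apply: (out_eq a b b' y y') => //.
    have [bY _ _ _] := yb; have [bY' _ _ _] := yb'; rewrite -ab in bY; rewrite -ab' in bY'.
    exact: other_pivot tx bY bY' xy xy'.
  move=> c c' ca ca'; have [y yc] := arr_nxt c; have [y' yc'] := arr_nxt c'.
  move=> /(tiling_arrows ca)/(tiling_relationP ca yc xa)/nesym xy.
  move=> /(tiling_arrows ca')/(tiling_relationP ca' yc' xa)/nesym xy'.
  apply: (in_eq a c c' y y') => //.
  have [_ cy _ _] := yc; have [_ cy' _ _] := yc'; rewrite ca in cy; rewrite ca' in cy'.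
  exact: other_pivot ax cy cy' xy xy'.
by exists tiling_rel_path; split; [exact: tiling_rel_length | exact: tiling_idealE].
Qed.

End TilingAlgebraGentle.

Lemma stepE (Q : quiver) (a : arr Q) :
  [/\ step_start (a, true) = src a, step_end (a, true) = tgt a,
      step_start (a, false) = tgt a & step_end (a, false) = src a].
Proof. by []. Qed.

Lemma uniq_map_inj (A B : eqType) (h : A -> B) (s : seq A) :
  uniq (map h s) -> {in s &, injective h}.
Proof.
elim: s => //= a s IHs /andP[as' us] x y; rewrite !inE.
case/orP=> [/eqP->|xs] /orP[/eqP->|ys] // e; last exact: IHs.
  by rewrite e map_f in as'.
by rewrite -e map_f in as'.
Qed.

Lemma walk_avoids (Q : quiver) (v : vert Q) (w : step Q) r :
  path (fun t u : step Q => step_end t == step_start u) w r ->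
  step_end (last w r) != v -> all (fun u : step Q => step_start u != v) (w :: r) ->
  all (fun u : step Q => (step_start u != v) && (step_end u != v)) (w :: r).
Proof.
elim: r w => [|z r IHr] w; first by rewrite /= !andbT => _ -> ->.
rewrite /path -/(path _ z r) => /andP[/eqP wz pr] le /andP[sw av].
have IH := IHr z pr le av; case/andP: av => zv _.
by apply/andP; split; [rewrite sw wz zv | exact: IH].
Qed.

(** * Cycles in the quiver of a tiling *)

Section TilingPaths.
Variables (k : fieldType) (m : nat) (T : {set 'I_m * 'I_m}).
Hypothesis Ttil : is_tiling T.
Local Notation Q := (tiling_quiver T).
Local Notation I := (tiling_ideal T k).
Local Notation nx := (nxt (@arc m T) [set: tdiag T]).
Implicit Types a b : arr Q.

Let AT := arcs_tiling Ttil.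
Let inT (d : tdiag T) : d \in [set: tdiag T] := in_setT d.

Definition adjacent (d e : tdiag T) : Prop := tarrow d e \/ tarrow e d.

Lemma adjacent_nested d e f : adjacent d e -> f <> d -> f <> e ->
  nested (arc d) (arc f) = nested (arc e) (arc f).
Proof.
have ta d' e' : tarrow d' e' -> f <> d' -> f <> e' ->
    nested (arc d') (arc f) = nested (arc e') (arc f).
  move=> de; have dne : d' <> e' by have /(tarrowP Ttil)[x /nxt_neq] := de.
  move: f; apply/(common_tileP Ttil dne).
  by case/andP: de => /existsP[P /and3P[tP sd se]] _; exists P.
by move=> [de|ed] fd fe; [apply: ta | apply/esym/ta].
Qed.

Lemma step_adjacent (s : step Q) : adjacent (step_start s) (step_end s).
Proof.
case: s => a [] /=; [left | right]; exact: (valP a).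
Qed.

(** Adjacent arcs are sides of a common tile, so no third arc separates them; a walk avoiding [v]
    therefore stays on one side of [v]. *)
Lemma walk_nested (v : vert Q) (s : step Q) (r : seq (step Q)) :
  all (fun t : step Q => (step_start t != v) && (step_end t != v)) (s :: r) ->
  path (fun t u : step Q => step_end t == step_start u) s r ->
  nested (arc (step_start s)) (arc v) = nested (arc (step_end (last s r))) (arc v).
Proof.
elim: r s => [|t r IHr] s /= /andP[/andP[/eqP sv /eqP ev]].
  by move=> _ _; apply: adjacent_nested (step_adjacent s) _ _; apply/nesym.
move=> al /andP[/eqP st pr].
by rewrite (adjacent_nested (step_adjacent s) (nesym sv) (nesym ev)) st IHr.
Qed.

(** With a common pivot, steps in the same direction put the neighbours on different sides of the
    middle arc, and steps in opposite directions make them equal. With distinct pivots, opposite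
    directions again give different sides. What remains is a turn with a change of pivot, which is a
    relation. *)
Lemma turn_in_tile (s t : step Q) : step_end s = step_start t ->
  step_start s <> step_end t ->
  nested (arc (step_start s)) (arc (step_end s)) =
    nested (arc (step_end t)) (arc (step_end s)) ->
  [/\ s.2 = t.2, s.2 -> tiling_relation s.1 t.1 & ~~ s.2 -> tiling_relation t.1 s.1].
Proof.
have lt d := arc_lt AT (inT d).
case: s t => a [] [b []].
all: have [sa ea sa' ea'] := stepE a; have [sb eb sb' eb'] := stepE b.
all: rewrite ?(sa, ea, sa', ea', sb, eb, sb', eb') => e ne.
all: have [x xa] := arr_nxt Ttil a; have [y yb] := arr_nxt Ttil b => ns.
- suff r : tiling_relation a b by [].
  apply: (tiling_relationP Ttil e xa yb).2 => xy; rewrite -xy -e in yb.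
  have [ax bx h _] := xa; have [_ cx h' _] := yb.
  have := nested_between (lt _) (lt _) (lt _) ax cx bx h h'.
  by rewrite ns; case: nested.
- rewrite -e in yb; have [xy|/eqP xy] := eqVneq x y.
    by case: ne; rewrite -xy in yb; apply: (nxt_pred_uniq AT (inT _)) xa yb.
  have [ax bx h _] := xa; have [cy bY h' _] := yb.
  have := nested_fork (lt _) (lt _) (lt _) ax bx bY cy xy.
  move: h h'; rewrite /before => -> ->.
  by rewrite ns => /(_ isT); case: nested.
- rewrite -e in yb; have [xy|/eqP xy] := eqVneq x y.
    by case: ne; rewrite -xy in yb; apply: (nxt_succ_uniq AT (inT _)) xa yb.
  have [bx ax h _] := xa; have [bY cy h' _] := yb.
  have := nested_fork (lt _) (lt _) (lt _) ax bx bY cy xy.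
  move: h h'; rewrite /before => -> ->; rewrite orbT.
  by rewrite ns => /(_ isT); case: nested.
suff r : tiling_relation b a by [].
apply: (tiling_relationP Ttil (esym e) yb xa).2 => xy; rewrite xy -e in yb.
have [bx ax h _] := xa; have [cx _ h' _] := yb.
have := nested_between (lt _) (lt _) (lt _) cx ax bx h' h.
by rewrite ns; case: nested.
Qed.

Lemma no_2cycle (s t : step Q) : step_end s = step_start t ->
  step_end t = step_start s -> s.1 <> t.1 -> False.
Proof.
case: s t => a [] [b []].
all: have [sa ea sa' ea'] := stepE a; have [sb eb sb' eb'] := stepE b.
all: rewrite ?(sa, ea, sa', ea', sb, eb, sb', eb') => st le ab.
- by have [[_ h] _ _ _ _] := tiling_gentle k Ttil; apply: (h a b).
- by apply: ab; apply: arr_eq.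
- by apply: ab; apply: arr_eq.
by have [[_ h] _ _ _ _] := tiling_gentle k Ttil; apply: (h a b).
Qed.

(** The rest of the cycle is a walk that avoids the vertex between [s] and [t], so the two
    neighbours lie on the same side of its arc. Length 2 is excluded by [no_2cycle]. *)
Lemma cycle_turn (c : seq (step Q)) s t r i : graph_cycle c -> rot i c = [:: s, t & r] ->
  step_end s = step_start t /\
  [/\ s.2 = t.2, s.2 -> tiling_relation s.1 t.1 & ~~ s.2 -> tiling_relation t.1 s.1].
Proof.
case/and4P => _ cc us ua ei.
move: cc us ua; rewrite -(rot_cycle i) -(rot_uniq i) -map_rot => + + ua.
rewrite ei => /=; rewrite rcons_path => /and3P[/eqP st ptr /eqP le].
move=> /and3P[+ + ur]; rewrite inE negb_or => /andP[/eqP ust sr] tr; split=> //.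
move: ua; rewrite -(rot_uniq i) -map_rot ei /= => /and3P[+ ua1 ua2].
rewrite inE negb_or => /andP[/eqP ab _].
case: r => [|w r] in ei ptr le sr tr ur ua1 ua2 *.
  by case: (no_2cycle st le ab).
move: ptr => /= /andP[/eqP tw pr].
apply: turn_in_tile => //.
  by move=> e; move: sr; rewrite e tw inE eqxx.
rewrite tw st.
have -> : step_start s = step_end (last w r) by rewrite le.
apply/esym/walk_nested => //.
apply: walk_avoids pr _ _; first by rewrite le; apply/eqP.
apply/allP => u uw; apply/eqP => e.
by move: tr; rewrite -e => /negP; apply; apply: map_f.
Qed.

Lemma tiling_cycles (c : seq (step Q)) : graph_cycle c -> oriented c /\ relation_full I c.
Proof.
move=> gc; have [cn cc us ua] := and4P gc.
have succ s : s \in c -> exists t r i, rot i c = [:: s, t & r] /\ t \in c.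
  move=> sc; have [i r e] := rot_to sc; case: r e => [|t r] e; last first.
    by exists t, r, i; split=> //; rewrite -(mem_rot i) e !inE eqxx orbT.
  move: cc; rewrite -(rot_cycle i) e /= andbT => /eqP.
  have [[nl _] _ _ _ _] := tiling_gentle k Ttil.
  by case: (s) => a [] h; case: (nl a).
have ori : forall s t : step Q, s \in c -> t \in c -> s.2 = t.2.
  move=> s t sc tc; have [i r e] := rot_to sc.
  have tsr : t \in s :: r by rewrite -e mem_rot.
  have gr : graph_cycle (s :: r).
    rewrite -e /graph_cycle -size_eq0 size_rot size_eq0 cn rot_cycle cc.
    by rewrite !map_rot !rot_uniq us ua.
  have pr : path (fun s t : step Q => s.2 == t.2) s r.
    apply/(pathP s) => j jr.
    have e2 : rot j (s :: r) =
        [:: nth s (s :: r) j, nth s r j & drop j.+2 (s :: r) ++ take j (s :: r)].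
      rewrite /rot (drop_nth s) /=; last by rewrite ltnW.
      by rewrite (drop_nth s jr).
    by have [_ [-> _ _]] := cycle_turn gr e2.
  have : all (fun u : step Q => s.2 == u.2) r.
    apply: order_path_min pr => x y z /eqP-> /eqP->; exact: eqxx.
  by move: tsr; rewrite inE => /orP[/eqP->//|tr] /allP/(_ _ tr)/eqP.
split.
  case: c cn cc us ua succ ori {gc} => // s c _ _ _ _ _ ori.
  apply/orP; case e: s.2; [left | right]; apply/allP => t tc.
    by rewrite -(ori s t) ?mem_head.
  by rewrite -(ori s t) ?mem_head ?e.
move=> a b /mapP[s sc ->] /mapP[t tc ->] st; apply: (tiling_arrows k st).2.
(* The vertices of the cycle are distinct, so arrows with a common vertex [tgt a = src b] belong to
   consecutive steps. *)
have inj (u u' : step Q) : u \in c -> u' \in c -> step_start u = step_start u' -> u = u'.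
  exact: (uniq_map_inj us).
case e: s.2; have e' := ori s t sc tc; rewrite e in e'.
  have [u [r [i [ei uc]]]] := succ _ sc; have [su [_ /(_ e) h _]] := cycle_turn gc ei.
  suff -> : t = u by [].
  by apply: inj => //; rewrite -su /step_start /step_end -e' e.
have [u [r [i [ei uc]]]] := succ _ tc; have [su [_ _ h]] := cycle_turn gc ei.
have -> : s = u by apply: inj => //; rewrite -su /step_start /step_end -e' e.
by apply: h; rewrite -e'.
Qed.

End TilingPaths.

(** * Transfer along an isomorphism *)

Section CycleCondition.
Variables (k : fieldType) (Q : quiver) (I : ideal (pathalg k Q)).
Hypothesis noloop : forall a : arr Q, src a <> tgt a.
Hypothesis cycI : forall c : seq (step Q), graph_cycle c -> oriented c /\ relation_full I c.

Lemma walk_src (v : vert Q) s : walk v s -> map (@src Q) s = belast v (map (@tgt Q) s).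
Proof. by elim: s v => //= a s IHs v /andP[/eqP -> /IHs ->]. Qed.

Definition forward (s : seq (arr Q)) : seq (step Q) := [seq (a, true) | a <- s].

Lemma forward_path x s :
  path (fun t u : step Q => step_end t == step_start u) x (forward s) = walk (step_end x) s.
Proof. by elim: s x => //= a s IHs x; rewrite eq_sym IHs. Qed.

Lemma forward_start s : map (@step_start Q) (forward s) = map (@src Q) s.
Proof. by rewrite -map_comp. Qed.

Lemma forward_fst s : map fst (forward s) = s.
Proof. by rewrite -map_comp map_id. Qed.

Definition pverts (p : qpath Q) : seq (vert Q) := pstart p :: map (@tgt Q) (parrows p).

(** A return to a vertex traces an oriented cycle. As it is relation-full, its first two arrows
    already compose to zero; the induction reduces to a return to the starting vertex whose
    remaining vertices are distinct. *)
Lemma pverts_in p : ~~ uniq (pverts p) -> I (pathU k p).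
Proof.
move: {2}(parrows p) (erefl (parrows p)) => s; elim: s p => [|a s IHs] p ep.
  by rewrite /pverts ep.
have [q [qa qs pa eq]] := path_cons ep.
have vp : pverts p = src a :: pverts q by rewrite /pverts ep pa qa qs.
rewrite vp cons_uniq negb_and negbK.
have [uq|nuq _] := boolP (uniq (pverts q)); last first.
  exact: path_tail_in eq qa (IHs q qs nuq).
rewrite orbF => ain.
have [b bs ab] : exists2 b, b \in s & src a = tgt b.
  apply/mapP; move: ain; rewrite /pverts qa qs inE => /orP[/eqP/noloop|] //.
case: (path.splitP bs) ep qs {IHs} => s1 s2 ep qs.
have wp : walk (src a) (a :: rcons s1 b ++ s2) by rewrite -ep -pa; exact: (valP p).
have w1 : walk (tgt a) (rcons s1 b).
  by move: wp; rewrite /= walk_cat => /and3P[_ ->].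
have us : uniq (map (@src Q) (a :: rcons s1 b)).
  rewrite map_cons (walk_src w1) ab map_rcons belast_rcons cons_uniq -rcons_uniq.
  move: uq; rewrite /pverts qa qs map_cat -cat_cons cat_uniq map_rcons rcons_cons.
  by case/and3P.
have gc : graph_cycle (forward (a :: rcons s1 b)).
  apply/and4P; split=> //; last first.
  - by rewrite forward_fst; apply: map_uniq us.
  - by rewrite forward_start.
  rewrite /= rcons_path forward_path [step_end _]/(tgt a) w1 /=.
  by rewrite /forward map_rcons last_rcons; apply/eqP.
have [_ rf] := cycI gc; rewrite /relation_full forward_fst in rf.
case: s1 {us gc wp} => [|b' s1] in ep w1 qs bs rf *.
  apply: (path_rel_in ep); apply: rf; rewrite ?inE ?eqxx ?orbT //.
  by move: w1 => /= /andP[/eqP].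
apply: (path_rel_in ep); apply: rf; rewrite ?inE ?eqxx ?orbT //.
by move: w1 => /= /andP[/eqP].
Qed.

(** If [p] repeated no vertex, then [p] followed by [a] backwards would be a cycle using both
    directions. *)
Lemma parallel_in (a : arr Q) (p : qpath Q) : pstart p = src a -> pend p = tgt a ->
  (2 <= plength p)%N -> I (pathU k p).
Proof.
move=> pa pb p2; apply: pverts_in; apply/negP => uv.
have wp : walk (pstart p) (parrows p) by exact: (valP p).
have st : map (@src Q) (parrows p) = belast (pstart p) (map (@tgt Q) (parrows p)).
  exact: walk_src.
pose c := rcons (forward (parrows p)) (a, false).
have us : uniq (rcons (map (@src Q) (parrows p)) (tgt a)).
  by rewrite st -pb -lastI.
have np : a \notin parrows p.
  apply/negP => ap; move: uv us p2 pa pb ap; rewrite /pverts /pend /plength.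
  case: (parrows p) wp => [|b [|b' s]] //= wp.
  move=> /and3P[_ tb _] /andP[sb _] _ pa pb; rewrite inE => /orP[/eqP ab|ab].
    by move: tb; rewrite -ab -pb mem_last.
  have bv : src b = src a by move: wp => /andP[/eqP -> _].
  by have h := map_f (@src Q) ab; move: sb; rewrite bv -rcons_cons mem_rcons in_cons h orbT.
have gc : graph_cycle c.
  apply/and4P; split.
  - by rewrite -size_eq0 size_rcons.
  - case e: (parrows p) wp p2 => [|b s] wp p2; first by rewrite /plength e in p2.
    have -> : c = (b, true) :: rcons (forward s) (a, false) by rewrite /c e.
    have /andP[/eqP bv ws] : (src b == pstart p) && walk (step_end (b, true)) s := wp.
    suff : path (fun t u : step Q => step_end t == step_start u) (b, true)
        (rcons (rcons (forward s) (a, false)) (b, true)) by [].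
    rewrite 2!rcons_path forward_path last_rcons ws andTb; apply/andP; split; apply/eqP.
      transitivity (pend p); last exact: pb.
      rewrite /pend e [RHS]/=.
      by elim: (s) (b) => //= z r IHr y; exact: IHr.
    by transitivity (pstart p).
  - by rewrite /c map_rcons forward_start.
  by rewrite /c map_rcons forward_fst rcons_uniq np (map_uniq (f := @src Q)) // st;
    move: uv; rewrite /pverts lastI rcons_uniq => /andP[].
have [/orP[] o _] := cycI gc.
  by move: o; rewrite /c all_rcons.
move: o p2; rewrite /c all_rcons /plength => /andP[_].
by case: (parrows p).
Qed.

(** Going along [a] and back along [b] is a cycle of length 2 that is not oriented. *)
Lemma no_parallel (a b : arr Q) : src a = src b -> tgt a = tgt b -> a = b.
Proof.
move=> sab tab; apply: contrapT => /eqP ab.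
have gc : graph_cycle [:: (a, true); (b, false)].
  apply/and4P; split=> //=.
  - by rewrite /step_end /step_start /= tab sab !eqxx.
  - rewrite inE andbT; apply/eqP => e; apply: (@noloop a); rewrite tab; exact: e.
  by rewrite inE andbT.
by have [o _] := cycI gc; move: o; rewrite /oriented.
Qed.

End CycleCondition.

Lemma kalg_inM (k : pzRingType) (A : kalgebra k) c d (x : A) :
  kalg_in A c * (kalg_in A d * x) = kalg_in A (c * d) * x.
Proof. by rewrite mulrA rmorphM. Qed.

Lemma kalg_in_eq0 (k : fieldType) (A : kalgebra k) c (x : A) :
  c != 0 -> kalg_in A c * x = 0 -> x = 0.
Proof.
by move=> c0 cx; rewrite -[x]mul1r -(rmorph1 (kalg_in A)) -(mulVf c0) -kalg_inM cx mulr0.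
Qed.

(** * The radical filtration under a morphism matching the vertices *)

Section HalfTransfer.
Variables (k : fieldType) (Q1 Q2 : quiver).
Variables (I1 : ideal (pathalg k Q1)) (I2 : ideal (pathalg k Q2)).
Hypothesis small1 : forall x, I1 x -> forall p, p \in msupp x -> (2 <= plength p)%N.
Hypothesis small2 : forall x, I2 x -> forall p, p \in msupp x -> (2 <= plength p)%N.
Variables (kappa : vert Q1 -> vert Q2) (Psi : {rmorphism quotalg I1 -> quotalg I2}).
Hypothesis kinj : injective kappa.
Hypothesis Psi_k : forall c, Psi (kalg_in (quotalg I1) c) = kalg_in (quotalg I2) c.
Hypothesis Psi_e : forall i, Psi (qe I1 i) = qe I2 (kappa i).
Hypothesis noloop1 : forall a : arr Q1, src a <> tgt a.

Lemma qa_corner (Q : quiver) (I : ideal (pathalg k Q)) a :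
  qe I (src a) * qa I a * qe I (tgt a) = qa I a.
Proof. by rewrite /qa qe_qp eqxx qp_qe eqxx. Qed.

Lemma coef_qa (Q : quiver) (I : ideal (pathalg k Q))
    (small : forall x, I x -> forall p, p \in msupp x -> (2 <= plength p)%N) a b :
  coef (arrow_path a) (qa I b) = (b == a)%:R.
Proof.
rewrite (coef_qp small) //; congr (_%:R); congr nat_of_bool; apply/eqP/eqP => [|->] //.
by move/(congr1 (@parrows Q)) => -[].
Qed.

Lemma Psi_qa a : Psi (qa I1 a) =
  qe I2 (kappa (src a)) * Psi (qa I1 a) * qe I2 (kappa (tgt a)).
Proof. by rewrite -!Psi_e -!(rmorphM Psi) qa_corner. Qed.

(** Without loops an arrow maps into a corner between distinct vertices, hence into [rad 1], and a
    path maps to a product of such elements. *)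
Lemma Psi_qp p : rad (plength p) (Psi (qp I1 p)).
Proof.
move: {2}(parrows p) (erefl (parrows p)) => s; elim: s p => [|a s IHs] p ep.
  by rewrite /plength ep; apply: rad_top.
have [q [qa' qs pa ->]] := path_cons ep.
have -> : qp I1 (pcat (arrow_path a) q) = qa I1 a * qp I1 q by rewrite qp_mul qa' eqxx.
rewrite rmorphM plength_cat //; apply: radM; last exact: IHs.
rewrite Psi_qa; apply: (rad1_corner small2) => /kinj; exact: noloop1.
Qed.

Lemma Psi_rad n x : rad n x -> rad n (Psi x).
Proof.
elim/rad_ind: x / => [|x y|c x|p np].
- by rewrite rmorph0; apply: rad0.
- by rewrite rmorphD; apply: radD.
- by rewrite rmorphM Psi_k; apply: radZ.
exact: rad_leq np (Psi_qp p).
Qed.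

Lemma no_arrow_rad2 (Q : quiver) (I : ideal (pathalg k Q)) i j x :
  (forall a : arr Q, src a = i -> tgt a = j -> False) ->
  rad 1 x -> rad 2 (qe I i * x * qe I j).
Proof.
move=> na; apply: corner_ind => [|y z|c y|p p1 pi pj]; [exact: rad0|exact: radD|exact: radZ|].
apply: rad_qp; rewrite ltn_neqAle p1 andbT; apply/eqP => /esym p1'.
case ep: (parrows p) => [|a [|b s]]; move: p1'; rewrite /plength ep //.
have [q [qa' qs pa e]] := path_cons ep => _.
apply: (na a); first by rewrite -pa.
by rewrite -pj /pend ep.
Qed.

End HalfTransfer.

Section Transfer.
Variables (k : fieldType) (Q1 Q2 : quiver).
Variables (I1 : ideal (pathalg k Q1)) (I2 : ideal (pathalg k Q2)).
Hypothesis small1 : forall x, I1 x -> forall p, p \in msupp x -> (2 <= plength p)%N.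
Hypothesis small2 : forall x, I2 x -> forall p, p \in msupp x -> (2 <= plength p)%N.
Variables (kappa : vert Q1 -> vert Q2) (kappa' : vert Q2 -> vert Q1).
Variables (Psi : {rmorphism quotalg I1 -> quotalg I2}).
Variables (Phi : {rmorphism quotalg I2 -> quotalg I1}).
Hypotheses (kK : cancel kappa kappa') (k'K : cancel kappa' kappa).
Hypothesis PhiK : cancel Phi Psi.
Hypothesis Psi_k : forall c, Psi (kalg_in (quotalg I1) c) = kalg_in (quotalg I2) c.
Hypothesis Phi_k : forall c, Phi (kalg_in (quotalg I2) c) = kalg_in (quotalg I1) c.
Hypothesis Psi_e : forall i, Psi (qe I1 i) = qe I2 (kappa i).
Hypothesis Phi_e : forall i, Phi (qe I2 i) = qe I1 (kappa' i).
Hypothesis noloop1 : forall a : arr Q1, src a <> tgt a.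

Let kinj := can_inj kK.
Let k'inj := can_inj k'K.
Let kin2 := kalg_in (quotalg I2).
Let kin1 := kalg_in (quotalg I1).

Lemma PsiZ c x : Psi (kin1 c * x) = kin2 c * Psi x.
Proof. by rewrite (rmorphM Psi); congr (_ * _); apply: Psi_k. Qed.

Lemma PhiZ c x : Phi (kin2 c * x) = kin1 c * Phi x.
Proof. by rewrite (rmorphM Phi); congr (_ * _); apply: Phi_k. Qed.

(** This precedes any use of [Psi_rad] for [Phi], which requires it. As [Q1] has no loops, a loop
    [b] maps to a multiple of a vertex idempotent plus an element of [rad 2]; mapping back
    contradicts the coefficient of [b]. *)
Lemma transfer_noloop (b : arr Q2) : src b <> tgt b.
Proof.
move=> bl; set i := kappa' (src b); pose y := Phi (qa I2 b).
have yi : qe I1 i * y * qe I1 i = y.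
  by rewrite /y /i -Phi_e -!(rmorphM Phi) {2}bl qa_corner.
pose c := chi small1 i y; pose r := qe I1 i * (y - kin1 c) * qe I1 i.
have rr : qe I1 i * r * qe I1 i = r.
  by rewrite /r !mulrA qe_idem -!mulrA qe_idem.
have r2 : rad 2 r.
  rewrite -rr; apply: no_arrow_rad2 (rad1_diag small1 i y) => a ai aj.
  by apply: (@noloop1 a); rewrite ai aj.
have : qa I2 b = kin2 c * qe I2 (src b) + Psi r.
  have -> : kin2 c * qe I2 (src b) = Psi (kin1 c * qe I1 i).
    by rewrite PsiZ Psi_e k'K.
  rewrite -rmorphD -[LHS]PhiK -/y; congr (Psi _).
  by rewrite /r mulrBr mulrBl yi kinC -mulrA qe_idem addrC subrK.
move/(congr1 (coef (arrow_path b))); rewrite (coefD small2) // (coefZ small2) //.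
rewrite (coef_qa small2) eqxx (coef_qp small2) //.
rewrite (@coef_rad _ _ _ small2 2) //; last first.
  exact: (Psi_rad small2 kinj Psi_k Psi_e noloop1).
have -> : (trivial_path (src b) == arrow_path b) = false.
  by apply/eqP => /(congr1 (@parrows Q2)).
by rewrite mulr0 addr0 => /eqP; rewrite oner_eq0.
Qed.

(** Otherwise the image of [b] would lie in [rad 2], and, mapping back, so would [b]. *)
Lemma transfer_arrow (b : arr Q2) :
  exists a : arr Q1, kappa (src a) = src b /\ kappa (tgt a) = tgt b.
Proof.
apply: contrapT => na.
have r2 : rad 2 (Phi (qa I2 b)).
  rewrite (Psi_qa Phi_e); apply: no_arrow_rad2; last first.
    apply: (Psi_rad small1 k'inj Phi_k Phi_e transfer_noloop).
    exact: rad_qp.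
  by move=> a a1 a2; apply: na; exists a; rewrite a1 a2 !k'K.
have := Psi_rad small2 kinj Psi_k Psi_e noloop1 r2; rewrite PhiK => h.
have := @coef_rad _ _ _ small2 2 (arrow_path b) _ isT isT h.
by rewrite (coef_qa small2) eqxx => /eqP; rewrite oner_eq0.
Qed.

Hypothesis cyc1 : forall c : seq (step Q1), graph_cycle c -> oriented c /\ relation_full I1 c.

(** The radical part of the corner from [src a] to [tgt a] is spanned by [a] alone: longer parallel
    paths vanish and parallel arrows coincide. *)
Lemma transfer_qa a b : kappa (src a) = src b -> kappa (tgt a) = tgt b ->
  exists2 c, c != 0 & Phi (qa I2 b) = kin1 c * qa I1 a.
Proof.
move=> sab tab.
have [c cE] : exists c, Phi (qa I2 b) = kin1 c * qa I1 a.
  rewrite (Psi_qa Phi_e) -sab -tab !kK.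
  have : rad 1 (Phi (qa I2 b)).
    apply: (Psi_rad small1 k'inj Phi_k Phi_e transfer_noloop); exact: rad_qp.
  apply: (@corner_ind _ _ _ 1 _ _ (fun x => exists c, x = kin1 c * qa I1 a))
    => [|x y [c ->] [d ->]|c x [d ->]|p p1 pi pj].
  - by exists 0; rewrite rmorph0 mul0r.
  - by exists (c + d); rewrite rmorphD mulrDl.
  - by exists (c * d); rewrite rmorphM mulrA.
  have [p2|p2] := leqP 2 (plength p).
    exists 0; rewrite rmorph0 mul0r; apply/qpi_eq0.
    exact: (parallel_in noloop1 cyc1 pi pj).
  exists 1; rewrite rmorph1 mul1r; congr (qp I1 _).
  case ep: (parrows p) p1 p2 => [|a' [|? ?]]; rewrite /plength ep // => _ _.
  have [q [qa' qs pa e]] := path_cons ep.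
  have aa : a' = a.
    apply: (no_parallel noloop1 cyc1); first by rewrite -pa.
    by rewrite -pj /pend ep.
  by apply: qpathP; rewrite ?pi // ep aa.
exists c => //; apply/eqP => c0.
have : qa I2 b = 0 by rewrite -[LHS]PhiK cE c0 rmorph0 mul0r rmorph0.
move/(congr1 (coef (arrow_path b))); rewrite (coef_qa small2) eqxx.
rewrite (@coef_rad _ _ _ small2 2) //; last exact: rad0.
by move/eqP; rewrite oner_eq0.
Qed.

Lemma transfer_no_parallel (b b' : arr Q2) : src b = src b' -> tgt b = tgt b' -> b = b'.
Proof.
move=> sb tb; have [a [sa ta]] := transfer_arrow b.
have [c c0 cE] := transfer_qa sa ta.
have [c' c0' cE'] : exists2 c', c' != 0 & Phi (qa I2 b') = kin1 c' * qa I1 a.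
  by apply: transfer_qa; rewrite ?sa ?ta.
have : kin2 c' * qa I2 b = kin2 c * qa I2 b'.
  apply: (can_inj PhiK); rewrite (PhiZ c' (qa I2 b)) (PhiZ c (qa I2 b')) cE cE'.
  transitivity (kin1 (c' * c) * qa I1 a); first exact: kalg_inM.
  by rewrite (mulrC c' c); apply/esym/kalg_inM.
move/(congr1 (coef (arrow_path b))); rewrite !(coefZ small2) // !(coef_qa small2) eqxx.
rewrite mulr1; case: eqP => [->//|_]; rewrite mulr0 => e.
by rewrite e eqxx in c0'.
Qed.

Lemma qpi_arrows (Q : quiver) (I : ideal (pathalg k Q)) (a b : arr Q) :
  qa I a * qa I b = 0 <-> I (arrU k a * arrU k b).
Proof. by rewrite -qpi_eq0 qpiM. Qed.

Lemma transfer_relation a1 a2 b1 b2 :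
  kappa (src a1) = src b1 -> kappa (tgt a1) = tgt b1 ->
  kappa (src a2) = src b2 -> kappa (tgt a2) = tgt b2 ->
  I1 (arrU k a1 * arrU k a2) <-> I2 (arrU k b1 * arrU k b2).
Proof.
move=> s1 t1 s2 t2; have [c c0 cE] := transfer_qa s1 t1; have [d d0 dE] := transfer_qa s2 t2.
have e : Phi (qa I2 b1 * qa I2 b2) = kin1 (c * d) * (qa I1 a1 * qa I1 a2).
  rewrite (rmorphM Phi) cE dE -mulrA (kinCA d (qa I1 a1) (qa I1 a2)).
  exact: kalg_inM.
rewrite -!qpi_arrows; split=> h.
  apply: (can_inj PhiK); rewrite (rmorph0 Phi).
  exact: etrans e (etrans (congr1 _ h) (mulr0 _)).
apply: (@kalg_in_eq0 _ (quotalg I1) (c * d)); first by rewrite mulf_neq0.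
exact: etrans (esym e) (etrans (congr1 Phi h) (rmorph0 Phi)).
Qed.

(** The choice of corresponding arrows is injective because [Q2] has no parallel arrows either; it
    carries cycles to cycles with the same directions. *)
Lemma transfer_cycles (c : seq (step Q2)) : graph_cycle c ->
  oriented c /\ relation_full I2 c.
Proof.
have [tau tauP] := boolp.choice transfer_arrow.
have taus b : kappa (src (tau b)) = src b by have [] := tauP b.
have taut b : kappa (tgt (tau b)) = tgt b by have [] := tauP b.
have tauI : injective tau.
  by move=> b b' e; apply: transfer_no_parallel; rewrite -?taus -?taut e.
pose g (s : step Q2) : step Q1 := (tau s.1, s.2).
have gs s : kappa (step_start (g s)) = step_start s.
  by case: s => b [] /=; rewrite /step_start /= ?taus ?taut.
have ge s : kappa (step_end (g s)) = step_end s.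
  by case: s => b [] /=; rewrite /step_end /= ?taus ?taut.
case/and4P=> cn cc us ua.
have gc : graph_cycle (map g c).
  apply/and4P; split.
  - by rewrite -size_eq0 size_map size_eq0.
  - rewrite cycle_map; apply: sub_cycle cc => s t /= /eqP st.
    by apply/eqP/kinj; rewrite ge gs.
  - rewrite -(map_inj_uniq kinj) -!map_comp.
    by rewrite (eq_map (g := @step_start Q2)) // => s; exact: gs.
  rewrite -map_comp (eq_map (g := tau \o fst)) // map_comp.
  by rewrite (map_inj_uniq tauI).
have [o rf] := cyc1 gc; split.
  by move: o; rewrite /oriented !all_map.
move=> a b /mapP[s sc ->] /mapP[t tc ->] st.
apply/(transfer_relation (taus _) (taut _) (taus _) (taut _)).
apply: rf; rewrite -?map_comp.
- by apply/mapP; exists s.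
- by apply/mapP; exists t.
by apply: kinj; rewrite taut taus.
Qed.

End Transfer.

(** * Morphisms of algebras induced by maps of quivers *)

Section QuiverMorphism.
Variables (k : fieldType) (Q1 Q2 : quiver).
Variables (kappa : vert Q1 -> vert Q2) (tau : arr Q1 -> arr Q2).
Hypothesis kbij : bijective kappa.
Hypothesis taus : forall a, src (tau a) = kappa (src a).
Hypothesis taut : forall a, tgt (tau a) = kappa (tgt a).

Let kinj := bij_inj kbij.

Lemma walk_map v s : walk v s -> walk (kappa v) (map tau s).
Proof. by elim: s v => //= a s IHs v /andP[/eqP <- /IHs]; rewrite taus taut eqxx. Qed.

Definition path_map (p : qpath Q1) : qpath Q2 :=
  exist _ (kappa (pstart p), map tau (parrows p)) (walk_map (valP p)).

Lemma pstart_map p : pstart (path_map p) = kappa (pstart p).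
Proof. by []. Qed.

Lemma parrows_map p : parrows (path_map p) = map tau (parrows p).
Proof. by []. Qed.

Lemma pend_map p : pend (path_map p) = kappa (pend p).
Proof.
have e : map (@tgt Q2) (parrows (path_map p)) = map kappa (map (@tgt Q1) (parrows p)).
  by rewrite -!map_comp; apply: eq_map => a; exact: taut.
by rewrite /pend e; exact: last_map.
Qed.

Lemma path_map_cat p q : pend p = pstart q ->
  path_map (pcat p q) = pcat (path_map p) (path_map q).
Proof.
move=> pq; have pq' : pend (path_map p) = pstart (path_map q) by rewrite pend_map pq.
apply: qpathP; first by rewrite pstart_cat // !pstart_map pstart_cat.
by rewrite parrows_cat // !parrows_map parrows_cat // map_cat.
Qed.

Lemma path_map_trivial v : path_map (trivial_path v) = trivial_path (kappa v).
Proof. exact: qpathP. Qed.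

Lemma path_map_path2 a b : tgt a = src b -> path_map (path2 a b) = path2 (tau a) (tau b).
Proof.
have e c : path_map (arrow_path c) = arrow_path (tau c).
  by apply: qpathP => //; apply: esym (taus c).
by move=> ab; rewrite path_map_cat // !e.
Qed.

Definition palg_map (f : palg k Q1) : palg k Q2 :=
  \sum_(p <- msupp f) f@_p *: pathU k (path_map p).

Lemma palg_mapw (d : {fset qpath Q1}) (f : palg k Q1) : (msupp f `<=` d)%fset ->
  palg_map f = \sum_(p <- d) f@_p *: pathU k (path_map p).
Proof.
move=> fd; apply: big_fset_incl => // p _ /mcoeff_outdom ->.
by rewrite scale0r.
Qed.

Lemma palg_mapD f g : palg_map (f + g) = palg_map f + palg_map g.
Proof.
rewrite (palg_mapw (msuppD_le f g)) (palg_mapw (fsubsetUl (msupp f) (msupp g))).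
rewrite (palg_mapw (fsubsetUr (msupp f) (msupp g))) -big_split /=.
by apply: eq_bigr => p _; rewrite mcoeffD scalerDl.
Qed.

Lemma palg_mapZ c f : palg_map (c *: f) = c *: palg_map f.
Proof.
rewrite (palg_mapw (msuppZ_le c f)) scaler_sumr.
by apply: eq_bigr => p _; rewrite mcoeffZ scalerA.
Qed.

Lemma palg_mapU p : palg_map (pathU k p) = pathU k (path_map p).
Proof.
rewrite (@palg_mapw [fset p]%fset); last by rewrite pathU.unlock msuppU_le.
by rewrite big_seq_fset1 pathU_coef eqxx scale1r.
Qed.

Lemma palg_map0 : palg_map 0 = 0.
Proof. by rewrite /palg_map msupp0 big_seq_fset0. Qed.

Lemma palg_map_sum (J : Type) (s : seq J) (F : J -> palg k Q1) :
  palg_map (\sum_(i <- s) F i) = \sum_(i <- s) palg_map (F i).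
Proof. exact: (big_morph palg_map palg_mapD palg_map0). Qed.

Lemma palg_map1 : palg_map 1 = 1.
Proof.
rewrite [1]/(palg_one k Q1) [RHS]/(palg_one k Q2) palg_map_sum.
rewrite [RHS](reindex kappa) /=; last exact: onW_bij.
by apply: eq_bigr => v _; rewrite palg_mapU path_map_trivial.
Qed.

Lemma palg_mapM f g : palg_map (f * g) = palg_map f * palg_map g.
Proof.
elim/palg_ind: f => [|f1 f2 e1 e2|c f e|p].
- by rewrite mul0r palg_map0 mul0r.
- by rewrite mulrDl !palg_mapD e1 e2 mulrDl.
- by rewrite [in LHS]palgZl [LHS]palg_mapZ (palg_mapZ c f) [RHS]palgZl e.
elim/palg_ind: g => [|f1 f2 e1 e2|c f e|q].
- by rewrite mulr0 palg_map0 mulr0.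
- by rewrite mulrDr !palg_mapD e1 e2 mulrDr.
- by rewrite [in LHS]palgZr [LHS]palg_mapZ (palg_mapZ c f) [RHS]palgZr e.
rewrite pathU_mul !palg_mapU pathU_mul /pprod pend_map (inj_eq kinj).
by case: eqP => [pq|_]; rewrite ?palg_map0 // palg_mapU path_map_cat.
Qed.

Variables (I1 : ideal (pathalg k Q1)) (I2 : ideal (pathalg k Q2)).
Variable S : qpath Q1 -> Prop.
Hypothesis I1S : forall x, I1 x <->
  ideal_gen (fun y : pathalg k Q1 => exists2 p, S p & y = pathU k p) x.
Hypothesis S_in : forall p, S p -> I2 (pathU k (path_map p)).

Fact preim_ideal0 : I2 (palg_map 0). Proof. by rewrite palg_map0; apply: ideal0. Qed.
Fact preim_idealD f g : I2 (palg_map f) -> I2 (palg_map g) -> I2 (palg_map (f + g)).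
Proof. by rewrite palg_mapD; apply: idealD. Qed.
Fact preim_idealMl f g : I2 (palg_map g) -> I2 (palg_map (f * g)).
Proof. by rewrite palg_mapM; apply: (@idealMl (pathalg k Q2)). Qed.
Fact preim_idealMr f g : I2 (palg_map g) -> I2 (palg_map (g * f)).
Proof. by rewrite palg_mapM; apply: (@idealMr (pathalg k Q2)). Qed.

Definition preim_ideal : ideal (pathalg k Q1) :=
  @Ideal (pathalg k Q1) (fun f => I2 (palg_map f))
    preim_ideal0 preim_idealD preim_idealMl preim_idealMr.

Lemma palg_map_ideal f : I1 f -> I2 (palg_map f).
Proof.
move=> /I1S/(_ preim_ideal); apply => y [p Sp ->].
by rewrite /= palg_mapU; apply: S_in.
Qed.

Definition quot_map (u : quotalg I1) : quotalg I2 := qpi I2 (palg_map (repr (u : quotring I1))).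

Lemma palg_mapB f g : palg_map (f - g) = palg_map f - palg_map g.
Proof. by rewrite palg_mapD -scaleN1r palg_mapZ scaleN1r. Qed.

Lemma quot_map_pi f : quot_map (qpi I1 f) = qpi I2 (palg_map f).
Proof.
apply/qpi_eq; rewrite -palg_mapB; apply: palg_map_ideal.
exact: quot_repr.
Qed.

Fact quot_map_zmod : zmod_morphism quot_map.
Proof.
elim/quot_ind=> f; elim/quot_ind=> g.
have -> : quot_pi I1 f - quot_pi I1 g = qpi I1 (f - g) :> quotalg I1.
  by apply/esym/(rmorphB (quot_pi I1)).
rewrite -[quot_pi I1 f]/(qpi I1 f) -[quot_pi I1 g]/(qpi I1 g) !quot_map_pi palg_mapB.
exact: (rmorphB (quot_pi I2)).
Qed.

Fact quot_map_monoid : monoid_morphism quot_map.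
Proof.
split; first by rewrite -(qpi1 I1) quot_map_pi palg_map1 qpi1.
elim/quot_ind=> f; elim/quot_ind=> g.
rewrite -[quot_pi I1 f]/(qpi I1 f) -[quot_pi I1 g]/(qpi I1 g) -qpiM !quot_map_pi.
by rewrite palg_mapM qpiM.
Qed.

Lemma quiver_hom : exists Psi : {rmorphism quotalg I1 -> quotalg I2},
  (forall c, Psi (kalg_in (quotalg I1) c) = kalg_in (quotalg I2) c) /\
  (forall p, Psi (qp I1 p) = qp I2 (path_map p)).
Proof.
pose Psi : {rmorphism quotalg I1 -> quotalg I2} := HB.pack quot_map
  (GRing.isZmodMorphism.Build _ _ quot_map quot_map_zmod)
  (GRing.isMonoidMorphism.Build _ _ quot_map quot_map_monoid).
exists Psi; split=> [c|p]; last by rewrite [LHS]quot_map_pi palg_mapU.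
transitivity (quot_map (qpi I1 (palg_const Q1 c))) => //.
by rewrite quot_map_pi /palg_const palg_mapZ [palg_map _]palg_map1.
Qed.

End QuiverMorphism.

(** A quadratic monomial ideal is determined by the zero compositions of two arrows, so preserving
    these makes both maps of path algebras descend to the quotients. *)
Lemma quiver_iso (k : fieldType) (Q1 Q2 : quiver)
    (I1 : ideal (pathalg k Q1)) (I2 : ideal (pathalg k Q2)) S1 S2
    (kappa : vert Q1 -> vert Q2) (tau : arr Q1 -> arr Q2) :
  bijective kappa -> bijective tau ->
  (forall a, src (tau a) = kappa (src a)) -> (forall a, tgt (tau a) = kappa (tgt a)) ->
  (forall p, S1 p -> plength p = 2%N) -> (forall p, S2 p -> plength p = 2%N) ->
  (forall x, I1 x <->
    ideal_gen (fun y : pathalg k Q1 => exists2 p, S1 p & y = pathU k p) x) ->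
  (forall x, I2 x <->
    ideal_gen (fun y : pathalg k Q2 => exists2 p, S2 p & y = pathU k p) x) ->
  (forall a b, tgt a = src b ->
    I1 (arrU k a * arrU k b) <-> I2 (arrU k (tau a) * arrU k (tau b))) ->
  alg_isomorphic (quotalg I1) (quotalg I2).
Proof.
move=> kb tb ts tt S12 S22 I1S I2S rel.
have kb' := kb; have tb' := tb; case: kb' tb' => kappa' kK k'K [tau' tK t'K].
have ts' a : src (tau' a) = kappa' (src a) by rewrite -{2}[a]t'K ts kK.
have tt' a : tgt (tau' a) = kappa' (tgt a) by rewrite -{2}[a]t'K tt kK.
have kb' : bijective kappa' by exists kappa.
have h1 p : S1 p -> I2 (pathU k (path_map ts tt p)).
  move=> Sp; have [a [b [ab ep]]] := path2P (S12 p Sp).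
  have tab : tgt (tau a) = src (tau b) by rewrite tt ts ab.
  have -> : path_map ts tt p = path2 (tau a) (tau b).
    by rewrite ep path_map_path2.
  rewrite -arrU_mul //; apply/rel => //.
  by apply/(quad_arrows S12 I1S ab); rewrite -ep.
have h2 p : S2 p -> I1 (pathU k (path_map ts' tt' p)).
  move=> Sp; have [a [b [ab ep]]] := path2P (S22 p Sp).
  have tab : tgt (tau' a) = src (tau' b) by rewrite tt' ts' ab.
  have -> : path_map ts' tt' p = path2 (tau' a) (tau' b).
    by rewrite ep path_map_path2.
  rewrite -arrU_mul //; apply/rel => //.
  by rewrite !t'K; apply/(quad_arrows S22 I2S ab); rewrite -ep.
have [Psi [Pk Pp]] := quiver_hom kb I1S h1.
have [Phi [Fk Fp]] := quiver_hom kb' I2S h2.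
have pmK p : path_map ts' tt' (path_map ts tt p) = p.
  by apply: qpathP; [exact: kK | exact: (mapK tK)].
have pmK' p : path_map ts tt (path_map ts' tt' p) = p.
  by apply: qpathP; [exact: k'K | exact: (mapK t'K)].
exists Psi; split=> //; exists Phi => x.
  elim/rad_ind: x / (rad_top x) => [|x y ex ey|c x ex|p _].
  - by rewrite !rmorph0.
  - by rewrite !rmorphD ex ey.
  - by rewrite (rmorphM Psi) Pk (rmorphM Phi) Fk ex.
  by rewrite Pp Fp pmK.
elim/rad_ind: x / (rad_top x) => [|x y ex ey|c x ex|p _].
- by rewrite !rmorph0.
- by rewrite !rmorphD ex ey.
- by rewrite (rmorphM Phi) Fk (rmorphM Psi) Pk ex.
by rewrite Fp Pp pmK'.
Qed.

Section Connected.
Variables (k : fieldType) (Q : quiver) (I : ideal (pathalg k Q)).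
Hypothesis small : forall x, I x -> forall p, p \in msupp x -> (2 <= plength p)%N.
Hypothesis conI : alg_connected (quotalg I).

Definition linked : rel (vert Q) := fun u v =>
  [exists a, (src a == u) && (tgt a == v)] || [exists a, (src a == v) && (tgt a == u)].

Lemma linked_arrow a : linked (src a) (tgt a).
Proof. by apply/orP; left; apply/existsP; exists a; rewrite !eqxx. Qed.

(** The sum of the vertex idempotents over a component is a central idempotent. The character at [u]
    shows that it is not 0, so it is 1, and the character at [v] puts [v] in the component. *)
Lemma quiver_connected u v : connect linked u v.
Proof.
pose C := connect linked u; pose e := \sum_(w | C w) qe I w.
have csym : connect_sym linked.
  by apply: sym_connect_sym => x y; rewrite /linked orbC.
have ep p : e * qp I p = if C (pstart p) then qp I p else 0.
  rewrite /e mulr_suml; case: ifP => [Cp|/negbT Cp].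
    rewrite (bigD1 (pstart p)) //= qe_qp eqxx big1 ?addr0 // => w /andP[_ wp].
    by rewrite qe_qp (negPf wp).
  rewrite big1 // => w Cw; rewrite qe_qp; case: eqP => // wp.
  by rewrite -wp Cw in Cp.
have pe p : qp I p * e = if C (pend p) then qp I p else 0.
  rewrite /e mulr_sumr; case: ifP => [Cp|/negbT Cp].
    rewrite (bigD1 (pend p)) //= qp_qe eqxx big1 ?addr0 // => w /andP[_ wp].
    by rewrite qp_qe eq_sym (negPf wp).
  rewrite big1 // => w Cw; rewrite qp_qe; case: eqP => // wp.
  by rewrite wp Cw in Cp.
have Cpath p : C (pstart p) = C (pend p).
  have : walk (pstart p) (parrows p) by exact: (valP p).
  rewrite /pend; elim: (parrows p) (pstart p) => //= a s IHs w /andP[/eqP <- /IHs <-].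
  have aa := connect1 (linked_arrow a).
  by apply/idP/idP => h; [apply: connect_trans h aa | apply: connect_trans h _; rewrite csym].
have central x : e * x = x * e.
  elim/rad_ind: x / (rad_top x) => [|x y ex ey|c x ex|p _].
  - by rewrite mulr0 mul0r.
  - by rewrite mulrDl mulrDr ex ey.
  - by rewrite kinCA -mulrA ex.
  by rewrite ep pe Cpath.
have idem : e * e = e.
  rewrite {2}/e mulr_sumr; apply: eq_bigr => w Cw.
  by rewrite -[qe I w]/(qp I (trivial_path w)) ep Cw.
have chiC w : chi small w e = (C w)%:R.
  have -> : chi small w e = \sum_(w' | C w') (w == w')%:R.
    by rewrite /e rmorph_sum; apply: eq_bigr => w' _; exact: chi_qe.
  case: (boolP (C w)) => Cw.
    rewrite (bigD1 w) //= eqxx big1 ?addr0 // => w' /andP[_ ww].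
    by rewrite eq_sym (negPf ww).
  by rewrite big1 // => w' Cw'; case: eqP => // ww; rewrite ww Cw' in Cw.
have [_ /(_ e idem central)[e0|e1]] := conI.
  have := chiC u; rewrite e0 rmorph0 /C connect0 => /eqP.
  by rewrite eq_sym oner_eq0.
have := chiC v; rewrite e1 rmorph1 /C; case: (connect linked u v) => // /eqP.
by rewrite oner_eq0.
Qed.

End Connected.

Lemma alg_connected_iso (k : pzRingType) (A B : kalgebra k) :
  alg_isomorphic A B -> alg_connected A -> alg_connected B.
Proof.
move=> [f [[g fK gK] _]] [A1 Ae].
split=> [B1|e ee ce]; first by apply: A1; apply: (can_inj fK); rewrite rmorph1 rmorph0.
have fg x : f (g x) = x by exact: gK.
case: (Ae (g e)).
- by apply: (can_inj fK); rewrite rmorphM !fg.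
- by move=> x; apply: (can_inj fK); rewrite !rmorphM !fg.
- by move/(congr1 f); rewrite fg rmorph0; left.
by move/(congr1 f); rewrite fg rmorph1; right.
Qed.

(** * Gentle algebras come from tilings *)

Section GentleQuiver.
Variables (k : fieldType) (Q : quiver) (I : ideal (pathalg k Q)).
Hypothesis gp : gentle_presentation I.
Hypothesis cycI : forall c : seq (step Q), graph_cycle c -> oriented c /\ relation_full I c.
Local Notation V := (vert Q).
Implicit Types (a b : arr Q) (u v w : V).

Let noloop : forall a, src a <> tgt a.
Proof. by have [[h _] _ _ _ _] := gp. Qed.

Let no2 : forall a b, tgt a = src b -> tgt b <> src a.
Proof. by have [[_ h] _ _ _ _] := gp. Qed.

Let noparallel a b : src a = src b -> tgt a = tgt b -> a = b.
Proof. exact: no_parallel noloop cycI a b. Qed.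

Definition arrow_rel : rel V := fun u v => [exists a, (src a == u) && (tgt a == v)].

(** A triple of vertices suffices to record a composition because there are no parallel arrows. *)
Definition zero_rel u v w : bool := `[< exists a b,
  [/\ src a = u, tgt a = v, src b = v, tgt b = w & I (arrU k a * arrU k b)] >].

Lemma arrow_relP u v : reflect (exists a, src a = u /\ tgt a = v) (arrow_rel u v).
Proof.
apply: (iffP existsP) => [[a /andP[/eqP au /eqP av]]|[a [au av]]]; exists a => //.
by rewrite au av !eqxx.
Qed.

Lemma zero_relP a b : tgt a = src b ->
  reflect (I (arrU k a * arrU k b)) (zero_rel (src a) (tgt a) (tgt b)).
Proof.
move=> ab; apply: (iffP (asboolP _)) => [[a' [b' [sa ta sb tb]]]|Iab]; last by exists a, b.
by rewrite (noparallel sa ta) (@noparallel b' b) // sb ab.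
Qed.

Lemma pigeon2 (A : {set arr Q}) a b c : (#|A| <= 2)%N -> a \in A -> b \in A -> c \in A ->
  [\/ a = b, a = c | b = c].
Proof.
move=> A2 aA bA cA; apply: contrapT => h.
have ab : a != b by apply/eqP => e; apply: h; constructor 1.
have ac : a != c by apply/eqP => e; apply: h; constructor 2.
have bc : b != c by apply/eqP => e; apply: h; constructor 3.
suff : (2 < #|A|)%N by rewrite ltnNge A2.
have -> : 3%N = #|[set a; b; c]|.
  by rewrite setUC cardsU1 cards2 !inE negb_or ![c == _]eq_sym ac bc ab.
by apply: subset_leq_card; apply/subsetP => x; rewrite !inE -orbA => /or3P[] /eqP->.
Qed.

Lemma gentle_arrow_rel : gentle_rel arrow_rel zero_rel.
Proof.
have [_ deg nonrel rel _] := gp; split.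
- by move=> u; apply/arrow_relP => -[a [au ua]]; apply: (@noloop a); rewrite au ua.
- move=> u v /arrow_relP[a [au av]]; apply/arrow_relP => -[b [bv bu]].
  by apply: (@no2 a b); rewrite ?av ?bv ?bu ?au.
- move=> u a b c /arrow_relP[x [xu <-]] /arrow_relP[y [yu <-]] /arrow_relP[z [zu <-]].
  have [] := @pigeon2 _ x y z (deg u).1; rewrite ?inE ?xu ?yu ?zu // => ->.
  + by constructor 1.
  + by constructor 2.
  by constructor 3.
- move=> u a b c /arrow_relP[x [<- xu]] /arrow_relP[y [<- yu]] /arrow_relP[z [<- zu]].
  have [] := @pigeon2 _ x y z (deg u).2; rewrite ?inE ?xu ?yu ?zu // => ->.
  + by constructor 1.
  + by constructor 2.
  by constructor 3.
- move=> u v w w' /arrow_relP[a [<- <-]] /arrow_relP[b [bv <-]] /arrow_relP[c [cv <-]].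
  case: (zero_relP (esym bv)) => Ib; case: (zero_relP (esym cv)) => Ic // _.
    by rewrite ((rel a).1 b c).
  by rewrite ((nonrel a).1 b c).
move=> u u' v w /arrow_relP[a [<- av]] /arrow_relP[b [<- bv]] /arrow_relP[c [cv <-]].
rewrite -{1}av -bv; have ca : tgt a = src c by rewrite av.
have cb : tgt b = src c by rewrite bv.
case: (zero_relP ca) => Ia; case: (zero_relP cb) => Ib // _.
  by rewrite ((rel c).2 a b).
by rewrite ((nonrel c).2 a b).
Qed.

Lemma linked_rel u v : linked u v = arrow_rel u v || arrow_rel v u.
Proof. by []. Qed.

Definition step_between u v (s : step Q) : Prop := step_start s = u /\ step_end s = v.

Lemma step_ends (s t : step Q) : s.1 = t.1 ->
  (step_start s = step_start t /\ step_end s = step_end t) \/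
  (step_start s = step_end t /\ step_end s = step_start t).
Proof.
case: s t => a [] [b []] /= ->; by [left | right].
Qed.

Fixpoint steps_along u (s : seq V) (st : seq (step Q)) : Prop :=
  match s, st with
  | [::], [::] => True
  | v :: s', t :: st' => step_between u v t /\ steps_along v s' st'
  | _, _ => False
  end.

Lemma steps_exist u s : path (@linked Q) u s -> exists st, steps_along u s st.
Proof.
elim: s u => [|v s IHs] u /=; first by exists [::].
case/andP => uv /IHs[st sts].
have [t tuv] : exists t, step_between u v t.
  move: uv; rewrite linked_rel => /orP[/arrow_relP[a [au av]]|/arrow_relP[a [av au]]].
    by exists (a, true).
  by exists (a, false).
by exists (t :: st).
Qed.

Lemma steps_starts u s st : steps_along u s st -> map (@step_start Q) st = belast u s.
Proof. by elim: s u st => [|v s IHs] u [|t st] //= [[-> _] /IHs ->]. Qed.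

Lemma steps_path u s st t : steps_along u s st -> step_end t = u ->
  path (fun x y : step Q => step_end x == step_start y) t st /\
  step_end (last t st) = last u s.
Proof.
elim: s u st t => [|v s IHs] u [|x st] t //= [[xu xv] sts] tu.
by rewrite tu xu eqxx; exact: IHs sts xv.
Qed.

Lemma steps_verts u s st t : steps_along u s st -> t \in st ->
  step_start t \in u :: s /\ step_end t \in u :: s.
Proof.
elim: s u st => [|v s IHs] u [|x st] //= [[xu xv] sts]; rewrite inE => /orP[/eqP->|ts].
  by rewrite xu xv !inE !eqxx orbT.
by have [h1 h2] := IHs _ _ sts ts; split; rewrite inE ?h1 ?h2 orbT.
Qed.

Lemma steps_uniq u s st : steps_along u s st -> uniq (u :: s) -> uniq (map fst st).
Proof.
elim: s u st => [|v s IHs] u [|x st] // [[xu xv] sts].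
rewrite cons_uniq => /andP[us uvs]; rewrite map_cons cons_uniq (IHs _ _ sts uvs) andbT.
apply/mapP => -[t ts xt]; have [h1 h2] := steps_verts sts ts.
have ux : u \in v :: s by rewrite -xu; have [[-> _]|[-> _]] := step_ends xt.
by rewrite ux in us.
Qed.

Lemma steps_rcons u s v st t : steps_along u (rcons s v) (rcons st t) ->
  steps_along u s st /\ step_between (last u s) v t.
Proof.
elim: s u st => [|w s IHs] u [|p st] //=.
- by case.
- by case=> _; case: st.
- by case=> _; case: s {IHs}.
by move=> [up /IHs[h1 h2]].
Qed.

(** Each edge is lifted to a step. The point is that the arrows are distinct: two steps along one
    arrow have the same two ends, which in a cycle of distinct vertices forces length 2. *)
Lemma vertex_cycle c : uniq c -> (2 < size c)%N -> cycle (@linked Q) c ->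
  exists st, graph_cycle st /\ exists x s, c = x :: s /\ steps_along x (rcons s x) st.
Proof.
case: c => [|x [|y [|z r]]] // uc _ cc; set s := [:: y, z & r] in uc cc *.
have [st sts] := steps_exist (cc : path (@linked Q) x (rcons s x)).
exists st; split; last by exists x, s.
have starts := steps_starts sts; rewrite belast_rcons in starts.
case/lastP: st sts starts => [|st t] sts starts; first by [].
have [sts' [t1 t2]] := steps_rcons sts.
apply/and4P; split.
- by rewrite -size_eq0 size_rcons.
- case: st sts' {starts sts} => [|p st] //= [[px py] sts'].
  have [pp pl] := steps_path (sts' : steps_along y (z :: r) st) py.
  by rewrite !rcons_path pp last_rcons pl t1 t2 px !eqxx.
- by rewrite starts.
rewrite map_rcons rcons_uniq (steps_uniq sts' uc) andbT.
apply/mapP => -[p pst tp].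
have xs : x \notin s by move: uc; rewrite cons_uniq => /andP[].
have ls : last x s \in z :: r by rewrite /s /= mem_last.
case: st sts' pst {starts sts} => [|p0 st] // [[p0x p0y] sts'].
rewrite inE => /orP[/eqP e|pst].
  have yzr : y \notin z :: r by move: uc => /= /and3P[].
  have := step_ends tp; rewrite e t1 t2 p0x p0y => -[[e1 _]|[e1 _]].
    by move: xs; rewrite /s -e1 inE ls orbT.
  by move: yzr; rewrite -e1 ls.
have [h1 h2] := steps_verts (sts' : steps_along y (z :: r) st) pst.
have xin : x \in s by rewrite -t2; have [[_ ->]|[_ ->]] := step_ends tp.
by rewrite xin in xs.
Qed.

Lemma steps_forward u s st : steps_along u s st ->
  (all (fun t => t.2) st -> path arrow_rel u s) /\
  (all (fun t => ~~ t.2) st -> path (rev_rel arrow_rel) u s).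
Proof.
elim: s u st => [|v s IHs] u [|[a b] st] // [[tu tv] /IHs[h1 h2]]; split=> /= /andP[ab].
  move/h1 => ->; rewrite andbT; apply/arrow_relP; exists a.
  by move: tu tv; rewrite ab.
move/h2 => ->; rewrite andbT; apply/arrow_relP; exists a.
by move: tu tv; rewrite (negPf ab).
Qed.

Lemma gentle_cycles c : uniq c -> (2 < size c)%N ->
  cycle (fun u v => arrow_rel u v || arrow_rel v u) c ->
  cycle arrow_rel c \/ cycle (rev_rel arrow_rel) c.
Proof.
move=> uc c2 cc; have [st [gst [x [s [-> sts]]]]] := vertex_cycle uc c2 cc.
have [/orP[o|o] _] := cycI gst; have [h1 h2] := steps_forward sts; [left|right].
  exact: h1.
exact: h2.
Qed.

Lemma gentle_cycle_rel u v w r : uniq [:: u, v, w & r] -> cycle arrow_rel [:: u, v, w & r] ->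
  zero_rel u v w.
Proof.
move=> uc cc.
have cl : cycle (@linked Q) [:: u, v, w & r].
  by apply: sub_cycle cc => x y; rewrite linked_rel => ->.
have [st [gst [x [s [e sts]]]]] := vertex_cycle uc isT cl.
case: e sts => <- <-; case: st gst => [|p [|q st]] gst //; first by case.
case=> [[pu pv] [[qv qw] _]].
have [euv evw] : arrow_rel u v /\ arrow_rel v w by move: cc => /= /and3P[].
(* A backward step would use an arrow opposite to an existing one, and there are no 2-cycles. *)
have fwd t y z : step_between y z t -> arrow_rel y z -> src t.1 = y /\ tgt t.1 = z.
  case: t => a [] // [ty tz] yz; have := gr_2cycle gentle_arrow_rel yz.
  by case/negP; apply/arrow_relP; exists a.
have [p1 p2] := fwd p u v (conj pu pv) euv; have [q1 q2] := fwd q v w (conj qv qw) evw.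
have [_ rf] := cycI gst.
rewrite -p1 -q2 -[v]p2; apply/zero_relP; first by rewrite p2.
by apply: rf; rewrite ?inE ?eqxx ?orbT // p2.
Qed.

End GentleQuiver.

Section TilingOfRealisation.
Variables (k : fieldType) (Q : quiver) (I : ideal (pathalg k Q)).
Hypothesis gp : gentle_presentation I.
Hypothesis cycI : forall c : seq (step Q), graph_cycle c -> oriented c /\ relation_full I c.
Variables (m : nat) (f : vert Q -> nat * nat).
Hypothesis real : realises (@arrow_rel Q) (zero_rel I) [set: vert Q] m f.
Local Notation V := (vert Q).

Let Sf : arcs [set: V] m f. Proof. by case: real. Qed.
Let f2m v : ((f v).2 < m)%N := arc_m Sf (in_setT v).
Let f12 v : ((f v).1 < (f v).2)%N := arc_lt Sf (in_setT v).
Let f1m v : ((f v).1 < m)%N := ltn_trans (f12 v) (f2m v).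

Definition diag_of v : 'I_m * 'I_m := (Ordinal (f1m v), Ordinal (f2m v)).
Definition realised_tiling : {set 'I_m * 'I_m} := [set diag_of v | v : V].
Local Notation T := realised_tiling.

Lemma realised_is_tiling : is_tiling T.
Proof.
split=> [d /imsetP[v _ ->]|d e /imsetP[v _ ->] /imsetP[w _ ->]]; first exact: f12.
exact: (arc_nc Sf (in_setT v) (in_setT w)).
Qed.

Lemma diag_of_in v : diag_of v \in T.
Proof. exact: imset_f. Qed.

Definition tdiag_of v : tdiag T := exist _ (diag_of v) (diag_of_in v).

Lemma arc_tdiag_of v : arc (tdiag_of v) = f v.
Proof. by rewrite [RHS]surjective_pairing. Qed.

Lemma tdiag_of_inj : injective tdiag_of.
Proof.
move=> v w /(congr1 (@arc m T)); rewrite !arc_tdiag_of.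
by apply: (arc_inj Sf); rewrite in_setT.
Qed.

Lemma tdiag_of_surj d : exists v, tdiag_of v = d.
Proof.
by have /imsetP[v _ e] := valP d; exists v; apply: val_inj.
Qed.

Lemma nxt_tdiag_of x u v :
  nxt (@arc m T) [set: tdiag T] x (tdiag_of u) (tdiag_of v) <-> nxt f [set: V] x u v.
Proof.
rewrite /nxt /before !arc_tdiag_of.
split=> -[iu iv uv nuv]; split=> // w _; last first.
  by have [w' <-] := tdiag_of_surj w; rewrite arc_tdiag_of; apply: nuv; rewrite in_setT.
by have := nuv (tdiag_of w); rewrite arc_tdiag_of; apply; rewrite in_setT.
Qed.

Lemma tarrow_tdiag_of u v : tarrow (tdiag_of u) (tdiag_of v) <-> arrow_rel u v.
Proof.
have [_ fE _] := real; rewrite (fE u v (in_setT u) (in_setT v)).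
by split=> [/(tarrowP realised_is_tiling)|] [x xuv]; last apply/(tarrowP realised_is_tiling);
  exists x; apply/nxt_tdiag_of.
Qed.

Lemma arr_of_subproof (a : arr Q) : tarrow (tdiag_of (src a)) (tdiag_of (tgt a)).
Proof. by apply/tarrow_tdiag_of/arrow_relP; exists a. Qed.

Definition arr_of (a : arr Q) : arr (tiling_quiver T) :=
  exist _ (tdiag_of (src a), tdiag_of (tgt a)) (arr_of_subproof a).

Lemma realised_tiling_iso : alg_isomorphic (quotalg I) (tiling_algebra T k).
Proof.
have [[noloop _] _ _ _ [S [S2 IS]]] := gp.
apply: (@quiver_iso k Q (tiling_quiver T) I (tiling_ideal T k) S (@tiling_rel_path m T)
  tdiag_of arr_of) => //.
- by apply: inj_surj_bij; [exact: tdiag_of_inj | exact: tdiag_of_surj].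
- apply: inj_surj_bij => [a b /(congr1 val) e|b].
    by apply: (no_parallel noloop cycI); apply: tdiag_of_inj;
      [exact: (congr1 fst e) | exact: (congr1 snd e)].
  have [u su] := tdiag_of_surj (src b); have [v tv] := tdiag_of_surj (tgt b).
  have : arrow_rel u v by apply/tarrow_tdiag_of; rewrite su tv; exact: (valP b).
  by case/arrow_relP => a [au av]; exists a; apply: arr_eq; rewrite -?su -?tv -?au -?av.
- exact: tiling_rel_length.
- exact: tiling_idealE.
move=> a b ab; have ab' : tgt (arr_of a) = src (arr_of b) by congr tdiag_of.
have arr_nxt_f c : exists x, nxt f [set: V] x (src c) (tgt c).
  have [x xc] := arr_nxt realised_is_tiling (arr_of c).
  by exists x; apply/nxt_tdiag_of.
have [x xa] := arr_nxt_f a; have [y yb] := arr_nxt_f b.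
have xa' : nxt (@arc m T) [set: tdiag T] x (src (arr_of a)) (tgt (arr_of a)).
  exact/nxt_tdiag_of.
have yb' : nxt (@arc m T) [set: tdiag T] y (src (arr_of b)) (tgt (arr_of b)).
  exact/nxt_tdiag_of.
apply: (iff_trans _ (iff_sym (tiling_arrows k ab'))).
apply: (iff_trans _ (iff_sym (tiling_relationP realised_is_tiling ab' xa' yb'))).
rewrite -ab in yb; have [_ _ fR] := real.
have e := fR _ _ _ _ _ (in_setT _) (in_setT _) (in_setT _) xa yb.
apply: (iff_trans (rwP (zero_relP gp cycI ab))); rewrite e.
by split=> /eqP.
Qed.

End TilingOfRealisation.

Section MoritaVertices.
Variables (k : fieldType) (Q Q' : quiver).
Variables (I : ideal (pathalg k Q)) (I' : ideal (pathalg k Q')).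
Hypothesis admI : admissible I.
Hypothesis gp : gentle_presentation I'.
Hypothesis mor : morita_equivalent (quotalg I) (quotalg I').

Lemma gentle_small x : I' x -> forall p, p \in msupp x -> (2 <= plength p)%N.
Proof. by have [_ _ _ _ [S [S2 IS]]] := gp; apply: (quad_small S2 IS). Qed.

Lemma morita_vertices : exists (kappa : vert Q -> vert Q') (kappa' : vert Q' -> vert Q)
    (Psi : {rmorphism quotalg I -> quotalg I'}) (Phi : {rmorphism quotalg I' -> quotalg I}),
  [/\ cancel kappa kappa' /\ cancel kappa' kappa, cancel Psi Phi /\ cancel Phi Psi,
      (forall c, Psi (kalg_in (quotalg I) c) = kalg_in (quotalg I') c) /\
      (forall c, Phi (kalg_in (quotalg I') c) = kalg_in (quotalg I) c) &
      (forall i, Psi (qe I i) = qe I' (kappa i)) /\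
      (forall i, Phi (qe I' i) = qe I (kappa' i))].
Proof.
have [_ _ _ _ [S [S2 IS]]] := gp; have [F eqF] := mor.
have [pg] := equivalence_progenerator eqF.
have [kappa [Phi [[kappa' kK k'K] Phib Phik Phie]]] := basic_morita admI S2 IS pg.
have [Psi PhiK PsiK] := Phib.
have PB : zmod_morphism Psi.
  by move=> x y; apply: (can_inj PhiK); rewrite [RHS]rmorphB !PsiK.
have PM : monoid_morphism Psi.
  by split=> [|x y]; apply: (can_inj PhiK); rewrite ?rmorph1 ?(rmorphM Phi) !PsiK.
pose Psi' : {rmorphism quotalg I -> quotalg I'} := HB.pack Psi
  (GRing.isZmodMorphism.Build _ _ Psi PB) (GRing.isMonoidMorphism.Build _ _ Psi PM).
have PsiE x : Psi' (Phi x) = x by exact: PhiK.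
exists kappa, kappa', Psi', Phi; split=> //.
  by split=> // c; rewrite -Phik PsiE.
by split=> i; [rewrite -Phie PsiE | rewrite -Phie k'K].
Qed.

End MoritaVertices.

Theorem proposition3p2 (k : closedFieldType) (Q : quiver)
    (I : ideal (pathalg k Q))
    (admI : admissible I) (connA : alg_connected (quotalg I)) :
  (exists (m : nat) (T : {set 'I_m * 'I_m}),
     [/\ (2 <= m)%N, is_tiling T &
         alg_isomorphic (quotalg I) (tiling_algebra T k)])
  <->
  (gentle (quotalg I) /\
   forall c : seq (step Q), graph_cycle c -> oriented c /\ relation_full I c).
Proof.
split=> [[m [T [_ Ttil iso]]]|[[Q' [I' [gp mor]]] cyc]].
  have gp := tiling_gentle k Ttil.
  have mor := alg_iso_morita iso.
  split; first by exists (tiling_quiver T), (tiling_ideal T k).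
  have [kappa [kappa' [Psi [Phi [[kK k'K] [PsiK PhiK] [Psik Phik] [Psie Phie]]]]]] :=
    morita_vertices admI gp mor.
  have [[noloop _] _ _ _ _] := gp.
  (* The transfer runs from the tiling quiver to [Q], so the two inverse isomorphisms exchange their
     roles. *)
  exact: (transfer_cycles (gentle_small gp) admI.1 k'K kK PsiK Phik Psik Phie Psie
    noloop (tiling_cycles k Ttil)).
have [kappa [kappa' [Psi [Phi [[kK k'K] [PsiK PhiK] [Psik Phik] [Psie Phie]]]]]] :=
  morita_vertices admI gp mor.
have [[noloop' _] _ _ _ _] := gp.
(* [Q] is first shown to have no loops, on which the transfer of the cycle condition to [Q']
   relies. *)
have noloop := transfer_noloop (gentle_small gp) admI.1 k'K kK PsiK Phik Phie Psie noloop'.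
have cyc' := transfer_cycles admI.1 (gentle_small gp) kK k'K PhiK Psik Phik Psie Phie
  noloop cyc.
have isoII' : alg_isomorphic (quotalg I) (quotalg I').
  by exists Psi; split=> //; exists Phi.
have con' := alg_connected_iso isoII' connA.
have conV := quiver_connected (gentle_small gp) con'.
(* A connected algebra is nonzero, so there is a vertex to start from; its arc also forces two
   marked points. *)
have [v0] : inhabited (vert Q').
  apply: contrapT => noV; case: con' => + _; apply.
  rewrite -(qe_sum1 I') big1 // => v _.
  by case: noV.
have [m [f real]] := realisation_exists (gentle_arrow_rel gp cyc')
  (gentle_cycle_rel gp cyc') (gentle_cycles cyc') conV v0.
exists m, (realised_tiling real); split.
- have [Sf _ _] := real; have := arc_lt Sf (in_setT v0); have := arc_m Sf (in_setT v0).
  by case: (f v0) => a b /=; clear; lia.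
- exact: realised_is_tiling.
exact: alg_iso_trans isoII' (realised_tiling_iso gp cyc' real).
Qed.
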